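(* Let $\Lambda$ be an artin algebra and let $(\Theta,\mathbf{Q},\leq)$ be an Ext-injective stratifying system of size $t$ in $\mathrm{mod}(\Lambda)$, where $\mathbf{Q}=\{Q(i)\}_{i=1}^t$ is a set of pairwise non-isomorphic indecomposable $\Lambda$-modules. Let $Q=\bigoplus_{i=1}^tQ(i)$, $\Gamma=\mathrm{End}_\Lambda(Q)^{op}$ and $G=Q\otimes_\Gamma-$. Then the following conditions are equivalent. (a) There exists a family $\Psi=\{\Psi(i)\}_{i=1}^t$ in $\mathrm{mod}(\Lambda)$ such that $(\Psi,\mathbf{Q},\leq)$ is a proper costratifying system. (b) $\mathrm{Tor}^\Gamma_1(Q,{}_\Gamma\overline{\Delta}(i))=0$ and $\mathrm{Ext}^1_\Lambda(Q,G({}_\Gamma\overline{\Delta}(i)))=0$ for all $i\in[1,t]$. If these conditions hold, the system $(\Psi,\mathbf{Q},\leq)$ is uniquely determined (up to isomorphism) and $\Psi(i)\simeq G({}_\Gamma\overline{\Delta}(i))$ for all $i\in[1,t]$.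
   Context: $\Lambda$ is an artin $R$-algebra ($R$ a commutative artinian ring); for an artin algebra $A$, $\mathrm{mod}(A)$ is the category of finitely generated left $A$-modules; $[1,t]=\{1,\dots,t\}$. For a class $\mathcal{X}$ of modules, $\mathcal{F}(\mathcal{X})$ is the class of modules having a finite filtration with all factors isomorphic to modules in $\mathcal{X}$ (it contains $0$). A proper costratifying system $(\Psi,\mathbf{Q},\leq)$ of size $t$ in $\mathrm{mod}(\Lambda)$ consists of two families of $\Lambda$-modules $\Psi=\{\Psi(i)\}_{i=1}^t$ and $\mathbf{Q}=\{Q(i)\}_{i=1}^t$, with $Q(i)$ indecomposable for all $i$, and a linear order $\leq$ on $[1,t]$ such that: (a) $\mathrm{End}_\Lambda(\Psi(i))$ is a division ring for all $i$; (b) $\mathrm{Hom}_\Lambda(\Psi(i),\Psi(j))=0$ if $i<j$; (c) for each $i$ there is an exact sequence $0\to Z(i)\to Q(i)\to\Psi(i)\to 0$ with $Z(i)\in\mathcal{F}(\{\Psi(j):j\leq i\})$; (d) $\mathrm{Ext}^1_\Lambda(Q(i),\Psi(j))=0$ for all $i,j\in[1,t]$. An Ext-injective stratifying system $(\Theta,\underline{Y},\leq)$ of size $t$ in $\mathrm{mod}(\Lambda)$ consists of two families of non-zero $\Lambda$-modules $\Theta=\{\Theta(i)\}_{i=1}^t$ and $\underline{Y}=\{Y(i)\}_{i=1}^t$, with $Y(i)$ indecomposable for all $i$, and a linear order $\leq$ on $[1,t]$ such that: (a) $\mathrm{Hom}_\Lambda(\Theta(i),\Theta(j))=0$ if $i>j$;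 (b) for each $i$ there is an exact sequence $0\to\Theta(i)\to Y(i)\to Z(i)\to0$ with $Z(i)\in\mathcal{F}(\{\Theta(j):j<i\})$; (c) $\mathrm{Ext}^1_\Lambda(\Theta(j),Y)=0$ for all $j$, where $Y=\bigoplus_{i=1}^tY(i)$. $Q$ is a left module over $\mathrm{End}_\Lambda(Q)=\Gamma^{op}$, i.e. a right $\Gamma$-module. The indecomposable projective $\Gamma$-modules are indexed as ${}_\Gamma P(i)=\mathrm{Hom}_\Lambda(Q,Q(i))$, $i\in[1,t]$. Let $\leq^{op}$ be the opposite order of $\leq$. The proper standard $\Gamma$-modules (computed with the order $\leq^{op}$) are ${}_\Gamma\overline{\Delta}(i)={}_\Gamma P(i)/\mathrm{Tr}_{\bigoplus_{j\geq^{op}i}{}_\Gamma P(j)}(\mathrm{rad}\,{}_\Gamma P(i))$, where $\mathrm{Tr}_M(N)$ denotes the submodule of $N$ generated by the images of all morphisms $M\to N$. *)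

(* Defs.v *)
From HB Require Import structures.
From mathcomp Require Import all_boot all_algebra.
From mathcomp Require Import boolp.

Set Implicit Arguments.
Unset Strict Implicit.
Unset Printing Implicit Defensive.

Import GRing.Theory.
Local Open Scope ring_scope.
Local Open Scope quotient_scope.

Definition isomorphic (A : pzRingType) (M N : lmodType A) : Prop :=
  exists f : {linear M -> N}, bijective f.

Definition zero_module (A : pzRingType) (M : lmodType A) : Prop :=
  forall x : M, x = 0.

Definition surjective (X Y : Type) (f : X -> Y) : Prop :=
  forall y, exists x, f x = y.

Definition exact (X Y : Type) (Z : nmodType) (f : X -> Y) (g : Y -> Z) : Prop :=
  forall y, g y = 0 <-> exists x, f x = y.

Definition short_exact (A : pzRingType) (L M N : lmodType A) : Prop :=
  exists (f : {linear L -> M}) (g : {linear M -> N}),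
    [/\ injective f, exact f g & surjective g].

Definition indecomposable (A : pzRingType) (M : lmodType A) : Prop :=
  ~ zero_module M /\
  forall L N : lmodType A,
    isomorphic M (L * N)%type -> zero_module L \/ zero_module N.

Definition fin_gen (A : pzRingType) (M : lmodType A) : Prop :=
  exists s : seq M, forall x : M, exists c : nat -> A,
    x = \sum_(k < size s) c k *: s`_k.

Definition division_ring (D : pzRingType) : Prop :=
  1 <> 0 :> D /\
  forall x : D, x <> 0 -> exists y : D, y * x = 1 /\ x * y = 1.

Record submodule (A : pzRingType) (M : lmodType A) : Type := Submodule {
  submod_pred :> {pred M};
  submod_predP : submod_closed submod_pred }.

HB.instance Definition _ A M (S : @submodule A M) :=
  GRing.isSubmodClosed.Build A M (submod_pred S)
    (GRing.submod_closed_semi (submod_predP S)).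

Definition artinian (R : comNzRingType) : Prop :=
  forall I : nat -> submodule R^o,
    (forall n, {subset I n.+1 <= I n}) ->
    exists N, forall n, (N <= n)%N -> I n =i I N.

Definition artin_algebra (R : comNzRingType) (Lam : algType R) : Prop :=
  artinian R /\ fin_gen (Lam : lmodType R).

Definition lin_hom (A : pzRingType) (U V : lmodType A) : Type :=
  {linear U -> V}.

Section HomZmodule.
Variables (A : pzRingType) (U V : lmodType A).
Local Notation lin_hom := (lin_hom U V).

HB.instance Definition _ := gen_eqMixin lin_hom.
HB.instance Definition _ := gen_choiceMixin lin_hom.

Lemma homP (f g : lin_hom) : f =1 g -> f = g.
Proof.
case: f g => [f cf] [g cg] /= /funext fg; case: _ / fg in cg *.
congr GRing.Linear.Pack.
case: cf cg => [[fD] [fZ]] [[gD] [gZ]].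
by rewrite (Prop_irrelevance gD fD) (Prop_irrelevance gZ fZ).
Qed.

Definition hom0 : lin_hom := \0 : {linear U -> V}.
Definition homN (f : lin_hom) : lin_hom := GRing.opp \o f : {linear U -> V}.
Definition homD (f g : lin_hom) : lin_hom := f \+ g : {linear U -> V}.

Fact homDA : associative homD.
Proof. by move=> f g h; apply: homP => x /=; rewrite addrA. Qed.
Fact homDC : commutative homD.
Proof. by move=> f g; apply: homP => x /=; rewrite addrC. Qed.
Fact hom0D : left_id hom0 homD.
Proof. by move=> f; apply: homP => x /=; rewrite add0r. Qed.
Fact homND : left_inverse hom0 homN homD.
Proof. by move=> f; apply: homP => x /=; rewrite addNr. Qed.

HB.instance Definition _ :=
  GRing.isZmodule.Build lin_hom homDA homDC hom0D homND.

End HomZmodule.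

Definition endo (A : pzRingType) (U : lmodType A) : Type := lin_hom U U.

Section EndoRing.
Variables (A : pzRingType) (U : lmodType A).
Local Notation endo := (endo U).

HB.instance Definition _ := GRing.Zmodule.on endo.

Definition endo1 : endo := idfun : {linear U -> U}.
Definition endoM (f g : endo) : endo :=
  (f : {linear U -> U}) \o (g : {linear U -> U}) : {linear U -> U}.

Fact endoMA : associative endoM.
Proof. by move=> f g h; apply: homP. Qed.
Fact endo1M : left_id endo1 endoM.
Proof. by move=> f; apply: homP. Qed.
Fact endoM1 : right_id endo1 endoM.
Proof. by move=> f; apply: homP. Qed.
Fact endoMDl : left_distributive endoM +%R.
Proof. by move=> f g h; apply: homP. Qed.
Fact endoMDr : right_distributive endoM +%R.
Proof. by move=> f g h; apply: homP => x; exact: linearD. Qed.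

HB.instance Definition _ :=
  GRing.Zmodule_isPzRing.Build endo endoMA endo1M endoM1 endoMDl endoMDr.

End EndoRing.

Definition opendo (A : pzRingType) (U : lmodType A) : pzRingType := (endo U)^c.

(** [Hom(U, V)] is a left module over the opposite of [End(U)], by
    precomposition. *)
Section HomLmodule.
Variables (A : pzRingType) (U V : lmodType A).

Definition hom_scale (a : opendo U) (f : lin_hom U V) : lin_hom U V :=
  (f : {linear U -> V}) \o (a : {linear U -> U}) : {linear U -> V}.

Fact hom_scaleA a b f : hom_scale a (hom_scale b f) = hom_scale (a * b) f.
Proof. exact: homP. Qed.
Fact hom_scale1 : left_id 1 hom_scale.
Proof. by move=> f; apply: homP. Qed.
Fact hom_scaleDr : right_distributive hom_scale +%R.
Proof. by move=> a f g; apply: homP. Qed.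
Fact hom_scaleDl f : {morph hom_scale^~ f : a b / a + b}.
Proof. by move=> a b; apply: homP => x; exact: linearD. Qed.

HB.instance Definition _ :=
  GRing.Zmodule_isLmodule.Build (opendo U) (lin_hom U V)
  hom_scaleA hom_scale1 hom_scaleDr hom_scaleDl.

End HomLmodule.

Definition dsum (A : pzRingType) (I : finType) (M : I -> lmodType A) : Type :=
  {dffun forall i, M i}.

Section DirectSum.
Variables (A : pzRingType) (I : finType) (M : I -> lmodType A).
Local Notation dsum := (dsum M).
Implicit Types x y : dsum.

HB.instance Definition _ := Choice.on dsum.

Definition dsum0 : dsum := [ffun i => 0 : M i].
Definition dsumN x : dsum := [ffun i => - x i : M i].
Definition dsumD x y : dsum := [ffun i => x i + y i : M i].
Definition dsumZ (a : A) x : dsum := [ffun i => a *: x i : M i].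

Fact dsumDA : associative dsumD.
Proof. by move=> x y z; apply/ffunP => i; rewrite !ffunE addrA. Qed.
Fact dsumDC : commutative dsumD.
Proof. by move=> x y; apply/ffunP => i; rewrite !ffunE addrC. Qed.
Fact dsum0D : left_id dsum0 dsumD.
Proof. by move=> x; apply/ffunP => i; rewrite !ffunE add0r. Qed.
Fact dsumND : left_inverse dsum0 dsumN dsumD.
Proof. by move=> x; apply/ffunP => i; rewrite !ffunE addNr. Qed.

HB.instance Definition _ :=
  GRing.isZmodule.Build dsum dsumDA dsumDC dsum0D dsumND.

Fact dsumZA a b x : dsumZ a (dsumZ b x) = dsumZ (a * b) x.
Proof. by apply/ffunP => i; rewrite !ffunE scalerA. Qed.
Fact dsum1Z : left_id 1 dsumZ.
Proof. by move=> x; apply/ffunP => i; rewrite !ffunE scale1r. Qed.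
Fact dsumZDr : right_distributive dsumZ +%R.
Proof. by move=> a x y; apply/ffunP => i; rewrite !ffunE scalerDr. Qed.
Fact dsumZDl x : {morph dsumZ^~ x : a b / a + b}.
Proof. by move=> a b; apply/ffunP => i; rewrite !ffunE scalerDl. Qed.

HB.instance Definition _ :=
  GRing.Zmodule_isLmodule.Build A dsum dsumZA dsum1Z dsumZDr dsumZDl.

End DirectSum.

Definition sub_of (A : pzRingType) (M : lmodType A) (S : submodule M) : Type :=
  {x : M | x \in S}.

HB.instance Definition _ A M S := SubChoice.on (@sub_of A M S).
HB.instance Definition _ A M S :=
  [SubChoice_isSubLmodule of @sub_of A M S by <:].

Definition quo (A : pzRingType) (M : lmodType A) (S : submodule M) : Type :=
  Quotient.quot S.

Section QuotientModule.
Variables (A : pzRingType) (M : lmodType A) (S : submodule M).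
Local Notation quo := (quo S).

HB.instance Definition _ := GRing.Zmodule.on quo.

Definition quo_proj (x : M) : quo := \pi_(Quotient.quot S) x.
Definition quoZ (a : A) (x : quo) : quo :=
  quo_proj (a *: repr (x : Quotient.quot S)).

Lemma proj_eq x y : (quo_proj x = quo_proj y) <-> (x - y \in S).
Proof. by rewrite Quotient.idealrBE; split => /eqP. Qed.

Lemma projD : {morph quo_proj : x y / x + y}.
Proof. move=> x y; exact: Quotient.pi_add. Qed.

Lemma projK (x : quo) : quo_proj (repr (x : Quotient.quot S)) = x.
Proof. exact: reprK. Qed.

Lemma projZ a x : quo_proj (a *: x) = quoZ a (quo_proj x).
Proof.
apply/proj_eq; rewrite -scalerBr; apply: rpredZ; apply/proj_eq.
by rewrite projK.
Qed.

Fact quoZA a b x : quoZ a (quoZ b x) = quoZ (a * b) x.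
Proof. by rewrite -(projK x) -!projZ scalerA. Qed.
Fact quo1Z : left_id 1 quoZ.
Proof. by move=> x; rewrite -(projK x) -projZ scale1r. Qed.
Fact quoZDr : right_distributive quoZ +%R.
Proof.
move=> a x y; rewrite -(projK x) -(projK y) -!(projZ, projD).
by rewrite scalerDr.
Qed.
Fact quoZDl x : {morph quoZ^~ x : a b / a + b}.
Proof. by move=> a b; rewrite -(projK x) -!projZ -projD scalerDl. Qed.

HB.instance Definition _ :=
  GRing.Zmodule_isLmodule.Build A quo quoZA quo1Z quoZDr quoZDl.

Fact proj_is_linear : linear (quo_proj : M -> quo).
Proof. by move=> a x y; rewrite projD projZ. Qed.

HB.instance Definition _ :=
  GRing.isLinear.Build A M quo *:%R quo_proj proj_is_linear.

End QuotientModule.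

(** [T / (S :&: T)], used only for [S] contained in [T]. *)
Section Subquotient.
Variables (A : pzRingType) (M : lmodType A) (T S : submodule M).

Fact restr_submod_closed :
  submod_closed [pred x : sub_of T | val x \in S].
Proof.
split=> [|a x y]; rewrite !inE ?GRing.val0 ?rpred0 // => xS yS.
by rewrite GRing.valD GRing.valZ rpredD ?rpredZ.
Qed.

Definition subquo : lmodType A := quo (Submodule restr_submod_closed).

End Subquotient.

Section GeneratedSubmodule.
Variables (A : pzRingType) (M : lmodType A) (G : M -> Prop).

Definition gen_pred : {pred M} := fun x =>
  `[< forall S : submodule M, (forall y, G y -> y \in S) -> x \in S >].

Fact gen_submod_closed : submod_closed gen_pred.
Proof.
split=> [|a x y /asboolP xG /asboolP yG]; apply/asboolP => S GS.
  exact: rpred0.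
by rewrite rpredD ?rpredZ ?xG ?yG.
Qed.

Definition gen_submodule : submodule M := Submodule gen_submod_closed.

End GeneratedSubmodule.

Section Radical.
Variables (A : pzRingType) (M : lmodType A).

Definition maximal_submodule (S : submodule M) : Prop :=
  (exists x, x \notin S) /\
  forall T : submodule M, {subset S <= T} -> (exists x, x \notin T) -> T =i S.

Definition rad_pred : {pred M} := fun x =>
  `[< forall S : submodule M, maximal_submodule S -> x \in S >].

Fact rad_submod_closed : submod_closed rad_pred.
Proof.
split=> [|a x y /asboolP xR /asboolP yR]; apply/asboolP => S maxS.
  exact: rpred0.
by rewrite rpredD ?rpredZ ?xR ?yR.
Qed.

Definition radical : submodule M := Submodule rad_submod_closed.

End Radical.

(** The trace of [X] in the submodule [N] of [M]; morphisms [X -> N] are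
    morphisms [X -> M] with image in [N]. *)
Definition trace (A : pzRingType) (X M : lmodType A) (N : submodule M) :
    submodule M :=
  gen_submodule (fun y => exists f : {linear X -> M},
    (forall v, f v \in N) /\ exists v, f v = y).

(** [M] has a filtration [0 = S 0 <= ... <= S n = M] whose factors are
    isomorphic to modules [F j] with [j] in [P]. *)
Definition filtered (A : pzRingType) (I : Type) (F : I -> lmodType A)
    (P : pred I) (M : lmodType A) : Prop :=
  exists (n : nat) (S : nat -> submodule M),
    [/\ forall x, x \in S 0 -> x = 0,
        forall x, x \in S n &
        forall k, (k < n)%N -> {subset S k <= S k.+1} /\
          exists2 j, P j & isomorphic (subquo (S k.+1) (S k)) (F j)].

Definition projective (A : pzRingType) (P : lmodType A) : Prop :=
  forall (M N : lmodType A) (g : {linear M -> N}) (f : {linear P -> N}),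
    surjective g -> exists h : {linear P -> M}, forall x, g (h x) = f x.

(** The part of a projective resolution in degrees at most 2, which is all
    that degree 1 (co)homology depends on. *)
Definition proj_resolution (A : pzRingType) (P2 P1 P0 M : lmodType A)
    (d2 : {linear P2 -> P1}) (d1 : {linear P1 -> P0}) (e : {linear P0 -> M}) :
    Prop :=
  [/\ projective P2, projective P1 & projective P0] /\
  [/\ exact d2 d1, exact d1 e & surjective e].

Definition hom_precomp (A : pzRingType) (U V Y : lmodType A)
    (d : {linear U -> V}) (f : lin_hom V Y) : lin_hom U Y :=
  (f : {linear V -> Y}) \o d : {linear U -> Y}.

(** [Ext^1(X, Y) = 0], as the vanishing of the cohomology in degree 1 of
    [Hom(P, Y)], for projective resolutions [P] of [X]; the choice of [P] is
    immaterial. *)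
Definition Ext1_eq0 (A : pzRingType) (X Y : lmodType A) : Prop :=
  forall (P2 P1 P0 : lmodType A)
    (d2 : {linear P2 -> P1}) (d1 : {linear P1 -> P0}) (e : {linear P0 -> X}),
    proj_resolution d2 d1 e ->
    exact (@hom_precomp A P1 P0 Y d1) (@hom_precomp A P2 P1 Y d2).

(** The tensor product [Q (x)_Gamma M] for [Gamma = End(Q)^op], where [Gamma]
    acts on the right of [Q] by [q a = a q], as a left module over the base
    ring of [Q].  Its elements are formal sums of pairs [(q, m)], modulo the
    bilinear and balanced relations. *)
Section Tensor.
Variables (A : pzRingType) (Q : lmodType A).
Local Notation Gamma := (opendo Q).

Definition right_act (q : Q) (a : Gamma) : Q := (a : {linear Q -> Q}) q.

Section Construction.
Variable M : lmodType Gamma.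
Implicit Types s : seq (Q * M).

Inductive tens_rel : seq (Q * M) -> seq (Q * M) -> Prop :=
| TensRefl s : tens_rel s s
| TensSym s1 s2 : tens_rel s1 s2 -> tens_rel s2 s1
| TensTrans s1 s2 s3 : tens_rel s1 s2 -> tens_rel s2 s3 -> tens_rel s1 s3
| TensCat s1 s2 s3 s4 :
    tens_rel s1 s2 -> tens_rel s3 s4 -> tens_rel (s1 ++ s3) (s2 ++ s4)
| TensComm s1 s2 : tens_rel (s1 ++ s2) (s2 ++ s1)
| TensZero m : tens_rel [:: (0, m)] [::]
| TensAddl q1 q2 m : tens_rel [:: (q1 + q2, m)] [:: (q1, m); (q2, m)]
| TensAddr q m1 m2 : tens_rel [:: (q, m1 + m2)] [:: (q, m1); (q, m2)]
| TensBal q (a : Gamma) m : tens_rel [:: (right_act q a, m)] [:: (q, a *: m)].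

Definition tens_relb : rel (seq (Q * M)) := fun s1 s2 => `[< tens_rel s1 s2 >].

Fact tens_relb_equiv : equiv_class_of tens_relb.
Proof.
split=> [s|s1 s2|s2 s1 s3]; first exact/asboolP/TensRefl.
  by apply/asboolP/asboolP; apply: TensSym.
by move=> /asboolP r12 /asboolP r23; apply/asboolP; apply: TensTrans r12 r23.
Qed.

Canonical tens_equiv := EquivRelPack tens_relb_equiv.

Definition tensor : Type := {eq_quot tens_equiv}.

HB.instance Definition _ := Choice.on tensor.

Definition tclass s : tensor := \pi_({eq_quot tens_equiv}) s.
Definition trepr (x : tensor) : seq (Q * M) :=
  repr (x : {eq_quot tens_equiv}).
Definition tens (q : Q) (m : M) : tensor := tclass [:: (q, m)].

Lemma tclassP s1 s2 : tclass s1 = tclass s2 <-> tens_rel s1 s2.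
Proof.
split=> [/eqmodP/asboolP //|r12].
by apply/eqmodP/asboolP.
Qed.

Lemma treprK x : tclass (trepr x) = x.
Proof. exact: reprK. Qed.

Lemma trepr_tclass s : tens_rel (trepr (tclass s)) s.
Proof. by apply/tclassP; rewrite treprK. Qed.

Definition tens0 : tensor := tclass [::].
Definition tensD (x y : tensor) : tensor := tclass (trepr x ++ trepr y).
Definition mapl (f : Q -> Q) s := [seq (f p.1, p.2) | p <- s].
Definition tensN (x : tensor) : tensor := tclass (mapl -%R (trepr x)).
Definition tensZ (a : A) (x : tensor) : tensor :=
  tclass (mapl ( *:%R a) (trepr x)).

Lemma tclass_cat s1 s2 : tclass (s1 ++ s2) = tensD (tclass s1) (tclass s2).
Proof. by apply/tclassP; apply: TensCat; apply/TensSym/trepr_tclass. Qed.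

Lemma tclass_cons p s : tclass (p :: s) = tensD (tclass [:: p]) (tclass s).
Proof. exact: (tclass_cat [:: p]). Qed.

Fact tensDA : associative tensD.
Proof.
move=> x y z; rewrite -(treprK x) -(treprK y) -(treprK z).
by rewrite -!tclass_cat catA.
Qed.
Fact tensDC : commutative tensD.
Proof. by move=> x y; apply/tclassP; apply: TensComm. Qed.
Fact tens0D : left_id tens0 tensD.
Proof. by move=> x; rewrite -(treprK x) -tclass_cat. Qed.

Fact tclass_mapl (f g h : Q -> Q) s :
    (forall q m, tens_rel [:: (h q, m)] [:: (f q, m); (g q, m)]) ->
  tensD (tclass (mapl f s)) (tclass (mapl g s)) = tclass (mapl h s).
Proof.
move=> fgh; elim: s => [|[q m] s IHs]; first exact: tens0D.
rewrite [mapl f _]/= [mapl g _]/= [mapl h _]/=.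
rewrite (tclass_cons (f q, m)) (tclass_cons (g q, m)) (tclass_cons (h q, m)).
rewrite -IHs; have -> : tclass [:: (h q, m)]
  = tensD (tclass [:: (f q, m)]) (tclass [:: (g q, m)]).
  by rewrite -tclass_cat; apply/tclassP.
by rewrite !tensDA; congr tensD; rewrite -!tensDA; congr tensD; apply: tensDC.
Qed.

Fact tensND : left_inverse tens0 tensN tensD.
Proof.
move=> x; have {2}-> : x = tclass (mapl id (trepr x)).
  by rewrite -[LHS]treprK /mapl map_id_in // => -[].
rewrite (@tclass_mapl _ _ (fun=> 0)) => [|q m].
  elim: (trepr x) => //= -[q m] s IHs; rewrite tclass_cons IHs.
  have -> : tclass [:: (0, m)] = tens0 by apply/tclassP/TensZero.
  exact: tens0D.
by rewrite -(addNr q); apply: TensAddl.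
Qed.

HB.instance Definition _ :=
  GRing.isZmodule.Build tensor tensDA tensDC tens0D tensND.

Lemma tclassE s : tclass s = \sum_(p <- s) tens p.1 p.2.
Proof.
elim: s => [|[q m] s IHs]; first by rewrite big_nil.
by rewrite big_cons tclass_cons IHs.
Qed.

Lemma tensDl q1 q2 m : tens (q1 + q2) m = tens q1 m + tens q2 m.
Proof. by rewrite -[RHS]tclass_cat; apply/tclassP/TensAddl. Qed.

Lemma tensDr q m1 m2 : tens q (m1 + m2) = tens q m1 + tens q m2.
Proof. by rewrite -[RHS]tclass_cat; apply/tclassP/TensAddr. Qed.

Lemma tens_bal q (a : Gamma) m : tens (right_act q a) m = tens q (a *: m).
Proof. exact/tclassP/TensBal. Qed.

Lemma tensor_universal (W : zmodType) (h : Q -> M -> W) :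
    (forall q1 q2 m, h (q1 + q2) m = h q1 m + h q2 m) ->
    (forall q m1 m2, h q (m1 + m2) = h q m1 + h q m2) ->
    (forall q (a : Gamma) m, h (right_act q a) m = h q (a *: m)) ->
  exists g : tensor -> W,
    {morph g : x y / x + y} /\ forall q m, g (tens q m) = h q m.
Proof.
move=> hDl hDr hbal; pose H s := \sum_(p <- s) h p.1 p.2.
have Hcat s1 s2 : H (s1 ++ s2) = H s1 + H s2 by rewrite /H big_cat.
have H1 q m : H [:: (q, m)] = h q m by rewrite /H big_seq1.
have H2 p1 p2 : H [:: p1; p2] = h p1.1 p1.2 + h p2.1 p2.2.
  by rewrite /H !big_cons big_nil addr0.
have h0 m : h 0 m = 0 by apply: (addrI (h 0 m)); rewrite -hDl !addr0.
have Hrel s1 s2 : tens_rel s1 s2 -> H s1 = H s2.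
  elim=> {s1 s2} // [s1 s2 s3 _ -> _ ->|s1 s2 s3 s4 _ e _ e'|s1 s2|m|||] //.
  - by rewrite !Hcat e e'.
  - by rewrite !Hcat addrC.
  - by rewrite H1 h0 /H big_nil.
  - by move=> q1 q2 m; rewrite H1 H2 hDl.
  - by move=> q m1 m2; rewrite H1 H2 hDr.
  - by move=> q a m; rewrite !H1 hbal.
exists (fun x => H (trepr x)); split=> [x y|q m].
  by rewrite -Hcat; apply/Hrel/trepr_tclass.
by rewrite -H1; apply/Hrel/trepr_tclass.
Qed.

Lemma tens_rel_mapl (f : Q -> Q) s1 s2 :
    {morph f : x y / x + y} ->
    (forall q a, f (right_act q a) = right_act (f q) a) ->
  tens_rel s1 s2 -> tens_rel (mapl f s1) (mapl f s2).
Proof.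
move=> fD fa; have f0 : f 0 = 0 by apply: (addrI (f 0)); rewrite -fD !addr0.
elim=> {s1 s2}; rewrite /mapl /=.
- by move=> s; apply: TensRefl.
- by move=> s1 s2 _ /TensSym.
- by move=> s1 s2 s3 _ r12 _ r23; apply: TensTrans r12 r23.
- by move=> s1 s2 s3 s4 _ r12 _ r34; rewrite !map_cat; apply: TensCat.
- by move=> s1 s2; rewrite !map_cat; apply: TensComm.
- by move=> m; rewrite f0; apply: TensZero.
- by move=> q1 q2 m; rewrite fD; apply: TensAddl.
- by move=> q m1 m2; apply: TensAddr.
- by move=> q a m; rewrite fa; apply: TensBal.
Qed.

Lemma tensZ_tclass a s : tensZ a (tclass s) = tclass (mapl ( *:%R a) s).
Proof.
apply/tclassP/tens_rel_mapl; [exact: scalerDr | | exact: trepr_tclass].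
by move=> q b; rewrite /right_act linearZ.
Qed.

Lemma tensZ_tens a q m : tensZ a (tens q m) = tens (a *: q) m.
Proof. exact: tensZ_tclass. Qed.

Fact tensZA a b x : tensZ a (tensZ b x) = tensZ (a * b) x.
Proof.
rewrite -(treprK x) !tensZ_tclass; congr tclass.
by rewrite /mapl -map_comp; apply: eq_map => p /=; rewrite scalerA.
Qed.
Fact tens1Z : left_id 1 tensZ.
Proof.
move=> x; rewrite -[in RHS](treprK x); congr tclass.
by rewrite /mapl map_id_in // => -[q m] _ /=; rewrite scale1r.
Qed.
Fact tensZDr : right_distributive tensZ +%R.
Proof.
move=> a x y; rewrite -(treprK x) -(treprK y).
rewrite -[X in tensZ a X]tclass_cat !tensZ_tclass /mapl map_cat.
exact: tclass_cat.
Qed.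
Fact tensZDl x : {morph tensZ^~ x : a b / a + b}.
Proof.
move=> a b; rewrite -(treprK x) !tensZ_tclass.
symmetry; apply: tclass_mapl => q m.
by rewrite scalerDl; apply: TensAddl.
Qed.

HB.instance Definition _ :=
  GRing.Zmodule_isLmodule.Build A tensor tensZA tens1Z tensZDr tensZDl.

End Construction.

(** [tmap] is [Q (x) f]. *)
Section Functor.
Variables (M N : lmodType Gamma) (f : {linear M -> N}).

Definition mapr (s : seq (Q * M)) : seq (Q * N) := [seq (p.1, f p.2) | p <- s].
Definition tmap (x : tensor M) : tensor N := tclass (mapr (trepr x)).

Lemma tens_rel_mapr s1 s2 : tens_rel s1 s2 -> tens_rel (mapr s1) (mapr s2).
Proof.
elim=> {s1 s2}; rewrite /mapr /=.
- by move=> s; apply: TensRefl.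
- by move=> s1 s2 _ /TensSym.
- by move=> s1 s2 s3 _ r12 _ r23; apply: TensTrans r12 r23.
- by move=> s1 s2 s3 s4 _ r12 _ r34; rewrite !map_cat; apply: TensCat.
- by move=> s1 s2; rewrite !map_cat; apply: TensComm.
- by move=> m; apply: TensZero.
- by move=> q1 q2 m; apply: TensAddl.
- by move=> q m1 m2; rewrite linearD; apply: TensAddr.
- by move=> q a m; rewrite linearZ; apply: TensBal.
Qed.

Lemma tmap_tclass s : tmap (tclass s) = tclass (mapr s).
Proof. exact/tclassP/tens_rel_mapr/trepr_tclass. Qed.

Lemma tmap_tens q m : tmap (tens q m) = tens q (f m).
Proof. exact: tmap_tclass. Qed.

Fact tmap_is_linear : linear tmap.
Proof.
move=> a x y; rewrite -(treprK x) -(treprK y).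
rewrite -[a *: _]/(tensZ a _) tensZ_tclass -[_ + _]tclass_cat !tmap_tclass.
rewrite -[a *: _]/(tensZ a _) tensZ_tclass -[RHS]tclass_cat; congr tclass.
by rewrite /mapr map_cat /mapl -!map_comp.
Qed.

HB.instance Definition _ :=
  GRing.isLinear.Build A (tensor M) (tensor N) *:%R tmap tmap_is_linear.

End Functor.

(** [Tor_1(Q, M) = 0], as the vanishing of the homology in degree 1 of
    [Q (x) P], for projective resolutions [P] of [M]. *)
Definition Tor1_eq0 (M : lmodType Gamma) : Prop :=
  forall (P2 P1 P0 : lmodType Gamma)
    (d2 : {linear P2 -> P1}) (d1 : {linear P1 -> P0}) (e : {linear P0 -> M}),
    proj_resolution d2 d1 e -> exact (tmap d2) (tmap d1).

End Tensor.

Arguments Tor1_eq0 {A} Q M.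

Definition linear_order (I : eqType) (le : rel I) : Prop :=
  [/\ reflexive le, antisymmetric le, transitive le & total le].

Definition opp_order (I : Type) (le : rel I) : rel I := fun i j => le j i.

Definition strict_part (I : eqType) (le : rel I) : rel I :=
  fun i j => (i != j) && le i j.

Record proper_costratifying (A : pzRingType) (t : nat)
    (Psi Q : 'I_t -> lmodType A) (le : rel 'I_t) : Prop := {
  pcs_order : linear_order le;
  pcs_fin_gen : forall i, fin_gen (Psi i) /\ fin_gen (Q i);
  pcs_indecomposable : forall i, indecomposable (Q i);
  pcs_division : forall i, division_ring (endo (Psi i));
  pcs_hom : forall i j, strict_part le i j ->
    forall f : {linear Psi i -> Psi j}, f =1 \0;
  pcs_exact : forall i, exists2 Z : lmodType A,
    filtered Psi (fun j => le j i) Z & short_exact Z (Q i) (Psi i);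
  pcs_ext : forall i j, Ext1_eq0 (Q i) (Psi j) }.

Record ext_injective_stratifying (A : pzRingType) (t : nat)
    (Theta Y : 'I_t -> lmodType A) (le : rel 'I_t) : Prop := {
  eiss_order : linear_order le;
  eiss_fin_gen : forall i, fin_gen (Theta i) /\ fin_gen (Y i);
  eiss_neq0 : forall i, ~ zero_module (Theta i) /\ ~ zero_module (Y i);
  eiss_indecomposable : forall i, indecomposable (Y i);
  eiss_hom : forall i j, strict_part le j i ->
    forall f : {linear Theta i -> Theta j}, f =1 \0;
  eiss_exact : forall i, exists2 Z : lmodType A,
    filtered Theta (fun j => strict_part le j i) Z &
    short_exact (Theta i) (Y i) Z;
  eiss_ext : forall j, Ext1_eq0 (Theta j) (dsum Y) }.

(** The proper standard modules of a family [P] of projective modules, for the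
    order [le]. *)
Definition proper_standard (A : pzRingType) (I : finType)
    (P : I -> lmodType A) (le : rel I) (i : I) : lmodType A :=
  quo (trace (dsum (fun j : {j | le i j} => P (val j))) (radical (P i))).

(* Main.v *)
From HB Require Import structures.
Require Import Defs.
From mathcomp Require Import all_boot all_algebra.
From mathcomp Require Import boolp functions.

(** Write [P i = Hom(Q, Q i)], [K i] for the trace in [rad (P i)] defining
    [Delta i = P i / K i], [F = Hom(Q,
      -)] and [G = Q (x) -].  Since the [Q i] are
    indecomposable of finite length, their endomorphism rings are local, and
    [K i] is the set of finite sums of maps [Q -> Q j -> Q i] with [j <= i] and
    [Q j -> Q i] not an isomorphism.

    (a) => (b).  A nonzero map from a module filtered by the [Psi j], [j <= i],
    to [Psi i] is an epimorphism with filtered kernel.  With [Ext^1(Q,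
      Psi) = 0],
    this shows that [K i] is the kernel of [P i -> F (Psi i)].  The counit
    [G F X -> X] is bijective for [X] filtered by [Psi], which gives both
    [Psi i = G (Delta i)] and the vanishing of [Tor_1].

    (b) => (a).  The point is that [K i] is filtered by the [Delta j], [j <= i];
    this is the only use of [Theta].  A submodule [S] of [K i] generated by maps
    [Q j -> Q i] extends to a subfunctor of [Hom(-,
      Q i)] on the modules filtered
    by [Theta].  If [S <> K i], choose a map [u : Q k ->
      Q i] of [K i] outside [S]
    with [k] minimal and [u] times the radical of [End(Q k)] inside [S].  Then
    [{g | u g \in S}] is [K k]: both subfunctors of [Hom(-, Q k)] agree on each
    [Theta j], and Ext-injectivity of [Q] propagates this along filtrations.  So
    [(S + u P k) / S = Delta k], and the process stops by noetherianity.  By the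
    vanishing of [Tor_1], [G] is exact on modules filtered by [Delta], so
    [G (K i)] is a filtered kernel of [Q i -> G (Delta i)]; as [Ext^1(Q, -)]
    vanishes on it, maps [G (Delta i) -> G (Delta j)] lift to maps
    [Q i -> Q j]. *)

Set Implicit Arguments.
Unset Strict Implicit.
Unset Printing Implicit Defensive.

Import GRing.Theory.
Local Open Scope ring_scope.

(** * Linear maps and filtrations *)

Section LinearMaps.
Variable A : pzRingType.
Implicit Types L M N X : lmodType A.

Lemma linear_pack M N (f : M -> N) :
  linear f -> exists g : {linear M -> N}, g =1 f.
Proof.
move=> lf; pose m := GRing.isLinear.Build A M N *:%R f lf.
by exists (HB.pack f m : {linear M -> N}).
Qed.

Lemma linear_inj0 M N (f : {linear M -> N}) :
  (forall x, f x = 0 -> x = 0) -> injective f.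
Proof.
by move=> f0 x y fxy; apply/eqP; rewrite -subr_eq0; apply/eqP/f0;
  rewrite linearB fxy subrr.
Qed.

(** Preimages under an injective map are unique, so a pointwise choice of them is automatically
    linear. *)
Lemma factor_inj L M X (f : {linear L -> M}) (h : {linear X -> M}) :
    injective f -> (forall x, exists l, f l = h x) ->
  exists k : {linear X -> L}, forall x, f (k x) = h x.
Proof.
move=> injf /boolp.choice[k fk].
have [|k' k'E] := @linear_pack _ _ k.
  by move=> a x y; apply: injf; rewrite linearP !fk linearP.
by exists k' => x; rewrite k'E.
Qed.

(** The section [s] is only set-theoretic; [h \o s] is nevertheless linear because [h] is constant
    on the fibres of [g]. *)
Lemma factor_surj M N X (g : {linear M -> N}) (h : {linear M -> X}) :
    surjective g -> (forall m, g m = 0 -> h m = 0) ->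
  exists k : {linear N -> X}, forall m, k (g m) = h m.
Proof.
move=> /boolp.choice[s gs] gh.
have hs m m' : g m = g m' -> h m = h m'.
  by move=> e; apply/eqP; rewrite -subr_eq0 -linearB gh // linearB e subrr.
have [|k kE] := @linear_pack _ _ (h \o s).
  by move=> a x y; rewrite /= -linearP; apply: hs; rewrite linearP !gs.
by exists k => m; rewrite kE /=; apply: hs; rewrite gs.
Qed.

Lemma bijP X Y (f : X -> Y) : bijective f <-> injective f /\ surjective f.
Proof.
split=> [[g fK gK]|[injf /boolp.choice[g gK]]].
  by split; [exact: can_inj fK | move=> y; exists (g y)].
by exists g => // x; apply: injf.
Qed.

Lemma linear_bij_inv M N (f : {linear M -> N}) :
  bijective f -> exists g : {linear N -> M}, cancel f g /\ cancel g f.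
Proof.
move=> /bijP[injf surf].
have [g gE] := @factor_inj _ _ _ f idfun injf surf.
by exists g; split=> x; [apply: injf|]; rewrite gE.
Qed.

Lemma isomorphic_sym M N : isomorphic M N -> isomorphic N M.
Proof. by case=> f /linear_bij_inv[g [fK gK]]; exists g; exists f. Qed.

Lemma isomorphic_trans L M N :
  isomorphic L M -> isomorphic M N -> isomorphic L N.
Proof. by move=> [f bf] [g bg]; exists (g \o f); apply: bij_comp. Qed.

Lemma quo_proj_surj M (S : submodule M) : surjective (@quo_proj A M S).
Proof. by move=> y; exists (repr (y : Quotient.quot S)); apply: projK. Qed.

Lemma quo_proj_eq0 M (S : submodule M) x : quo_proj S x = 0 <-> x \in S.
Proof. by rewrite -[0](linear0 (@quo_proj A M S)) proj_eq subr0. Qed.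

(** Trades the explicit quotient for an epimorphism with kernel [S], so that filtration factors can
    be handled through exact sequences. *)
Lemma quo_isomorphicP M (S : submodule M) N :
  isomorphic (quo S) N <->
  exists h : {linear M -> N}, surjective h /\ (forall x, h x = 0 <-> x \in S).
Proof.
split=> [[f /bijP[injf surf]]|[h [surh hS]]].
  exists (f \o quo_proj S); split=> [y|x] /=.
    have [z <-] := surf y; have [x <-] := quo_proj_surj z.
    by exists x.
  rewrite -quo_proj_eq0; split=> [|->]; last exact: linear0.
  by rewrite -[RHS](linear0 f) => /injf.
have [|k kE] := @factor_surj _ _ _ (quo_proj S) h (@quo_proj_surj _ _).
  by move=> m /quo_proj_eq0/hS.
exists k; apply/bijP; split=> [|y].
  apply: linear_inj0 => z; have [x <-] := quo_proj_surj z.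
  by rewrite kE => /hS/quo_proj_eq0.
by have [x <-] := surh y; exists (quo_proj S x); rewrite kE.
Qed.

Fact ker_closed M N (f : {linear M -> N}) :
  submod_closed (fun x => f x == 0).
Proof.
split=> [|a x y]; rewrite !unfold_in ?linear0 //.
by move=> /eqP fx /eqP fy; rewrite linearP fx fy scaler0 addr0.
Qed.
Definition kerm M N (f : {linear M -> N}) := Submodule (ker_closed f).

Lemma kermP M N (f : {linear M -> N}) x : reflect (f x = 0) (x \in kerm f).
Proof. exact: eqP. Qed.

Definition image_pred M N (f : {linear M -> N}) (S : submodule M) : {pred N} :=
  fun y => `[< exists2 x, x \in S & f x = y >].
Fact image_closed M N (f : {linear M -> N}) (S : submodule M) :
  submod_closed (image_pred f S).
Proof.
split=> [|a x y /asboolP[u uS <-] /asboolP[v vS <-]]; apply/asboolP.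
  by exists 0; rewrite ?rpred0 ?linear0.
by exists (a *: u + v); rewrite ?linearP ?rpredD ?rpredZ.
Qed.
Definition imagem M N (f : {linear M -> N}) S := Submodule (image_closed f S).

Lemma imagemP M N (f : {linear M -> N}) (S : submodule M) y :
  y \in imagem f S <-> exists2 x, x \in S & f x = y.
Proof. by split=> /asboolP. Qed.

Fact full_closed M : submod_closed (fun _ : M => true).
Proof. by []. Qed.
Definition fullm M : submodule M := Submodule (@full_closed M).

Definition submod M (S : submodule M) : lmodType A := sub_of S.

(** Locked, so that simplification does not unfold its linear structure. *)
Definition inclm M (S : submodule M) : {linear submod S -> M} :=
  locked ((val : sub_of S -> M) : {linear submod S -> M}).

Lemma inclmE M (S : submodule M) u : inclm S u = val (u : sub_of S).
Proof. by rewrite /inclm; unlock. Qed.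

Lemma inclmP M (S : submodule M) x : x \in S -> exists u, @inclm M S u = x.
Proof. by move=> xS; exists (exist _ x xS); rewrite inclmE. Qed.

Lemma inclm_in M (S : submodule M) u : @inclm M S u \in S.
Proof. by rewrite inclmE; apply: valP. Qed.

Lemma inclm_inj M (S : submodule M) : injective (@inclm M S).
Proof. by move=> x y; rewrite !inclmE; apply: val_inj. Qed.

Lemma mem_restr M (T S : submodule M) (x : sub_of T) :
  (x \in Submodule (@restr_submod_closed A M T S)) = (inclm T x \in S).
Proof. by rewrite inclmE. Qed.

Lemma sub_of_zero M (S : submodule M) :
  (forall x, x \in S -> x = 0) -> zero_module (submod S).
Proof.
by move=> S0 x; apply: (@inclm_inj _ S); rewrite linear0; apply/S0/inclm_in.
Qed.

End LinearMaps.

(** * Modules filtered by a family, as iterated extensions *)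

Section Filtrations.
Variables (A : pzRingType) (I : Type) (F : I -> lmodType A).

(** The recursive form of [filtered]: the top factor is peeled off by a short exact sequence, so
    induction needs no chain of submodules inside a fixed module. *)
Inductive filt (P : pred I) : lmodType A -> Prop :=
| filt0 M : zero_module M -> filt P M
| filtS L M j : filt P L -> P j -> short_exact L M (F j) -> filt P M.

Lemma short_exact_iso L M M' N :
  isomorphic M M' -> @short_exact A L M N -> short_exact L M' N.
Proof.
move=> [h /linear_bij_inv[k [hK kK]]] [f [g [injf fg surg]]].
exists (h \o f), (g \o k); split=> [||y] /=.
- by apply: inj_comp injf; apply: can_inj hK.
- move=> y /=; split=> [/fg[x fx]|[x <-]]; first by exists x; rewrite fx kK.
  by rewrite hK; apply/fg; exists x.
by have [x <-] := surg y; exists (h x); rewrite hK.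
Qed.

Lemma filt_iso P M M' : isomorphic M M' -> filt P M -> filt P M'.
Proof.
move=> MM' fM; case: fM MM' => [{}M M0|L {}M j fL Pj LM] MM'.
  by case: MM' => h /bijP[_ surh]; apply: filt0 => y;
    have [x <-] := surh y; rewrite (M0 x) linear0.
exact: filtS fL Pj (short_exact_iso MM' LM).
Qed.

Lemma filt_sub (P P' : pred I) M : subpred P P' -> filt P M -> filt P' M.
Proof.
move=> PP'; elim=> [N N0|L N j _ fL Pj LN]; first exact: filt0.
exact: filtS fL (PP' _ Pj) LN.
Qed.

Lemma filt1 (P : pred I) j : P j -> filt P (F j).
Proof.
move=> Pj; apply: filtS (filt0 _ (@sub_of_zero _ _ (kerm idfun) _)) Pj _.
  by move=> x /kermP.
exists (inclm _), idfun; split=> [|y|y] /=; last by exists y.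
  exact: inclm_inj.
split=> [y0|[x <-]]; last by have /kermP := inclm_in x.
by apply: (@inclmP _ _ (kerm idfun)); apply/kermP.
Qed.

Lemma filtered_filt (P : pred I) M : filtered F P M -> filt P M.
Proof.
case=> n [S [S0 Sn Sk]].
(* Induction on the length treats the member [S n] of the chain as a module; at the end it is all of
   [M]. *)
have: filt P (submod (S n)).
  elim: n {Sn} Sk => [|n IHn] Sk.
    exact/filt0/sub_of_zero.
  have [SS [j Pj /quo_isomorphicP[h [surh hS]]]] := Sk n (ltnSn n).
  apply: filtS (IHn _) Pj _; first by move=> k /ltnW; apply: Sk.
  have [||f fE] := @factor_inj _ _ _ _ (inclm (S n.+1)) (inclm (S n)).
  - exact: inclm_inj.
  - by move=> x; apply: inclmP; apply: SS; apply: inclm_in.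
  exists f, h; split=> // [x y fxy|y].
    by apply: (@inclm_inj _ _ (S n)); rewrite -!fE fxy.
  split=> [/hS yS|[x <-]].
    rewrite mem_restr in yS; have [u uE] := inclmP yS.
    by exists u; apply: inclm_inj; rewrite fE uE.
  apply/hS; rewrite mem_restr fE; exact: inclm_in.
apply: filt_iso; exists (inclm (S n)); apply/bijP; split;
  first exact: inclm_inj.
by move=> x; apply: inclmP.
Qed.

(** The chain of [L] is pushed forward along [f], and the whole of [M] is put on top. *)
Lemma filt_filtered (P : pred I) M : filt P M -> filtered F P M.
Proof.
elim=> [{}M M0|L {}M j _ [n [S [S0 Sn Sk]]] Pj [f [g [injf fg surg]]]].
  by exists 0, (fun=> fullm M); split=> // x _; apply: M0.
exists n.+1, (fun k => if (k <= n)%N then imagem f (S k) else fullm M).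
split=> [x /imagemP[y /S0-> <-]|x|k]; rewrite ?ltnn ?linear0 // ltnS => lekn.
rewrite lekn; case: ltnP => ltkn; last first.
  have -> : k = n by apply/eqP; rewrite eqn_leq lekn ltkn.
  split=> //; exists j => //; apply/quo_isomorphicP.
  exists (g \o inclm (fullm M)); split=> [y|x].
    by have [x <-] := surg y; have [//|u <-] := @inclmP _ _ (fullm M) x;
      exists u.
  rewrite mem_restr /= fg; split=> [[y fy]|/imagemP[y _ fy]]; last by exists y.
  by apply/imagemP; exists y.
have [SS [i Pi /quo_isomorphicP[h [surh hS]]]] := Sk k ltkn.
split=> [x /imagemP[y yS <-]|]; first by apply/imagemP; exists y => //;
  apply: SS.
exists i => //; apply/quo_isomorphicP.
have [||p pE] := @factor_inj _ _ _ _ (f \o inclm (S k.+1))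
   (inclm (imagem f (S k.+1))).
- exact/(inj_comp injf)/inclm_inj.
- move=> x; have /imagemP[y yS <-] := inclm_in x.
  by have [u <-] := inclmP yS; exists u.
exists (h \o p); split=> [y|x].
  have [x <-] := surh y.
  have [|u uE] := @inclmP _ _ (imagem f (S k.+1)) (f (inclm _ x)).
    by apply/imagemP; exists (inclm _ x) => //; apply: inclm_in.
  exists u; congr (h _); apply: (@inclm_inj _ _ (S k.+1)); apply: injf.
  by rewrite -uE -pE.
rewrite mem_restr -pE /= hS mem_restr.
split=> [pS|/imagemP[y yS /injf <-//]].
by apply/imagemP; exists (inclm _ (p x)).
Qed.

End Filtrations.

(** * Free modules and extensions *)

Section FreeModule.
Variables (A : pzRingType) (X : choiceType).

Definition fsupp_pred : {pred X -> A^o} := fun phi =>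
  `[< exists s : seq X, forall x, phi x != 0 -> x \in s >].

Fact fsupp_closed : submod_closed fsupp_pred.
Proof.
split=> [|a f g /asboolP[s sf] /asboolP[s' sg]]; apply/asboolP.
  by exists [::] => x; rewrite eqxx.
exists (s ++ s') => x; rewrite mem_cat; apply: contraR.
rewrite negb_or => /andP[xs xs'].
have /eqP fx : f x == 0 by apply: contraR xs; apply: sf.
have /eqP gx : g x == 0 by apply: contraR xs'; apply: sg.
by rewrite -[(_ + _) x]/(a *: f x + g x) fx gx scaler0 addr0.
Qed.

(** Vanishing of Ext and Tor is defined through projective resolutions; free modules on underlying
    sets supply them. *)
Definition free_module : lmodType A := submod (Submodule fsupp_closed).

Fact delta_in x : (fun y => (y == x)%:R : A^o) \in Submodule fsupp_closed.
Proof.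
by apply/asboolP; exists [:: x] => y; rewrite inE; case: (y == x);
  rewrite ?eqxx.
Qed.
Definition delta x : free_module :=
  exist (fun phi => phi \in Submodule fsupp_closed) _ (delta_in x).

Lemma free_supp (phi : free_module) :
  exists s : seq X, uniq s /\ forall x, val phi x != 0 -> x \in s.
Proof.
have /asboolP[s sP] := valP phi; exists (undup s); rewrite undup_uniq.
by split=> // x /sP; rewrite mem_undup.
Qed.

(** Entries outside the support contribute zero. A list covering several supports at once then makes
    [free_lift] linear. *)
Lemma free_sumE (M : lmodType A) (m : X -> M) (phi : X -> A) (s s' : seq X) :
    uniq s -> uniq s' ->
    (forall x, phi x != 0 -> x \in s) -> (forall x, phi x != 0 -> x \in s') ->
  \sum_(x <- s) phi x *: m x = \sum_(x <- s') phi x *: m x.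
Proof.
have sumE r : \sum_(x <- r) phi x *: m x
    = \sum_(x <- [seq x <- r | phi x != 0]) phi x *: m x.
  rewrite big_filter [LHS](bigID (fun x => phi x != 0)) /= addrC big1 ?add0r //.
  by move=> x; rewrite negbK => /eqP->; rewrite scale0r.
move=> us us' ss ss'; rewrite sumE [RHS]sumE; apply: perm_big.
apply: uniq_perm; rewrite ?filter_uniq // => x; rewrite !mem_filter.
by case: eqP => //= /eqP nz; rewrite ss ?ss'.
Qed.

Lemma free_lift (M : lmodType A) (m : X -> M) :
  exists h : {linear free_module -> M},
  forall (phi : free_module) s, uniq s -> (forall x, val phi x != 0 ->
    x \in s) ->
  h phi = \sum_(x <- s) (val phi x : A) *: m x.
Proof.
have [supp suppP] := boolp.choice free_supp.
pose h phi := \sum_(x <- supp phi) (val phi x : A) *: m x.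
have hE phi s : uniq s -> (forall x, val phi x != 0 -> x \in s) ->
    h phi = \sum_(x <- s) (val phi x : A) *: m x.
  by have [us ss] := suppP phi => us' ss'; apply: free_sumE.
have [|h' h'E] := @linear_pack _ _ _ h; last first.
  by exists h' => phi s us ss; rewrite h'E (hE _ _ us ss).
move=> a f g; pose s := undup (supp f ++ supp g).
have sf x : val f x != 0 -> x \in s.
  by rewrite mem_undup mem_cat => /(proj2 (suppP f))->.
have sg x : val g x != 0 -> x \in s.
  by rewrite mem_undup mem_cat orbC => /(proj2 (suppP g))->.
rewrite !(hE _ s) ?undup_uniq //.
  rewrite scaler_sumr -big_split /=; apply: eq_bigr => x _.
  by rewrite scalerDl scalerA.
move=> x; rewrite GRing.valD GRing.valZ /=; apply: contraR => xs.
have /eqP fx : val f x == 0 by apply: contraR xs; apply: sf.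
have /eqP gx : val g x == 0 by apply: contraR xs; apply: sg.
by rewrite -[(_ + _) x]/(a *: val f x + val g x) fx gx scaler0 addr0.
Qed.

Lemma free_lift1 (M : lmodType A) (m : X -> M) :
  exists h : {linear free_module -> M}, forall x, h (delta x) = m x.
Proof.
have [h hE] := free_lift m; exists h => x; rewrite (hE _ [:: x]) //.
  by rewrite big_seq1 /= eqxx scale1r.
by move=> y; rewrite inE /=; case: (y == x); rewrite ?eqxx.
Qed.

Lemma free_span (phi : free_module) : exists s (c : X -> A),
  phi = \sum_(x <- s) c x *: delta x.
Proof.
have [s [us ss]] := free_supp phi; exists s, (val phi : X -> A^o).
apply: (@inclm_inj _ _ (Submodule fsupp_closed)); rewrite linear_sum.
apply: funext => y; rewrite fct_sumE [in LHS]inclmE.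
have valZ c x : inclm (Submodule fsupp_closed) (c *: delta x : free_module) y
    = if x == y then c else 0.
  rewrite linearZ -[LHS]/(c * inclm (Submodule fsupp_closed) (delta x) y).
  rewrite inclmE /= eq_sym.
  by case: eqP; rewrite ?mulr1 ?mulr0.
under eq_bigr => x _ do rewrite valZ.
rewrite -big_mkcond; have [ys|yNs] := boolP (y \in s).
  by rewrite -big_filter (@filter_pred1_uniq _ s y) ?big_seq1.
rewrite big_seq_cond big1 => [|x /andP[xs /eqP exy]];
  last by rewrite -exy xs in yNs.
by apply/eqP; apply: contraR yNs; apply: ss.
Qed.

Lemma free_projective : projective free_module.
Proof.
move=> M N g f surg.
have [m mE] := boolp.choice (fun x => surg (f (delta x))).
have [h hE] := free_lift1 m; exists h => phi.
have [s [c ->]] := free_span phi; rewrite !linear_sum; apply: eq_bigr => x _.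
by rewrite !linearZ hE mE.
Qed.

End FreeModule.

(** * Vanishing of Ext^1 as a lifting and as an extension property *)

Section Ext.
Variable A : pzRingType.
Implicit Types L M N U V X Y : lmodType A.

Lemma enough_projectives M :
  exists (P : lmodType A) (e : {linear P -> M}), projective P /\ surjective e.
Proof.
have [e eE] := free_lift1 (id : M -> M).
exists (free_module A M), e; split=> [|x]; first exact: free_projective.
by exists (delta A x).
Qed.

(** [c] is [d1] corestricted to the first syzygy [kerm e], on which the Tor argument works. *)
Lemma resolution_of (P0 : lmodType A) M (e : {linear P0 -> M}) :
    projective P0 -> surjective e ->
  exists (P2 P1 : lmodType A) (d2 : {linear P2 -> P1}) (d1 : {linear P1 -> P0})
    (c : {linear P1 -> submod (kerm e)}),
    [/\ proj_resolution d2 d1 e, surjective c & forall x, inclm _ (c x) = d1 x].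
Proof.
move=> projP0 sure.
have [P1 [c [projP1 surc]]] := enough_projectives (submod (kerm e)).
have [P2 [c' [projP2 surc']]] := enough_projectives (submod (kerm c)).
exists P2, P1, (inclm _ \o c'), (inclm _ \o c), c; split=> //.
do 2![split=> //]; move=> y /=.
  split=> [cy|[x <-]].
    have {}cy : c y = 0 by apply: inclm_inj; rewrite linear0.
    have [|u uE] := @inclmP _ _ (kerm c) y; first exact/kermP.
    by have [x xE] := surc' u; exists x; rewrite xE.
  have /kermP-> := inclm_in (c' x); exact: linear0.
split=> [ey|[x <-]]; last exact/kermP/inclm_in.
have [|u uE] := @inclmP _ _ (kerm e) y; first exact/kermP.
by have [x xE] := surc u; exists x; rewrite xE.
Qed.

(** Ext^1(U, Y) = 0 in terms of extensions: the pullback along [u] of every extension by [Y] splits.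
    In the dual form [extends], the pushout along [u] of every extension of [U] splits. *)
Definition lifts U Y : Prop :=
  forall M N (f : {linear Y -> M}) (g : {linear M -> N}) (u : {linear U -> N}),
    injective f -> exact f g -> surjective g ->
  exists w : {linear U -> M}, forall x, g (w x) = u x.

Definition extends U Y : Prop :=
  forall M N (f : {linear M -> N}) (g : {linear N -> U}) (u : {linear M -> Y}),
    injective f -> exact f g -> surjective g ->
  exists w : {linear N -> Y}, forall x, w (f x) = u x.

Lemma hom_precomp_eq0 U V Y (d : {linear U -> V}) (f : lin_hom V Y) :
  hom_precomp d f = 0 <-> forall x, (f : {linear V -> Y}) (d x) = 0.
Proof.
split=> [e x|e]; last by apply: homP => x /=; rewrite e.
by have := congr1 (fun h : lin_hom U Y => (h : {linear U -> Y}) x) e.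
Qed.

(** Projectivity lifts [u \o e] to [v]; on [P1] it takes values in [Y] and is a cocycle. Writing
    this cocycle as a coboundary corrects [v] to a map that vanishes on the kernel of [e]. *)
Lemma Ext1_eq0_lifts U Y : Ext1_eq0 U Y -> lifts U Y.
Proof.
move=> ext M N f g u injf fg surg.
have [P0 [e [projP0 sure]]] := enough_projectives U.
have [P2 [P1 [d2 [d1 [_ [res _ _]]]]]] := resolution_of projP0 sure.
have exact1 := ext _ _ _ _ _ _ res.
have [_ [d21 d1e _]] := res.
have [v vE] := projP0 _ _ g (u \o e) surg.
have ed1 x : e (d1 x) = 0 by apply/d1e; exists x.
have [|phi phiE] := @factor_inj _ _ _ _ f (v \o d1) injf.
  by move=> x; apply/fg; rewrite vE /= ed1 linear0.
have [|f' f'E] := (exact1 phi).1.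
  apply/hom_precomp_eq0 => x; apply: injf; rewrite phiE linear0 /=.
  by rewrite (_ : d1 (d2 x) = 0) ?linear0 //; apply/d21; exists x.
have f'P x : (f' : {linear _ -> _}) (d1 x) = phi x.
  by rewrite -f'E.
have [p|w wE] := @factor_surj _ _ _ _ e
  (v \+ (GRing.opp \o (f \o (f' : {linear P0 -> Y})))) sure.
  by move=> /d1e[q <-] /=; rewrite f'P phiE /= subrr.
exists w => x; have [p <-] := sure x; rewrite wE /= linearB vE /=.
by rewrite (_ : g (f _) = 0) ?subr0 //; apply/fg; eexists.
Qed.

(** A lift [b] of [e] induces [a : P1 -> M], and the cocycle [u \o a] equals [f' \o d1] for some
    [f']. As [N] is a quotient of [M * P0], the pair of [u] and [f'] descends to it. *)
Lemma Ext1_eq0_extends U Y : Ext1_eq0 U Y -> extends U Y.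
Proof.
move=> ext M N f g u injf fg surg.
have [P0 [e [projP0 sure]]] := enough_projectives U.
have [P2 [P1 [d2 [d1 [_ [res _ _]]]]]] := resolution_of projP0 sure.
have exact1 := ext _ _ _ _ _ _ res.
have [_ [d21 d1e _]] := res.
have [b bE] := projP0 _ _ g e surg.
have [|a aE] := @factor_inj _ _ _ _ f (b \o d1) injf.
  by move=> x; apply/fg; rewrite bE /=; apply/d1e; exists x.
have [|f' f'E] := (exact1 (u \o a : {linear P1 -> Y})).1.
  apply/hom_precomp_eq0 => x /=.
  rewrite (_ : a (d2 x) = 0) ?linear0 //; apply: injf; rewrite aE linear0 /=.
  by rewrite (_ : d1 (d2 x) = 0) ?linear0 //; apply/d21; exists x.
have f'P x : (f' : {linear _ -> _}) (d1 x) = u (a x).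
  by rewrite -[LHS]/((hom_precomp d1 f' : {linear _ -> _}) x) f'E.
pose s : {linear (M * P0)%type -> N} := (f \o fst) \+ (b \o snd).
pose h : {linear (M * P0)%type -> Y} :=
  (u \o fst) \+ ((f' : {linear P0 -> Y}) \o snd).
have [y|[m p]|w wE] := @factor_surj _ _ _ _ s h.
- have [p pE] := sure (g y).
  have [|m mE] := (fg (y - b p)).1; first by rewrite linearB bE pE subrr.
  by exists (m, p); rewrite /s /= mE subrK.
- rewrite /s /h /= => fb.
  have [|q qE] := (d1e p).1.
    have := congr1 g fb; rewrite linearD bE linear0 (_ : g (f m) = 0) ?add0r //.
    by apply/fg; exists m.
  rewrite -qE f'P -linearD; suff -> : m + a q = 0 by rewrite linear0.
  by apply: injf; rewrite linearD aE /= qE fb linear0.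
exists w => x; have := wE (x, 0); rewrite /s /h /= !linear0 !addr0.
exact.
Qed.

(** A cocycle [phi] gives an extension [E] of [U] by [Y], and a section of [E -> U] exhibits [phi]
    as a coboundary. *)
Lemma lifts_Ext1_eq0 U Y : lifts U Y -> Ext1_eq0 U Y.
Proof.
move=> lft P2 P1 P0 d2 d1 e [_ [d21 d1e sure]] phi0.
pose phi : {linear P1 -> Y} := phi0.
split=> [/hom_precomp_eq0 phid2|[f <-]]; last first.
  apply/hom_precomp_eq0 => x /=.
  by rewrite (_ : d1 (d2 x) = 0) ?linear0 //; apply/d21; exists x.
have ed1 x : e (d1 x) = 0 by apply/d1e; exists x.
have [k kE] : exists k : {linear P1 -> (Y * P0)%type}, forall x, k x = (phi x,
  - d1 x).
  by apply: linear_pack => a x y; congr (_, _);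
    rewrite /= linearP ?opprD ?scalerN.
(* [E] is the pushout of [phi] and [d1]. *)
pose S := imagem k (fullm P1); pose E := quo S.
have [i1 i1E] : exists i : {linear Y -> E}, forall y, i y = quo_proj S (y, 0).
  by apply: linear_pack => a x y; rewrite -linearP; congr (quo_proj _ (_, _));
   rewrite /= scaler0 addr0.
have [i2 i2E] : exists i : {linear P0 -> E}, forall y, i y = quo_proj S (0, y).
  by apply: linear_pack => a x y; rewrite -linearP; congr (quo_proj _ (_, _));
   rewrite /= scaler0 addr0.
have [|p pE] := @factor_surj _ _ _ _ (quo_proj S) (e \o snd) (@quo_proj_surj _
  _ _).
  move=> m /quo_proj_eq0/imagemP[x _ <-]; rewrite kE /=.
  by rewrite linearN ed1 oppr0.
(* Here the cocycle condition enters: [d1 x = 0] gives [x = d2 z], hence [phi x = 0]. *)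
have inj1 : injective i1.
  apply: linear_inj0 => y; rewrite i1E => /quo_proj_eq0/imagemP[x _].
  rewrite kE => -[<- /eqP]; rewrite oppr_eq0 => /eqP/d21[z <-].
  exact: phid2.
have ex1 : exact i1 p.
  move=> z; have [[y q] <-] := quo_proj_surj z; rewrite pE /=.
  split=> [/d1e[x xE]|[y' y'E]].
    exists (y + phi x); rewrite i1E; apply/proj_eq; apply/imagemP.
    exists x => //; rewrite kE -xE; congr (_, _) => /=; last by rewrite sub0r.
    by rewrite addrAC subrr add0r.
  by have := congr1 p y'E; rewrite i1E !pE /= linear0.
have surp : surjective p.
  by move=> x; have [q <-] := sure x; exists (quo_proj S (0, q)); rewrite pE.
have [s sE] := lft _ _ _ _ idfun inj1 ex1 surp.
have [x|f' f'E] := @factor_inj _ _ _ _ i1 (i2 \+ (GRing.opp \o (s \o e))) inj1.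
  by apply/ex1; rewrite /= linearB sE i2E pE /= subrr.
exists f'; apply: homP => x /=; apply: inj1; rewrite f'E /= ed1 linear0 subr0.
rewrite i1E i2E; apply/proj_eq/imagemP; exists (- x) => //.
rewrite kE; congr (_, _) => /=; first by rewrite linearN sub0r.
by rewrite linearN opprK subr0.
Qed.

(** Lift in two stages: first to the quotient of [B] by [L], where the kernel is [N], then to [B],
    where the kernel is [L]. *)
Lemma lifts_ses U L M N : short_exact L M N -> lifts U L -> lifts U N ->
  lifts U M.
Proof.
move=> [i [p [inji ip surp]]] lL lN B C f g u injf fg surg.
pose S := imagem (f \o i) (fullm L).
have SP x : x \in S <-> exists l, f (i l) = x.
  by rewrite imagemP; split=> [[l _]|[l]]; exists l.
have pi0 l : p (i l) = 0 by apply/ip; exists l.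
have gf m : g (f m) = 0 by apply/fg; exists m.
have [|g' g'E] := @factor_surj _ _ _ _ (quo_proj S) g (@quo_proj_surj _ _ _).
  by move=> m /quo_proj_eq0/SP[l <-].
have [|f' f'E] := @factor_surj _ _ _ _ p (quo_proj S \o f) surp.
  by move=> m /ip[l <-]; apply/quo_proj_eq0/SP; exists l.
have [|||w wE] := lN _ _ f' g' u.
- apply: linear_inj0 => n; have [m <-] := surp n; rewrite f'E.
  by move=> /quo_proj_eq0/SP[l /injf <-].
- move=> y; have [b <-] := quo_proj_surj y; rewrite g'E; split=>
  [/fg[m <-]|[n]].
    by exists (p m); rewrite f'E.
  have [m <-] := surp n; rewrite f'E => /proj_eq/SP[l e].
  by rewrite -[b](subKr (f m)) -e linearB !gf subrr.
- by move=> c; have [b <-] := surg c; exists (quo_proj S b); rewrite g'E.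
have [|||v vE] := lL _ _ (f \o i) (quo_proj S) w.
- exact: inj_comp.
- by move=> y; rewrite quo_proj_eq0 SP.
- exact: quo_proj_surj.
by exists v => x; rewrite -g'E vE wE.
Qed.

Lemma lifts_zero U Y : zero_module Y -> lifts U Y.
Proof.
move=> Y0 M N f g u injf fg surg.
have injg : injective g.
  by apply: linear_inj0 => x /fg[y <-]; rewrite (Y0 y) linear0.
have [w wE] := factor_inj injg (fun x => surg (u x)).
by exists w.
Qed.

Lemma lifts_filt I (F : I -> lmodType A) (P : pred I) U M :
  (forall j, P j -> lifts U (F j)) -> filt F P M -> lifts U M.
Proof.
move=> lF; elim=> [{}M|L {}M j _ IH Pj ses]; first exact: lifts_zero.
exact: lifts_ses ses IH (lF _ Pj).
Qed.

End Ext.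

(** * Tensor products *)

Section TensorTheory.
Variables (A : pzRingType) (Q : lmodType A).
Local Notation Gamma := (opendo Q).
Implicit Types L M N K P : lmodType Gamma.

Lemma tens_ind M (T : tensor M -> Prop) :
    T 0 -> (forall q m, T (tens q m)) ->
    (forall x y, T x -> T y -> T (x + y)) -> forall x, T x.
Proof.
move=> T0 T1 TD x; rewrite -(treprK x) tclassE.
by apply: (big_ind T) => // -[q m] _; apply: T1.
Qed.

Lemma tens0r M (q : Q) : tens q (0 : M) = 0.
Proof. by apply: (addrI (tens q 0)); rewrite -tensDr !addr0. Qed.

Lemma tens_eq M (W : zmodType) (f g : tensor M -> W) :
    {morph f : x y / x + y} -> {morph g : x y / x + y} ->
    (forall q m, f (tens q m) = g (tens q m)) -> f =1 g.
Proof.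
move=> fD gD fg; apply: tens_ind => // [|x y fx fy];
  last by rewrite fD gD fx fy.
have f0 : f 0 = 0 by apply: (addrI (f 0)); rewrite -fD !addr0.
have g0 : g 0 = 0 by apply: (addrI (g 0)); rewrite -gD !addr0.
by rewrite f0 g0.
Qed.

Lemma tens_linear_eq M (W : lmodType A) (f g : {linear tensor M -> W}) :
  (forall q m, f (tens q m) = g (tens q m)) -> f =1 g.
Proof. by move=> fg; apply: tens_eq => // x y; apply: linearD. Qed.

Lemma tensor_linear M (W : lmodType A) (h : Q -> M -> W) :
    (forall q1 q2 m, h (q1 + q2) m = h q1 m + h q2 m) ->
    (forall q m1 m2, h q (m1 + m2) = h q m1 + h q m2) ->
    (forall q (a : Gamma) m, h (right_act q a) m = h q (a *: m)) ->
    (forall a q m, h (a *: q) m = a *: h q m) ->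
  exists g : {linear tensor M -> W}, forall q m, g (tens q m) = h q m.
Proof.
move=> hDl hDr hbal hZ; have [g [gD gE]] := tensor_universal hDl hDr hbal.
have [|g' g'E] := @linear_pack _ _ _ g; last by exists g' => q m; rewrite g'E.
move=> a x y; rewrite gD; congr (_ + _).
move: x; apply: (@tens_eq M W (fun x => g (a *: x)) (fun x => a *: g x)).
- by move=> x z; rewrite scalerDr gD.
- by move=> x z; rewrite gD scalerDr.
by move=> q m; rewrite [_ *: _]tensZ_tens !gE hZ.
Qed.

Lemma tmap_comp L M N (f : {linear L -> M}) (g : {linear M -> N})
    (h : {linear L -> N}) :
  (forall x, g (f x) = h x) -> forall x, tmap g (tmap f x) = tmap h x.
Proof.
move=> gf; apply: (@tens_linear_eq L _ (tmap g \o tmap f) (tmap h)) => q m.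
by rewrite /= !tmap_tens gf.
Qed.

Lemma tmap_eq0 M N (f : {linear M -> N}) :
  (forall x, f x = 0) -> forall x, tmap f x = 0.
Proof.
move=> f0; apply: (@tens_linear_eq M _ (tmap f) \0) => q m.
by rewrite /= tmap_tens f0 tens0r.
Qed.

Lemma tmap_id M (f : {linear M -> M}) :
  (forall x, f x = x) -> forall x, tmap f x = x.
Proof.
move=> f1; apply: (@tens_linear_eq M _ (tmap f) idfun) => q m.
by rewrite /= tmap_tens f1.
Qed.

Lemma tmap_surj M N (f : {linear M -> N}) : surjective f -> surjective (tmap f).
Proof.
move=> surf; apply: tens_ind => [|q n|x y [u <-] [v <-]].
- by exists 0; rewrite linear0.
- by have [m <-] := surf n; exists (tens q m); rewrite /= tmap_tens.
- by exists (u + v); rewrite linearD.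
Qed.

(** Modulo the image of [tmap f], sending [q (x) n] to the class of [q (x) s n] is a left inverse of
    [tmap g]; changing the lift [s n] only adds an element of that image. *)
Lemma tmap_exact L M N (f : {linear L -> M}) (g : {linear M -> N}) :
  exact f g -> surjective g -> exact (tmap f) (tmap g).
Proof.
move=> fg surg.
have gf x : g (f x) = 0 by apply/fg; exists x.
have tgf x : tmap g (tmap f x) = 0.
  rewrite (@tmap_comp _ _ _ f g \0) // tmap_eq0 //.
move=> y; split=> [gy|[x <-] //].
pose S := imagem (tmap f) (fullm (tensor L)).
have [s sE] := boolp.choice surg.
have same q m m' : g m = g m' -> quo_proj S (tens q m) = quo_proj S (tens q m').
  move=> e; apply/proj_eq/imagemP.
  have [|l lE] := (fg (m - m')).1; first by rewrite linearB e subrr.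
  exists (tens q l) => //; rewrite /= tmap_tens lE.
  by apply/eqP; rewrite eq_sym subr_eq -tensDr subrK.
have [|||a q m|h hE] := @tensor_linear N (quo S) (fun q n =>
  quo_proj S (tens q (s n))).
- by move=> q1 q2 m; rewrite tensDl linearD.
- move=> q m1 m2; rewrite -linearD -tensDr; apply: same.
  by rewrite linearD !sE.
- move=> q a m; rewrite tens_bal; apply: same; by rewrite linearZ !sE.
- by rewrite -tensZ_tens linearZ.
have hg : forall x, h (tmap g x) = quo_proj S x.
  apply: (@tens_linear_eq M _ (h \o tmap g) (quo_proj S)) => q m /=.
  by rewrite tmap_tens hE; apply: same; rewrite sE.
have /quo_proj_eq0/imagemP[x _ <-] : quo_proj S y = 0 by rewrite -hg gy linear0.
by exists x.
Qed.

(** With [P0 -> N] projective, [M] is the pushout of [L] and [P0] along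
    [ker e], and [tmap] preserves pushouts. *)
Lemma Tor1_eq0_inj L M N (f : {linear L -> M}) (g : {linear M -> N}) :
    Tor1_eq0 Q N -> injective f -> exact f g -> surjective g ->
  injective (tmap f).
Proof.
move=> tor injf fg surg.
have [P0 [e [projP0 sure]]] := enough_projectives N.
have [P2 [P1 [d2 [d1 [c [res surc cE]]]]]] := resolution_of projP0 sure.
have exact1 := tor _ _ _ _ _ _ res.
have [_ [d21 d1e _]] := res.
(* A kernel element lifts to a cycle in [Q (x) P1], which is a boundary from [P2] and therefore dies
   in the syzygy. *)
have injK : forall x, tmap (inclm (kerm e)) x = 0 -> x = 0.
  move=> x; have [y <-] := tmap_surj surc x.
  rewrite (tmap_comp cE) => /exact1[z <-].
  rewrite (@tmap_comp _ _ _ d2 c \0) ?tmap_eq0 // => u.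
  apply: inclm_inj; rewrite cE [RHS]linear0; apply/d21; by exists u.
have [b bE] := projP0 _ _ g e surg.
have [|a aE] := @factor_inj _ _ _ _ f (b \o inclm (kerm e)) injf.
  by move=> x; apply/fg; rewrite bE /=; apply/kermP/inclm_in.
pose s : {linear (L * P0)%type -> M} := (f \o fst) \+ (b \o snd).
have [k kE] : exists k : {linear submod (kerm e) -> (L * P0)%type},
    forall x, k x = (a x, - inclm _ x).
  by apply: linear_pack => r x y; congr (_, _);
    rewrite /= linearP ?opprD ?scalerN.
have exs : exact k s.
  move=> [l p]; rewrite /s /=; split=> [fb|[x]].
    have [|x xE] := @inclmP _ _ (kerm e) p.
      apply/kermP; have := congr1 g fb; rewrite linearD bE linear0.
      by rewrite (_ : g (f l) = 0) ?add0r //; apply/fg; exists l.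
    exists (- x); rewrite kE !linearN opprK xE; congr (_, _).
    apply: injf; rewrite linearN aE /= xE.
    by apply/eqP; rewrite eq_sym -addr_eq0 fb.
  by rewrite kE => -[<- <-]; rewrite aE linearN /= subrr.
have surs : surjective s.
  move=> y; have [p pE] := sure (g y).
  have [|l lE] := (fg (y - b p)).1; first by rewrite linearB bE pE subrr.
  by exists (l, p); rewrite /s /= lE subrK.
have [i iE] : exists i : {linear L -> (L * P0)%type}, forall x, i x = (x, 0).
  by apply: linear_pack => r x y; congr (_, _); rewrite /= scaler0 addr0.
pose p1 : {linear (L * P0)%type -> L} := fst.
pose p2 : {linear (L * P0)%type -> P0} := snd.
apply: linear_inj0 => x fx.
have [|z zE] := (tmap_exact exs surs (tmap i x)).1.
  by rewrite (@tmap_comp _ _ _ i s f) // => y; rewrite iE /s /= linear0 addr0.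
(* Compare [P0] components: [i] has none, and that of [k] is minus the inclusion of the syzygy. *)
have z0 : z = 0.
  apply: injK; have := congr1 (tmap p2) zE.
  rewrite (@tmap_comp _ _ _ i p2 \0) => [|y]; last by rewrite iE.
  rewrite (@tmap_comp _ _ _ k p2 (GRing.opp \o inclm _)) => [|y];
    last by rewrite kE.
  rewrite (@tmap_eq0 _ _ \0) // => nz0; apply: oppr_inj; rewrite oppr0 -nz0.
  apply/eqP; rewrite eq_sym -addr_eq0; apply/eqP; move: z {nz0 zE}.
  apply: (@tens_linear_eq _ _ (tmap (GRing.opp \o inclm _) \+ tmap (inclm _))
    \0).
  by move=> q m; rewrite /= !tmap_tens /= -tensDr addNr tens0r.
have := congr1 (tmap p1) zE; rewrite z0 !linear0.
rewrite (@tmap_comp _ _ _ i p1 idfun) => [|y]; last by rewrite iE.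
by rewrite tmap_id // => <-.
Qed.

(** Any resolution is compared with [K -> P -> M] by lifting the identity of [M] both ways. On
    [kerm e] the round trip [w' \o v'] differs from the identity by a map that extends to [P0], so
    injectivity after tensoring passes from [f] to the inclusion of [kerm e]. *)
Lemma inj_Tor1_eq0 K P M (f : {linear K -> P}) (g : {linear P -> M}) :
    projective P -> injective f -> exact f g -> surjective g ->
  injective (tmap f) -> Tor1_eq0 Q M.
Proof.
move=> projP injf fg surg injtf P2 P1 P0 d2 d1 e [[_ _ projP0] [d21 d1e sure]].
have [v vE] := projP0 _ _ g e surg.
have [w wE] := projP _ _ e g sure.
have [|c cE] := @factor_inj _ _ _ _ (inclm (kerm e)) d1 (@inclm_inj _ _ _).
  by move=> x; apply: inclmP; apply/kermP/d1e; exists x.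
have surc : surjective c.
  move=> y; have /kermP/d1e[x xE] := inclm_in y.
  by exists x; apply: inclm_inj; rewrite cE.
have ex : exact d2 c.
  move=> y; split=> [cy|[x <-]].
    by apply/d21; rewrite -cE cy linear0.
  by apply: inclm_inj; rewrite cE linear0; apply/d21; exists x.
have [|v' v'E] := @factor_inj _ _ _ _ f (v \o inclm (kerm e)) injf.
  by move=> x; apply/fg; rewrite vE /=; apply/kermP/inclm_in.
have [|w' w'E] := @factor_inj _ _ _ _ (inclm (kerm e)) (w \o f) (@inclm_inj _ _
  _).
  by move=> x; apply: inclmP; apply/kermP; rewrite /= wE; apply/fg; exists x.
have [|h hE] := @factor_inj _ _ _ _ (inclm (kerm e))
    ((w \o v) \+ (GRing.opp \o idfun)) (@inclm_inj _ _ _).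
  by move=> x; apply: inclmP; apply/kermP; rewrite /= linearB wE vE subrr.
have whE x : w' (v' x) - h (inclm _ x) = x.
  apply: inclm_inj; rewrite linearB w'E hE /= v'E /=.
  by rewrite opprB addrC subrK.
have injK : injective (tmap (inclm (kerm e))).
  apply: linear_inj0 => x x0.
  have v'x : tmap v' x = 0.
    apply: injtf; rewrite linear0 (@tmap_comp _ _ _ _ _ (v \o inclm _)) //.
    by rewrite -(@tmap_comp _ _ _ (inclm (kerm e)) v) // x0 linear0.
  have -> : x = tmap w' (tmap v' x) - tmap h (tmap (inclm (kerm e)) x).
    move: x {x0 v'x}.
    apply: (@tens_linear_eq _ _ idfun
      ((tmap w' \o tmap v') \+ (GRing.opp \o (tmap h \o tmap (inclm (kerm
        e)))))).
    move=> q m /=; rewrite !tmap_tens -{1}(whE m) tensDr; congr (_ + _).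
    by apply/eqP; rewrite -addr_eq0 -tensDr addrC subrr tens0r.
  by rewrite v'x x0 !linear0 addr0.
move=> y; rewrite -(tmap_exact ex surc); split=> [dy|cy].
  by apply: injK; rewrite (tmap_comp cE) dy linear0.
by rewrite -(tmap_comp cE) cy linear0.
Qed.

Section Hom.
Implicit Types X Y Z : lmodType A.

Definition hom_post X Y (f : {linear X -> Y}) (g : lin_hom Q X) : lin_hom Q Y :=
  f \o (g : {linear Q -> X}).
Fact hom_post_linear X Y (f : {linear X -> Y}) : linear (hom_post f).
Proof. by move=> a g h; apply: homP => x; apply: linearD. Qed.
HB.instance Definition _ X Y (f : {linear X -> Y}) :=
  GRing.isLinear.Build Gamma (lin_hom Q X) (lin_hom Q Y) *:%R (hom_post f)
    (hom_post_linear f).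

Lemma ev_exists X : exists ev : {linear tensor (lin_hom Q X) -> X},
  forall q (f : {linear Q -> X}), ev (tens q (f : lin_hom Q X)) = f q.
Proof.
apply: (@tensor_linear _ X (fun q (f : lin_hom Q X) => (f : {linear Q ->
  X}) q)) => //.
- by move=> q1 q2 f; apply: linearD.
- by move=> a q f; apply: linearZ.
Qed.

(** The counit of the adjunction between [Q (x) -] and [Hom(Q, -)]. *)
Definition ev X : {linear tensor (lin_hom Q X) -> X} :=
  sval (cid (ev_exists X)).

Lemma ev_tens X q (f : {linear Q -> X}) : ev X (tens q (f : lin_hom Q X)) = f q.
Proof. exact: (svalP (cid (ev_exists X))). Qed.

Lemma ev_natural X Y (f : {linear X -> Y}) x :
  ev Y (tmap (hom_post f) x) = f (ev X x).
Proof.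
move: x.
apply: (@tens_linear_eq _ _ (ev Y \o tmap (hom_post f)) (f \o ev X)) => q g.
by rewrite /= tmap_tens !ev_tens.
Qed.

(** The inverse sends [x] to [i x (x) p]: balancing moves [i \o f] across the tensor sign, and
    [p \o i] is the identity. *)
Lemma ev_summand X (i : {linear X -> Q}) (p : {linear Q -> X}) :
  cancel i p -> bijective (ev X).
Proof.
move=> iK; exists (fun x => tens (i x) (p : lin_hom Q X)); last first.
  by move=> x; rewrite ev_tens iK.
apply: tens_eq => [x y|//|q f]; first by rewrite !linearD tensDl.
rewrite ev_tens.
rewrite -[i _]/(right_act q (i \o (f : {linear Q -> X}) : endo Q)) tens_bal.
by congr tens; apply: homP => x /=; rewrite iK.
Qed.

(** [Hom(Q, X)] is generated by [p], since [u] equals [i \o u] acting on [p]; letting [i \o u] act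
    on a lift [m] of [f p] defines the required map. *)
Lemma hom_summand_projective X (i : {linear X -> Q}) (p : {linear Q -> X}) :
  cancel i p -> projective (lin_hom Q X).
Proof.
move=> iK M N g f surg; have [m mE] := surg (f (p : lin_hom Q X)).
pose r (h : lin_hom Q X) : Gamma := i \o (h : {linear Q -> X}).
have [|h hE] := @linear_pack _ _ _ (fun h : lin_hom Q X => r h *: m).
  move=> a u v; rewrite scalerA -scalerDl; congr (_ *: _).
  by apply: homP => x; apply: linearD.
exists h => u; rewrite hE linearZ mE -linearZ; congr (f _).
by apply: homP => x /=; rewrite iK.
Qed.

End Hom.
End TensorTheory.

(** * Chain conditions *)

Section ChainConditions.
Variable A : pzRingType.
Implicit Types M : lmodType A.

(** One flag covers both directions, so that arguments can serve the ascending and the descending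
    condition at once. *)
Definition subm (up : bool) M (S T : submodule M) : Prop :=
  if up then {subset S <= T} else {subset T <= S}.

(** The ascending chain condition if [up], else the descending one. *)
Definition chain_cond (up : bool) M : Prop :=
  forall I : nat -> submodule M, (forall n, subm up (I n) (I n.+1)) ->
    exists N, forall n, (N <= n)%N -> I n =i I N.

Lemma subm_trans up M (S T U : submodule M) :
  subm up S T -> subm up T U -> subm up S U.
Proof. by case: up => /= ST TU x; [move=> /ST/TU | move=> /TU/ST]. Qed.

Lemma chain_mono up M (I : nat -> submodule M) :
  (forall n, subm up (I n) (I n.+1)) ->
  forall m n, (m <= n)%N -> subm up (I m) (I n).
Proof.
move=> mI m n /subnKC<-; elim: (n - m)%N => [|k IHk].
  by rewrite addn0; case: up {mI}.
by rewrite addnS; apply: subm_trans IHk (mI _).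
Qed.

Lemma chain_extremal up M (P : submodule M -> Prop) :
    chain_cond up M -> (exists S, P S) ->
  exists2 S, P S & forall T, P T -> subm up S T -> T =i S.
Proof.
move=> cM [S0 PS0]; apply: contrapT => noS.
have next (S : {S | P S}) : exists T : {S | P S},
    subm up (sval S) (sval T) /\ ~ sval T =i sval S.
  apply: contrapT => noT; apply: noS; exists (sval S); first exact: svalP.
  move=> T PT ST; apply: contrapT => neq; apply: noT.
  by exists (exist _ T PT).
have [f fP] := boolp.choice next.
pose I n := iter n f (exist _ S0 PS0).
have [|N NP] := cM (fun n => sval (I n)).
  by move=> n; have [] := fP (I n).
have [_ []] := fP (I N); exact: (NP N.+1 (leqnSn N)).
Qed.

(** Recursion on the list of generators replaces indexed sums and suits induction. *)
Fixpoint spans M (s : seq M) (z : M) : Prop :=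
  if s is x :: s' then exists a y, spans s' y /\ z = a *: x + y else z = 0.

Lemma spans0 M (s : seq M) : spans s 0.
Proof. by elim: s => //= x s IHs; exists 0, 0; rewrite scale0r addr0. Qed.

Lemma spansP M (s : seq M) a x y : spans s x -> spans s y ->
  spans s (a *: x + y).
Proof.
elim: s x y => [x y -> ->|m s IHs x y] /=; first by rewrite scaler0 addr0.
move=> [b [u [su ->]]] [c [v [sv ->]]]; exists (a * b + c), (a *: u + v).
split; first exact: IHs.
by rewrite scalerDr scalerA scalerDl addrACA.
Qed.

Lemma spans_cat M (s s' : seq M) x y :
  spans s x -> spans s' y -> spans (s ++ s') (x + y).
Proof.
elim: s x => [x ->|m s IHs x [a [u [su ->]]] s'y] /=; first by rewrite add0r.
by exists a, (u + y); rewrite addrA; split=> //; apply: IHs.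
Qed.

Lemma spans_map M (N : lmodType A) (f : {linear M -> N}) s x :
  spans s x -> spans (map f s) (f x).
Proof.
elim: s x => [x ->|m s IHs x [a [u [su ->]]]] /=; first exact: linear0.
by exists a, (f u); rewrite linearP; split=> //; apply: IHs.
Qed.

Lemma spans_sum M (s : seq M) x :
  spans s x <-> exists c : nat -> A, x = \sum_(k < size s) c k *: s`_k.
Proof.
elim: s x => [x|m s IHs x] /=.
  split=> [->|[c ->]]; last by rewrite big_ord0.
  by exists (fun=> 0); rewrite big_ord0.
split=> [[a [y [/IHs[c ->] ->]]]|[c ->]].
  exists (fun k => if k is k'.+1 then c k' else a).
  by rewrite big_ord_recl.
rewrite big_ord_recl /=; exists (c 0), (\sum_(i < size s) c i.+1 *: s`_i).
by split=> //; apply/IHs; exists (c \o succn).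
Qed.

Lemma fin_genP M : fin_gen M <-> exists s : seq M, forall x, spans s x.
Proof.
by split=> -[s sP]; exists s => x; apply/spans_sum.
Qed.

Lemma fin_gen_surj M (N : lmodType A) (f : {linear M -> N}) :
  surjective f -> fin_gen M -> fin_gen N.
Proof.
move=> surf /fin_genP[s sP]; apply/fin_genP; exists (map f s) => y.
by have [x <-] := surf y; apply: spans_map.
Qed.

(** Induction on the generators. The coefficients at [x] of elements of [I n] form an ideal [D n];
    once [D] is stable, an element of [I n] agrees with one of the smaller [I m] up to a combination
    of the remaining generators. *)
Lemma fin_gen_chain up M : chain_cond up A^o -> fin_gen M -> chain_cond up M.
Proof.
move=> cA /fin_genP[s sP] I mI.
(* Speaking of any two late terms, one inside the other, makes the claim independent of the
   direction of the chain. *)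
have : exists N, forall m n, (N <= m)%N -> (N <= n)%N ->
    {subset I m <= I n} -> forall z, spans s z -> z \in I n -> z \in I m.
  elim: s {sP} => [|x s [N IHs]] /=; first by exists 0 => m n _ _ _ z ->;
    rewrite !rpred0.
  pose D n : {pred A^o} := fun a => `[< exists2 y, spans s y & (a :
    A) *: x + y \in I n >].
  have DP n : submod_closed (D n).
    split=> [|a b c /asboolP[y sy yI] /asboolP[z sz zI]]; apply/asboolP.
      by exists 0; rewrite ?scale0r ?addr0 ?rpred0 //; apply: spans0.
    exists (a *: y + z); first exact: spansP.
    by rewrite scalerDl -scalerA addrACA -scalerDr rpredD ?rpredZ.
  have [|N' N'P] := cA (fun n => Submodule (DP n)).
    move=> n; have := mI n; case: up {cA mI} => /= II a /asboolP[y sy /II yI];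
    by apply/asboolP; exists y.
  exists (maxn N N') => m n; rewrite !geq_max =>
    /andP[Nm N'm] /andP[Nn N'n] mn z.
  move=> [a [y [sy ->]]] zI.
  have /asboolP[y' sy' y'I] : a \in Submodule (DP m).
    by rewrite N'P // -(N'P n) //; apply/asboolP; exists y.
  have yy' : y - y' \in I m.
    apply: (IHs m n) => //; first by rewrite addrC -scaleN1r; apply: spansP.
    have -> : y - y' = (a *: x + y) - (a *: x + y').
      by rewrite opprD addrACA subrr add0r.
    by apply: rpredB => //; apply: mn.
  have <- : (a *: x + y') + (y - y') = a *: x + y.
    by rewrite -addrA [y' + _]addrC subrK.
  exact: rpredD.
move=> [N NP]; exists N => n leNn x.
have := chain_mono mI leNn; case: up {cA mI} => II.
  by apply/idP/idP => [|/II//]; apply: (NP N n).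
by apply/idP/idP => [/II//|]; apply: (NP n N).
Qed.

End ChainConditions.

(** * Artinian commutative rings are noetherian *)

Section Akizuki.
Variable R : comPzRingType.
Implicit Types I J : submodule R^o.

Definition mulr_lin (x : R) : R^o -> R^o := fun y => x * y.
Fact mulr_lin_linear x : linear (mulr_lin x).
Proof. by move=> a u v; rewrite /mulr_lin mulrDr /GRing.scale /= mulrCA. Qed.
HB.instance Definition _ x :=
  GRing.isLinear.Build R R^o R^o *:%R (mulr_lin x) (mulr_lin_linear x).

Definition noeth I : Prop := forall J : nat -> submodule R^o,
  (forall n, {subset J n <= I}) -> (forall n, {subset J n <= J n.+1}) ->
  exists N, forall n, (N <= n)%N -> J n =i J N.

Fact inter_closed I J : submod_closed [pred x : R^o | (x \in I) && (x \in J)].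
Proof.
split=> [|a x y]; rewrite !inE ?rpred0 // => /andP[xI xJ] /andP[yI yJ].
by rewrite !rpredD ?rpredZ.
Qed.
Definition inter I J : submodule R^o := Submodule (inter_closed I J).

Lemma noeth_ext I (f : {linear R^o -> R^o}) :
  noeth (imagem f I) -> noeth (inter I (kerm f)) -> noeth I.
Proof.
move=> nim nker J JI mJ.
have [||N1 N1P] := nim (fun n => imagem f (J n)).
- by move=> n y /imagemP[x /JI xI <-]; apply/imagemP; exists x.
- by move=> n y /imagemP[x /mJ xI <-]; apply/imagemP; exists x.
have [||N2 N2P] := nker (fun n => inter (J n) (kerm f)).
- by move=> n y; rewrite !inE => /andP[/JI-> ->].
- by move=> n y; rewrite !inE => /andP[/mJ-> ->].
exists (maxn N1 N2) => n; rewrite geq_max => /andP[n1 n2] x.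
set N := maxn N1 N2.
have NJ : {subset J N <= J n}.
  by apply: (@chain_mono _ true) => //; rewrite geq_max n1.
apply/idP/idP => [xJ|/NJ//].
have /imagemP[y yJ fyx] : f x \in imagem f (J N).
  rewrite N1P ?leq_maxl // -(N1P n) //; by apply/imagemP; exists x.
have : x - y \in inter (J N) (kerm f).
  rewrite N2P ?leq_maxr // -(N2P n) // inE; apply/andP; split.
    by apply: rpredB => //; apply: NJ.
  by apply/kermP; rewrite linearB fyx subrr.
rewrite inE => /andP[xyJ _]; rewrite -[x](subrK y); exact: rpredD.
Qed.

(** A minimal non-noetherian ideal [I] is a vector space over the field
    [R / ann I], and artinian vector spaces are noetherian. *)
Lemma artinian_noeth :
  chain_cond false (R^o : lmodType R) -> chain_cond true (R^o : lmodType R).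
Proof.
move=> dcc; apply: contrapT => nacc.
have [|I nI Imin] := @chain_extremal _ false (R^o : lmodType R)
    (fun I => ~ noeth I) dcc.
  by exists (fullm _) => nR; apply: nacc => J mJ; apply: nR.
have proper_noeth J : {subset J <= I} -> ~ J =i I -> noeth J.
  by move=> JI JnI; apply: contrapT => nJ; apply: JnI; apply: Imin.
(* Otherwise the image and the kernel of multiplication by [x] on [I] are both proper in [I], hence
   noetherian, and then so is [I]. *)
have act x : (forall y, y \in I -> x * y = 0) \/
             (forall y, y \in I -> exists2 z, z \in I & x * z = y).
  pose f : {linear R^o -> R^o} := mulr_lin x.
  have imI : {subset imagem f I <= I}.
    by move=> y /imagemP[z zI <-]; apply: (@rpredZ _ _ I x z).
  have [eqI|neqI] := pselect (imagem f I =i I).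
    by right=> y; rewrite -eqI => /imagemP.
  left; have [eqK|neqK] := pselect (inter I (kerm f) =i I).
    by move=> y; rewrite -eqK inE => /andP[_ /kermP].
  case: nI; apply: (@noeth_ext I f); first exact: proper_noeth.
  by apply: proper_noeth => // y; rewrite inE => /andP[].
have unit_act x : ~ (forall y, y \in I -> x * y = 0) ->
    exists y, forall z, z \in I -> y * (x * z) = z.
  case: (act x) => // surx _.
  (* The ideals generated by the powers of [x] become stable, so [x ^+ N = x ^+ N.+1 * y]; as [x]
     maps [I] onto itself, [y] inverts it on [I]. *)
  have [|N NP] := dcc (fun n => imagem (mulr_lin (x ^+ n)) (fullm _)).
    move=> n y /imagemP[z _ <-]; apply/imagemP; exists (x * z) => //.
    by rewrite /= /mulr_lin exprSr mulrA.
  have /imagemP[y _ /= yE] :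
      (x ^+ N : R^o) \in imagem (mulr_lin (x ^+ N.+1)) (fullm _).
    by rewrite NP //; apply/imagemP; exists 1; rewrite //= /mulr_lin mulr1.
  exists y => z zI.
  have [w _ <-] : exists2 w, w \in I & x ^+ N * w = z.
    elim: N z zI {NP yE} => [|N IHN] z /=; first by exists z; rewrite ?mul1r.
    move=> /surx[w /IHN[u uI <-] <-]; exists u => //.
    by rewrite exprS mulrA.
  by rewrite -[in RHS]yE /mulr_lin exprS [x * _ * y]mulrC !mulrA.
apply: nI => J JI mJ; apply: contrapT => nst.
have step n :
    exists p : nat * R, (n < p.1)%N /\ p.2 \in J p.1 /\ p.2 \notin J n.
  apply: contrapT => nop; apply: nst; exists n => m lenm x.
  apply/idP/idP => [xm|]; last exact: (@chain_mono _ true _ J mJ).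
  apply: contrapT => /negP xn; apply: nop; exists (m, x); split=> //=.
  by rewrite ltn_neqAle lenm andbT; apply: contraNneq xn => ->.
have [p pP] := boolp.choice step.
(* Along a strictly ascending subsequence of [J], [w k] lies in the term of index [k.+1] but not in
   that of index [k]. *)
pose nn k := iter k (fun n => (p n).1) 0; pose w k : R^o := (p (nn k)).2.
have wJ k : w k \in J (nn k.+1) by have [_ []] := pP (nn k).
have wNJ k : w k \notin J (nn k) by have [_ []] := pP (nn k).
have Jnn k l : (k <= l)%N -> {subset J (nn k) <= J (nn l)}.
  apply: (@chain_mono _ true _ (fun k => J (nn k))) => {}k.
  by apply: (@chain_mono _ true _ J) => //; apply: ltnW; have [] := pP (nn k).
pose L m := gen_submodule (fun y => exists2 k, (m <= k)%N & y = w k).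
(* Stability of the descending chain of tails writes [w M] as a combination of later [w k]. *)
have [|M MP] := dcc L.
  move=> m x /asboolP xL; apply/asboolP => S SP; apply: xL => y [k mk ->].
  by apply: SP; exists k => //; apply: ltnW.
have wL : w M \in L M.+1.
  by rewrite MP //; apply/asboolP => S SP; apply: SP; exists M.
have comb : exists n (c : nat -> R), w M = \sum_(M.+1 <= k < n) c k *: w k.
  pose C : {pred R^o} := fun x =>
    `[< exists n (c : nat -> R), x = \sum_(M.+1 <= k < n) c k *: w k >].
  have widen n n' (c : nat -> R) : (n <= n')%N ->
      \sum_(M.+1 <= k < n) c k *: w k
    = \sum_(M.+1 <= k < n') (if (k < n)%N then c k else 0) *: w k.
    move=> nn'; rewrite (big_nat_widen _ _ _ _ _ nn') big_mkcond.
    by apply: eq_bigr => k _ /=; case: (k < n)%N; rewrite ?scale0r.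
  have CP : submod_closed C.
    split=> [|a x y /asboolP[n [c ->]] /asboolP[n' [c' ->]]]; apply/asboolP.
      by exists 0, (fun=> 0); rewrite big_geq.
    pose m := maxn n n'; exists m.
    rewrite (widen n m) ?leq_maxl // (widen n' m) ?leq_maxr //.
    rewrite scaler_sumr -big_split /=.
    exists (fun k => a * (if (k < n)%N then c k else 0)
                     + (if (k < n')%N then c' k else 0)).
    by apply: eq_bigr => k _; rewrite scalerDl scalerA.
  have /asboolP/(_ (Submodule CP)) := wL.
  case/(_ _)/asboolP=> [y [k Mk ->]|n [c wM]].
    apply/asboolP; exists k.+1, (fun l => (l == k)%:R).
    rewrite big_nat_recr //= eqxx scale1r big1_seq ?add0r // => l.
    rewrite mem_index_iota => /andP[_ /andP[_ lk]].
    by rewrite ltn_eqF // scale0r.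
  by exists n, c.
have wI k : w k \in I by apply: JI (wJ k).
case: comb => n; elim: n => [|n IHn] [c wM].
  by have := wNJ M; rewrite wM big_geq // rpred0.
have [leMn|ltnM] := leqP M.+1 n; last first.
  by have := wNJ M; rewrite wM big_geq ?rpred0 //.
rewrite big_nat_recr //= in wM.
have cwJ : c n *: w n \in J (nn n).
  have -> : c n *: w n = w M - \sum_(M.+1 <= k < n) c k *: w k.
    by rewrite wM addrAC subrr add0r.
  rewrite rpredB //; first exact: Jnn (wJ M).
  rewrite big_nat_cond; apply: rpred_sum => k /andP[/andP[_ kn] _].
  by apply: rpredZ; apply: Jnn (wJ k).
have [c0|/unit_act[y yP]] := pselect (forall z, z \in I -> c n * z = 0).
  apply: IHn; exists c.
  by rewrite [LHS]wM -[c n *: w n]/(c n * w n) c0 ?addr0.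
have := wNJ n; rewrite -[w n](yP (w n)) //.
rewrite (_ : y * _ \in _ = true) //.
exact: (@rpredZ _ _ (J (nn n)) y (c n *: w n)).
Qed.

End Akizuki.

(** * Direct sums and finite length *)

Section DirectSums.
Variables (A : pzRingType) (I : finType) (M : I -> lmodType A).

Definition dsumm : lmodType A := dsum M.

Lemma dsum_proj_exists i : exists p : {linear dsumm -> M i},
  forall x : dsumm, p x = (x : dsum M) i.
Proof. by apply: linear_pack => a x y; rewrite !ffunE. Qed.

Definition dsum_proj i := sval (cid (dsum_proj_exists i)).
Lemma dsum_projE i x : dsum_proj i x = (x : dsum M) i.
Proof. exact: (svalP (cid (dsum_proj_exists i))). Qed.

Lemma dsum_inj_exists i : exists f : {linear M i -> dsumm},
  forall x, (f x : dsum M) i = x /\ forall j, j != i -> (f x : dsum M) j = 0.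
Proof.
pose f (x : M i) : dsumm := [ffun j => dfwith (fun j => 0 : M j) x j].
have fi x : (f x : dsum M) i = x by rewrite ffunE dfwith_in.
have fj x j : j != i -> (f x : dsum M) j = 0 by move=> ji;
  rewrite ffunE dfwith_out // eq_sym.
have [|g gE] := @linear_pack A (M i) dsumm f; last first.
  by exists g => x; rewrite gE; split; [apply: fi | move=> j; apply: fj].
move=> a x y; apply/ffunP => j.
apply: (@etrans _ _ (a *: (f x : dsum M) j + (f y : dsum M) j)); last first.
  by rewrite !ffunE.
have [->|ji] := eqVneq j i; first by rewrite !fi.
by rewrite !fj // scaler0 addr0.
Qed.

Definition dsum_inj i := sval (cid (dsum_inj_exists i)).
Lemma dsum_injE i x : dsum_proj i (dsum_inj i x) = x.
Proof. by rewrite dsum_projE; have [] := svalP (cid (dsum_inj_exists i)) x. Qed.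
Lemma dsum_inj_neq i j x : j != i -> dsum_proj j (dsum_inj i x) = 0.
Proof.
by move=> ji; rewrite dsum_projE;
  have [_ ->] := svalP (cid (dsum_inj_exists i)) x.
Qed.

Lemma dsum_sum x : x = \sum_i dsum_inj i (dsum_proj i x).
Proof.
apply/ffunP => j; rewrite -[RHS]dsum_projE linear_sum (bigD1 j) //= dsum_injE.
rewrite big1 ?addr0 ?dsum_projE // => i ij.
by rewrite dsum_inj_neq // eq_sym.
Qed.

Lemma fin_gen_dsum : (forall i, fin_gen (M i)) -> fin_gen dsumm.
Proof.
move=> fgM; pose c i := cid ((fin_genP (M i)).1 (fgM i)).
pose s i := sval (c i); have sP i : forall x, spans (s i) x := svalP (c i).
apply/fin_genP; exists (flatten [seq map (dsum_inj i) (s i) | i <- enum I]).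
move=> x; rewrite [x]dsum_sum -big_enum.
elim: (enum I) => [|i r IHr]; first by rewrite big_nil.
by rewrite big_cons; apply: spans_cat => //; apply: spans_map.
Qed.

End DirectSums.

(** * Chain conditions for modules over an artin algebra *)

Section RestrictionOfScalars.
Variables (R : comNzRingType) (Lam : algType R).

(** A copy of [M] on which the ground ring acts, so that the chain conditions of [R] become
    available. *)
Definition resc (M : lmodType Lam) : Type := M.
Section Resc.
Variable M : lmodType Lam.
HB.instance Definition _ := GRing.Zmodule.on (resc M).
Definition rescZ (r : R) (x : resc M) : resc M := (r%:A : Lam) *: (x : M).
Fact rescZA a b x : rescZ a (rescZ b x) = rescZ (a * b) x.
Proof. by rewrite /rescZ scalerA -scalerAl mul1r scalerA. Qed.
Fact resc1Z : left_id 1 rescZ.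
Proof. by move=> x; rewrite /rescZ !scale1r. Qed.
Fact rescZDr : right_distributive rescZ +%R.
Proof. by move=> a x y; apply: scalerDr. Qed.
Fact rescZDl x : {morph rescZ^~ x : a b / a + b}.
Proof. by move=> a b; rewrite /rescZ !scalerDl. Qed.
HB.instance Definition _ :=
  GRing.Zmodule_isLmodule.Build R (resc M) rescZA resc1Z rescZDr rescZDl.
End Resc.

Hypothesis hLam : artin_algebra Lam.

Lemma artin_chain up : chain_cond up R^o.
Proof. by case: up; [apply: artinian_noeth|]; apply: hLam.1. Qed.

Lemma fin_gen_resc (M : lmodType Lam) : fin_gen M -> fin_gen (resc M).
Proof.
move=> /fin_genP[s sP]; have /fin_genP[l lP] := hLam.2.
pose g (m : M) (a : Lam) : resc M := a *: m.
apply/fin_genP; exists (flatten [seq map (g m) l | m <- s]).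
move=> x; elim: s x {sP} (sP x) => [x -> //|m s IHs x [a [y [sy ->]]]] /=.
apply: (@spans_cat R (resc M) _ _ (g m a) y); last exact: IHs.
have [f fE] : exists f : {linear Lam -> resc M}, forall a, f a = g m a.
  apply: linear_pack => r b c; rewrite /g scalerDl; congr (_ + _).
  rewrite -[RHS]/((r%:A : Lam) *: ((b : Lam) *: m : M)) scalerA.
  by rewrite -scalerAl mul1r.
by rewrite -fE -(eq_map fE); apply: spans_map.
Qed.

Lemma chain_resc up (M : lmodType Lam) : fin_gen M -> chain_cond up (resc M).
Proof. by move=> /fin_gen_resc; apply/fin_gen_chain/artin_chain. Qed.

Lemma chain_fg up (M : lmodType Lam) : fin_gen M -> chain_cond up M.
Proof.
move=> /(@chain_resc up) cM I mI.
have SP n : submod_closed (I n : {pred resc M}).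
  split=> [|a x y xI yI]; first exact: (@rpred0 _ (I n)).
  by apply: (@rpredD _ (I n)) => //; apply: (@rpredZ _ _ (I n)).
have [|N NP] := cM (fun n => Submodule (SP n)); first by move=> n; apply: mI.
by exists N => n /NP.
Qed.

(** A map is determined by its values on finitely many generators. The values at one generator of
    those maps in [I n] that vanish on the generators already treated form an [R]-submodule of [X],
    where the chain conditions hold. *)
Lemma chain_hom up (U X : lmodType Lam) :
  fin_gen U -> fin_gen X -> chain_cond up (lin_hom U X : lmodType (opendo U)).
Proof.
move=> /fin_genP[s sP] fgX I mI.
pose app (h : lin_hom U X) : {linear U -> X} := h.
have appD h k x : app (h + k) x = app h x + app k x by [].
have appN h x : app (- h) x = - app h x by [].
(* the scalars of [R] act on [lin_hom U X] through [opendo U] *)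
have centr (r : R) (a : Lam) : r%:A * a = a * r%:A.
  by rewrite -scalerAl -scalerAr mul1r mulr1.
have [sc scE] : exists sc : R -> opendo U,
    forall r h x, app (sc r *: h) x = r%:A *: app h x.
  have /boolp.choice[sc scE] : forall r : R, exists sc : {linear U -> U},
    forall x, sc x = r%:A *: x.
    move=> r; apply: linear_pack => a x y.
    by rewrite scalerDr !scalerA centr.
  by exists sc => r h x; rewrite -[LHS]/(app h (sc r x)) scE linearZ.
have [N NP] : exists N, forall m n, (N <= m)%N -> (N <= n)%N ->
    {subset I m <= I n} -> forall h, h \in I n ->
    exists2 h', h' \in I m & forall x, x \in s -> app h x = app h' x.
  elim: s {sP} => [|x s [N IHs]].
    by exists 0 => m n _ _ _ h _; exists 0; rewrite ?rpred0.
  pose D n : {pred resc X} := fun y =>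
    `[< exists h, [/\ h \in I n, forall z, z \in s ->
      app h z = 0 & app h x = y] >].
  have DP n : submod_closed (D n).
    split=> [|a u v /asboolP[h [hI hs <-]] /asboolP[k [kI ks <-]]];
      apply/asboolP.
      by exists 0; rewrite rpred0.
    exists (sc a *: h + k); rewrite rpredD ?rpredZ //; split=> // [z zs|].
      by rewrite appD scE hs // ks // scaler0 addr0.
    by rewrite appD scE.
  have [|N' N'P] := @chain_resc up X fgX (fun n => Submodule (DP n)).
    move=> n; have := mI n; case: up {mI} => /= II y /asboolP[h [/II hI hs hx]];
    by apply/asboolP; exists h.
  exists (maxn N N') => m n; rewrite !geq_max =>
    /andP[Nm N'm] /andP[Nn N'n] mn h hI.
  have [h' h'I hs] := IHs m n Nm Nn mn h hI.
  have /asboolP[k [kI ks kx]] : (app (h - h') x : resc X) \in Submodule (DP m).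
    rewrite N'P // -(N'P n) //; apply/asboolP; exists (h - h'); split=> //.
      by apply: rpredB => //; apply: mn.
    by move=> z zs; rewrite appD appN hs // subrr.
  exists (h' + k) => [|z]; first exact: rpredD.
  rewrite inE => /predU1P[->|zs];
    first by rewrite appD kx appD appN addrC subrK.
  by rewrite appD ks // addr0 hs.
have sub_eq m n : (N <= m)%N -> (N <= n)%N -> {subset I m <= I n} ->
    {subset I n <= I m}.
  move=> Nm Nn mn h hI; have [k kI hk] := NP m n Nm Nn mn h hI.
  suff -> : h = k by [].
  apply: homP => x; rewrite -[LHS]/(app h x) -[RHS]/(app k x).
  move: (sP x) hk => {NP sP}; elim: s x => [x ->
    _|y s IHs x [a [z [sz ->]]] hk].
    by rewrite !linear0.
  rewrite !linearP hk ?mem_head // IHs // => u us; apply: hk.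
  by rewrite inE us orbT.
exists N => n leNn x; have := chain_mono mI leNn.
case: up {mI} => /= II; first by apply/idP/idP => [|/II//]; apply: (sub_eq N n).
by apply/idP/idP => [/II//|]; apply: (sub_eq n N).
Qed.

End RestrictionOfScalars.

(** * Fitting's lemma and local endomorphism rings *)

Section Fitting.
Variables (A : pzRingType) (M : lmodType A).
Hypotheses (acc : chain_cond true M) (dcc : chain_cond false M).
Hypothesis indM : indecomposable M.

(** Once the kernels and images of the powers of [f] are stable, [M] is the direct sum of the kernel
    and the image of a high power, and one of the two is zero. *)
Lemma fitting (f : {linear M -> M}) :
  bijective f \/ exists n, forall x, iter n f x = 0.
Proof.
have [F FE] : exists F : nat -> {linear M -> M}, forall n x, F n x = iter n f x.
  have /boolp.choice[F FE] : forall n, exists g : {linear M -> M}, forall x,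
    g x = iter n f x.
    elim=> [|n [g gE]]; first by exists idfun.
    by exists (f \o g) => x /=; rewrite gE.
  by exists F.
have [|N1 N1P] := @acc (fun n => kerm (F n)).
  by move=> n x /kermP; rewrite FE => Fx; apply/kermP; rewrite FE /= Fx linear0.
have [|N2 N2P] := @dcc (fun n => imagem (F n) (fullm _)).
  move=> n x /imagemP[y _ <-]; apply/imagemP; exists (f y) => //.
  by rewrite !FE iterSr.
(* The successor makes [n] positive, so that one factor [f] can be detached from the power. *)
pose n := maxn N1 N2.+1; have n1 : (N1 <= n)%N := leq_maxl _ _.
have n2 : (N2 <= n)%N by rewrite ltnW // leq_maxr.
have n0 : (0 < n)%N by rewrite (leq_trans _ (leq_maxr _ _)).
have ker2 x : F n (F n x) = 0 -> F n x = 0.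
  move=> Fx; apply/kermP; rewrite (N1P n) // -(N1P (n + n)%N) ?(leq_trans n1)
    ?leq_addr //.
  by apply/kermP; rewrite FE iterD -!FE.
have im2 x : exists y, F n x = F n (F n y).
  have : F n x \in imagem (F (n + n)%N) (fullm _).
    rewrite N2P ?(leq_trans n2) ?leq_addr // -(N2P n) //; apply/imagemP;
      by exists x.
  by move=> /imagemP[y _ <-]; exists y; rewrite !FE iterD.
pose S : {linear (submod (kerm (F n)) * submod (imagem (F n) (fullm _)))%type
  -> M} :=
  (inclm _ \o fst) \+ (inclm _ \o snd).
have bS : bijective S.
  apply/bijP; split=> [|x].
    apply: linear_inj0 => -[u v]; rewrite /S /= => uv.
    have /kermP Fu := inclm_in u; have /imagemP[y _ yE] := inclm_in v.
    have v0 : inclm _ v = 0.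
      rewrite -yE; apply: ker2; rewrite yE.
      by have := congr1 (F n) uv; rewrite linearD Fu add0r linear0.
    move: uv; rewrite v0 addr0 => u0; congr (_, _); apply: inclm_inj.
      by rewrite u0 linear0.
    by rewrite v0 linear0.
  have [y yE] := im2 x.
  have [|u uE] := @inclmP _ _ (kerm (F n)) (x - F n y).
    by apply/kermP; rewrite linearB yE subrr.
  have [|v vE] := @inclmP _ _ (imagem (F n) (fullm _)) (F n y).
    by apply/imagemP; exists y.
  by exists (u, v); rewrite /S /= uE vE subrK.
have [] := indM.2 _ _ (isomorphic_sym (ex_intro _ S bS)) => [K0|I0]; last first.
  right; exists n => x; rewrite -FE.
  have [|v <-] := @inclmP _ _ (imagem (F n) (fullm _)) (F n x).
    by apply/imagemP; exists x.
  by rewrite (I0 v) linear0.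
left; apply/bijP; split=> [|x].
  apply: linear_inj0 => x fx.
  have [|u <-] := @inclmP _ _ (kerm (F n)) x; last by rewrite (K0 u) linear0.
  by apply/kermP; rewrite FE -(prednK n0) iterSr fx -FE linear0.
have [[u v] <-] := ((bijP S).1 bS).2 x.
rewrite /S /= (K0 u) linear0 add0r; have /imagemP[y _ <-] := inclm_in v.
by exists (F n.-1 y); rewrite !FE -iterS prednK.
Qed.

(** Locality of the endomorphism ring: [f] is nilpotent by Fitting's lemma, and [y - iter n f y] is
    a value of [g] by the geometric series. *)
Lemma nonbij_subr (f g : {linear M -> M}) :
  ~ bijective f -> (forall x, g x = x - f x) -> bijective g.
Proof.
case: (fitting f) => // -[n fn] _ gE; apply/bijP; split=> [|y].
  apply: linear_inj0 => x; rewrite gE => /eqP; rewrite subr_eq0 => /eqP xf.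
  rewrite -(fn x); elim: n {fn} => //= n <-; exact: xf.
have: exists x, y - iter n f y = g x.
  elim: n {fn} => [|n [x xE]] /=; first by exists 0; rewrite subrr linear0.
  exists (x + iter n f y); rewrite linearD -xE [g (iter _ _ _)]gE.
  by rewrite addrA subrK.
by rewrite fn subr0 => -[x]; exists x.
Qed.

End Fitting.

(** * Families of modules with local endomorphism rings *)

Section FactoringMaps.
Variables (A : pzRingType) (I : Type) (Q : I -> lmodType A).
Implicit Types X Y Z : lmodType A.

(** Finite sums of maps that factor through a map [u] with [U u]. *)
Inductive fac Y (U : forall j, {linear Q j -> Y} -> Prop) X :
    {linear X -> Y} -> Prop :=
| fac0 (h : {linear X -> Y}) : (forall x, h x = 0) -> fac U h
| facD (h h1 h2 : {linear X -> Y}) :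
    fac U h1 -> fac U h2 -> (forall x, h x = h1 x + h2 x) -> fac U h
| facM j (u : {linear Q j -> Y}) (g : {linear X -> Q j}) (h : {linear X -> Y}) :
    U j u -> (forall x, h x = u (g x)) -> fac U h.

Lemma fac_gen Y (U : forall j, {linear Q j -> Y} -> Prop) j u :
  U j u -> fac U u.
Proof. by move=> Uu; apply: (facM (g := idfun) Uu). Qed.

Lemma fac_precomp Y (U : forall j, {linear Q j -> Y} -> Prop) X Z
    (h : {linear X -> Y}) (k : {linear Z -> X}) (h' : {linear Z -> Y}) :
  fac U h -> (forall x, h' x = h (k x)) -> fac U h'.
Proof.
move=> fh; elim: fh h' => {h} [h h0|h h1 h2 _ IH1 _ IH2 hE|j u g h Uu hE] h'
  h'E.
- by apply: fac0 => x; rewrite h'E h0.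
- apply: (facD (IH1 (h1 \o k) _) (IH2 (h2 \o k) _)) => // x.
  by rewrite h'E hE.
- by apply: (facM (g := g \o k) Uu) => x; rewrite h'E hE.
Qed.

Lemma fac_postcomp Y Y' (U : forall j, {linear Q j -> Y} -> Prop)
    (V : forall j, {linear Q j -> Y'} -> Prop) X (p : {linear Y -> Y'})
    (h : {linear X -> Y}) (h' : {linear X -> Y'}) :
    (forall j u, U j u -> fac V (p \o u)) ->
  fac U h -> (forall x, h' x = p (h x)) -> fac V h'.
Proof.
move=> UV fh; elim: fh h' =>
  {h} [h h0|h h1 h2 _ IH1 _ IH2 hE|j u g h Uu hE] h' h'E.
- by apply: fac0 => x; rewrite h'E h0 linear0.
- apply: (facD (IH1 (p \o h1) _) (IH2 (p \o h2) _)) => // x.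
  by rewrite h'E hE linearD.
- by apply: (fac_precomp (k := g) (UV _ _ Uu)) => x; rewrite h'E hE.
Qed.

Lemma fac_trans Y (U V : forall j, {linear Q j -> Y} -> Prop) X
    (h : {linear X -> Y}) :
  (forall j u, U j u -> fac V u) -> fac U h -> fac V h.
Proof.
move=> UV fh; apply: (fac_postcomp (p := idfun) _ fh) => // j u Uu.
by apply: (fac_precomp (k := idfun) (UV _ _ Uu)).
Qed.

Lemma fac_sub Y (U : forall j, {linear Q j -> Y} -> Prop) X
    (h h1 h2 : {linear X -> Y}) :
  fac U h1 -> fac U h2 -> (forall x, h x = h1 x - h2 x) -> fac U h.
Proof.
move=> f1 f2 hE; apply: (facD (h2 := GRing.opp \o h2) f1 _ hE).
by apply: (fac_precomp (k := GRing.opp) f2) => x /=; rewrite linearN.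
Qed.

Lemma fac_kill Y Y' (U : forall j, {linear Q j -> Y} -> Prop) X
    (p : {linear Y -> Y'}) (h : {linear X -> Y}) :
  (forall j u, U j u -> forall x, p (u x) = 0) -> fac U h -> forall x,
    p (h x) = 0.
Proof.
move=> Up; elim=> {h} [h h0|h h1 h2 _ IH1 _ IH2 hE|j u g h Uu hE] x.
- by rewrite h0 linear0.
- by rewrite hE linearD IH1 IH2 addr0.
- by rewrite hE Up.
Qed.

(** Each summand is extended separately, so the extension stays in the same subfunctor;
    Ext-injectivity will supply the hypothesis. *)
Lemma fac_extend Y (U : forall j, {linear Q j -> Y} -> Prop) X Z
    (f : {linear X -> Z}) (h : {linear X -> Y}) :
    (forall j (w : {linear X -> Q j}),
      exists w' : {linear Z -> Q j}, forall x, w' (f x) = w x) ->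
  fac U h -> exists2 h' : {linear Z -> Y}, fac U h' & forall x, h' (f x) = h x.
Proof.
move=> ext; elim=> {h} [h h0|h h1 h2 _ [k1 f1 k1E] _ [k2 f2 k2E] hE|j u g h Uu
  hE].
- by exists \0 => [|x]; [apply: fac0 | rewrite h0].
- exists (k1 \+ k2); first exact: facD f1 f2 _.
  by move=> x; rewrite /= k1E k2E hE.
- have [w wE] := ext _ g; exists (u \o w) => [|x]; last by rewrite /= wE hE.
  exact: (facM (g := w) Uu).
Qed.

End FactoringMaps.

(** * Radical maps and the trace submodule *)

Section LocalFamily.
Variables (A : pzRingType) (I : finType) (Q : I -> lmodType A) (le : rel I).
Hypothesis Q_local : forall i (f g : {linear Q i -> Q i}),
  ~ bijective f -> (forall x, g x = x - f x) -> bijective g.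
Hypothesis Q_neq0 : forall i, ~ zero_module (Q i).
Hypothesis Q_iso : forall i j, isomorphic (Q i) (Q j) -> i = j.

(** With [h] inverse to [f \o g], one has [f \o e = f]. Were [e] not bijective, [1 - e] would be
    onto while [f] vanishes on its image, making [f] and then [Q j] zero. *)
Lemma bij_comp_left i j (f : {linear Q i -> Q j}) (g : {linear Q j -> Q i}) :
  bijective (f \o g) -> bijective f.
Proof.
move=> /[dup] bfg /linear_bij_inv[h [hK Kh]].
pose e : {linear Q i -> Q i} := g \o (h \o f).
have [/bijP[inje _]|ne] := pselect (bijective e).
  apply/bijP; split; last by move=> y; exists (g (h y)); apply: Kh.
  by apply: linear_inj0 => x fx; apply: inje; rewrite /e /= fx !linear0.
have /bijP[_ sur1e] := Q_local (g := idfun \+ (GRing.opp \o e)) ne (fun _ =>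
  erefl).
case: (@Q_neq0 j) => x; rewrite -[x](Kh) /=.
have [y <-] := sur1e (g (h x)); rewrite /= linearB /e /=.
by rewrite [f (g _)]Kh subrr.
Qed.

Lemma bij_comp_right i j (f : {linear Q i -> Q j}) (g : {linear Q j -> Q i}) :
  bijective (f \o g) -> bijective g.
Proof.
move=> bfg; have /linear_bij_inv[h [hK Kh]] := bij_comp_left bfg.
apply: (eq_bij (f := h \o (f \o g))) => [|x]; last by rewrite /= hK.
by apply: bij_comp => //; exists f.
Qed.

Lemma nonbij_neq i j (f : {linear Q i -> Q j}) : i <> j -> ~ bijective f.
Proof. by move=> nij bf; apply: nij; apply: Q_iso; exists f. Qed.

(** A bijective composite identifies [i] with [k], since distinct members are not isomorphic; then
    [bij_comp_right] applies. *)
Lemma nonbij_postcomp i j k (f : {linear Q j -> Q k}) (g : {linear Q i ->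
  Q j}) :
  ~ bijective g -> ~ bijective (f \o g).
Proof.
move=> ng bfg; have eik : i = k by apply: Q_iso; exists (f \o g).
case: k / eik f bfg => f bfg; exact/ng/(bij_comp_right bfg).
Qed.

Lemma nonbij_precomp i j k (f : {linear Q j -> Q k}) (g : {linear Q i -> Q j}) :
  ~ bijective f -> ~ bijective (f \o g).
Proof.
move=> nf bfg; have eik : i = k by apply: Q_iso; exists (f \o g).
case: k / eik f nf bfg => f nf bfg; exact/nf/(bij_comp_left bfg).
Qed.

(** If [h] inverts the sum, then [h \o g = 1 - h \o f] is bijective by locality. *)
Lemma nonbijD i (f g : {linear Q i -> Q i}) :
  ~ bijective f -> ~ bijective g -> ~ bijective (f \+ g).
Proof.
move=> nf ng /linear_bij_inv[h [hK Kh]].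
have hb : bijective h by exists (f \+ g).
apply: (nonbij_postcomp (f := h) ng).
apply: (Q_local (nonbij_postcomp (f := h) nf)) => x /=.
by rewrite -[X in X - _]hK /= linearD addrAC subrr add0r.
Qed.

Local Notation QS := (dsumm Q).
Local Notation Gamma := (opendo QS).

Definition homm (X : lmodType A) : lmodType Gamma := lin_hom QS X.
Local Notation P i := (homm (Q i)).

Local Notation pr i := (dsum_proj Q i).
Local Notation inj i := (dsum_inj Q i).

Lemma homscaleE i (a : Gamma) (h : P i) x :
  ((a *: h : P i) : {linear QS -> Q i}) x
  = (h : {linear QS -> Q i}) ((a : {linear QS -> QS}) x).
Proof. by []. Qed.

(** As in Yoneda's lemma: every [h] is [inj i \o h] acting on [pr i], so a morphism [P i -> P j] is
    postcomposition with a map [Q i -> Q j]. *)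
Lemma P_factor i j (f : {linear P i -> P j}) (h : {linear QS -> Q i}) x :
  (f h : {linear QS -> Q j}) x
  = (f (pr i : {linear QS -> Q i}) : {linear QS -> Q j}) (inj i (h x)).
Proof.
have {1}-> : (h : P i) = ((inj i \o h : {linear QS -> QS}) : Gamma) *: (pr i :
  P i).
  by apply: homP => y; rewrite homscaleE /= dsum_injE.
by rewrite linearZ.
Qed.

Fact nonsplit_closed i : submod_closed (fun h : P i =>
  `[< forall s : {linear Q i -> QS}, ~ bijective ((h : {linear QS ->
    Q i}) \o s) >]).
Proof.
split=> [|a h k /asboolP nh /asboolP nk]; apply/asboolP => s.
  case/bijP=> /= injh _; case: (@Q_neq0 i) => x; apply: injh.
  by [].
pose s' : {linear Q i -> QS} := (a : {linear QS -> QS}) \o s.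
exact: (nonbijD (nh s') (nk s)).
Qed.

(** The maps that are not split epimorphisms form the only maximal submodule: a submodule containing
    some [k] with [k \o s] bijective contains every map. *)
Lemma mem_radicalP i (h : {linear QS -> Q i}) :
  (h : P i) \in radical (P i) <->
  forall s : {linear Q i -> QS}, ~ bijective (h \o s).
Proof.
pose S : submodule (P i) := Submodule (nonsplit_closed i).
have prS : (pr i : P i) \notin S.
  apply/negP => /asboolP/(_ (inj i)); apply; exists id => x /=;
  by rewrite dsum_injE.
have topS (T : submodule (P i)) (k : P i) (s : {linear Q i -> QS}) :
    k \in T -> bijective ((k : {linear QS -> Q i}) \o s) -> forall h : P i,
      h \in T.
  move=> kT /linear_bij_inv[g [gK Kg]] h'.
  have -> : h' = (((s \o g) \o (h' : {linear QS -> Q i}) : {linear QS -> QS}) :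
    Gamma) *: k.
    by apply: homP => x; rewrite homscaleE; apply/esym/Kg.
  exact: rpredZ.
have maxS : maximal_submodule S.
  split=> [|T ST [k kT] x]; first by exists (pr i).
  apply/idP/idP => [xT|/ST//]; apply/asboolP => s bs.
  by move: kT; rewrite (topS T x s).
split=> [/asboolP/(_ _ maxS)/asboolP //|nh].
apply/asboolP => T [[k kT] maxT].
have TS : {subset T <= S}.
  by move=> x xT; apply/asboolP => s bs; move: kT; rewrite (topS T x s).
have : (h : P i) \in S by apply/asboolP.
by rewrite (maxT S TS) //; exists (pr i).
Qed.

Definition radmaps i j (u : {linear Q j -> Q i}) : Prop :=
  le j i /\ ~ bijective u.

(** The [K i] of the overview; keeping the shape of [proper_standard] makes its quotient convertible
    to the proper standard module. *)
Definition rad_trace i : submodule (P i) :=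
  trace (dsum (fun j : {j | opp_order le i j} => P (val j))) (radical (P i)).

Fact fac_closed i (U : forall j, {linear Q j -> Q i} -> Prop) :
  submod_closed (fun h : P i => `[< fac U (h : {linear QS -> Q i}) >]).
Proof.
split=> [|a h k /asboolP fh /asboolP fk]; apply/asboolP; first exact: fac0.
apply: (facD (h1 := (h : {linear QS -> Q i}) \o (a : {linear QS ->
  QS})) _ fk) => //.
exact: fac_precomp fh _.
Qed.
Definition facS i U : submodule (P i) := Submodule (fac_closed U).

(** A morphism from the direct sum has components [P j -> P i], each given by a map
    [u : Q j -> Q i]; landing in the radical means that no such [u] is bijective. *)
Lemma mem_rad_trace i (h : {linear QS -> Q i}) :
  (h : P i) \in rad_trace i <-> fac (@radmaps i) h.
Proof.
pose T j := P (val (j : {j | opp_order le i j})).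
split=> [/asboolP/(_ (facS (@radmaps i)))|].
  move=> hK; apply/asboolP; apply: hK => k [f [frad [v <-]]]; apply/asboolP.
  have [g gE] : exists g : {linear dsumm T -> P i}, forall v,
    g v = f v by exists f.
  rewrite -gE [v](dsum_sum (M := T)) linear_sum.
  pose F j : P i := g (dsum_inj T j (dsum_proj T j v)).
  change (fac (@radmaps i) (\sum_j F j : P i)).
  apply: (big_ind (fun k : P i => fac (@radmaps i) (k : {linear QS -> Q i}))).
  - exact: fac0.
  - by move=> k1 k2 f1 f2; apply: facD f1 f2 _.
  move=> j _; rewrite /F; move: (dsum_proj T j v) => w.
  pose fj : {linear P (val j) -> P i} := g \o dsum_inj T j.
  pose u : {linear Q (val j) -> Q i} :=
    (fj (pr (val j) : {linear QS -> Q (val j)}) : {linear QS ->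
      Q i}) \o inj (val j).
  apply: (facM (u := u) (g := w)); last exact: (P_factor fj).
  split; first exact: (valP j).
  have /mem_radicalP fj_rad : fj (pr (val j) : {linear QS ->
    Q (val j)}) \in radical (P i).
    by rewrite /fj /= gE; apply: frad.
  move=> /[dup] bu /linear_bij_inv[u' [uK Ku]].
  apply: (fj_rad (inj (val j) \o u')).
  by exists id => x; apply: Ku.
elim=> {h} [h h0|h h1 h2 _ IH1 _ IH2 hE|j u g h [ji nu] hE].
- by rewrite (_ : (h : P i) = 0) ?rpred0 //; apply: homP.
- by rewrite (_ : (h : P i) = (h1 : P i) + h2) ?rpredD //; apply: homP.
apply/asboolP => S; apply.
pose j' : {j | opp_order le i j} := exist _ j ji.
have [f fE] : exists f : {linear dsumm T -> P i},
    forall v, f v = u \o (dsum_proj T j' v : {linear QS -> Q j}) :> lin_hom _ _.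
  by apply: linear_pack => a v w; apply: homP => x;
    rewrite [LHS]/= linearP /= linearD.
exists f; split=> [v|].
  rewrite [f v]fE; apply/mem_radicalP => s.
  exact: (nonbij_precomp (g := (dsum_proj T j' v : {linear QS ->
    Q j}) \o s) nu).
exists (dsum_inj T j' (g : P j)); rewrite [f _]fE; apply: homP => x /=.
by rewrite dsum_injE hE.
Qed.

End LocalFamily.

(** * From a proper costratifying system to the homological conditions *)

Section Complements.
Variable A : pzRingType.
Implicit Types L M N U X Y : lmodType A.

Lemma short_exact_kerm M N (g : {linear M -> N}) :
  surjective g -> short_exact (submod (kerm g)) M N.
Proof.
move=> surg; exists (inclm (kerm g)), g; split=> // [|x];
  first exact: inclm_inj.
split=> [gx|[y <-]]; last exact/kermP/inclm_in.
by apply: inclmP; apply/kermP.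
Qed.

Lemma kerm_short_exact L M N :
  short_exact L M N -> exists2 g : {linear M -> N}, surjective g &
    isomorphic L (submod (kerm g)).
Proof.
case=> f [g [injf fg surg]]; exists g => //.
have [|h hE] := @factor_inj _ _ _ _ (inclm (kerm g)) f (@inclm_inj _ _ _).
  by move=> l; apply: inclmP; apply/kermP/fg; exists l.
exists h; apply/bijP; split=> [x y hxy|x]; first by apply: injf;
  rewrite -!hE hxy.
have /kermP/fg[l lE] := inclm_in x.
by exists l; apply: inclm_inj; rewrite hE.
Qed.

Lemma same_kernel_iso M N N' (p : {linear M -> N}) (q : {linear M -> N'}) :
    surjective p -> surjective q -> (forall x, p x = 0 <-> q x = 0) ->
  isomorphic N N'.
Proof.
move=> surp surq pq.
have [|f fE] := @factor_surj _ _ _ _ p q surp; first by move=> x /pq.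
exists f; apply/bijP; split=> [|y].
  by apply: linear_inj0 => n; have [x <-] := surp n; rewrite fE => /pq.
by have [x <-] := surq y; exists (p x); rewrite fE.
Qed.

Lemma lifts_iso U Y Y' : isomorphic Y Y' -> lifts U Y -> lifts U Y'.
Proof.
case=> h /bijP[injh surh] lU M N f g u injf fg surg.
apply: (lU _ _ (f \o h) g u _ _ surg); first exact: inj_comp.
move=> y; rewrite fg; split=> [[x <-]|[x <-]]; last by exists (h x).
by have [z <-] := surh x; exists z.
Qed.

Lemma lifts_dsum (I : finType) (F : I -> lmodType A) Y :
  (forall i, lifts (F i) Y) <-> lifts (dsumm F) Y.
Proof.
split=> [lF M N f g u injf fg surg|lF i M N f g u injf fg surg].
  have lft i : exists w : {linear F i -> M}, forall x,
    g (w x) = u (dsum_inj F i x).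
    exact: (lF i _ _ f g (u \o dsum_inj F i)).
  pose w i := sval (cid (lft i)).
  have wE i x : g (w i x) = u (dsum_inj F i x) := svalP (cid (lft i)) x.
  have [v vE] : exists v : {linear dsumm F -> M}, forall x,
      v x = \sum_i w i (dsum_proj F i x).
    apply: linear_pack => a x y; rewrite scaler_sumr -big_split.
    by apply: eq_bigr => i _; rewrite !linearP.
  exists v => x; rewrite vE linear_sum [in RHS](dsum_sum x) linear_sum.
  by apply: eq_bigr => i _; apply: wE.
have [w wE] := lF _ _ f g (u \o dsum_proj F i) injf fg surg.
by exists (w \o dsum_inj F i) => x; rewrite /= wE /= dsum_injE.
Qed.

End Complements.

Section Tensoring.
Variables (A : pzRingType) (I : finType) (Q : I -> lmodType A).
Local Notation QS := (dsumm Q).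
Local Notation P i := (homm Q (Q i)).

Definition tensm (M : lmodType (opendo QS)) : lmodType A := tensor M.

Lemma ev_bij i : bijective (ev QS (Q i)).
Proof. exact: (ev_summand (@dsum_injE A I Q i)). Qed.

Lemma P_projective i : projective (P i).
Proof. exact: (hom_summand_projective (@dsum_injE A I Q i)). Qed.

(** Right exactness of the tensor product, transported along the bijective counit. *)
Lemma tens_quo i (S : submodule (P i)) :
  exists q : {linear Q i -> tensm (quo S)},
  [/\ surjective q,
      forall x, q x = 0 <-> exists y, ev QS (Q i) (tmap (inclm S) y) = x &
      forall (h : {linear QS -> Q i}) z, q (h z) = tens z (quo_proj S (h :
        P i))].
Proof.
have [e [evK eK]] := linear_bij_inv (ev_bij i).
pose q : {linear Q i -> tensm (quo S)} := tmap (quo_proj S) \o e.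
have surt := tmap_surj (@quo_proj_surj _ _ S).
exists q; split=> [y|x|h z].
- by have [x <-] := surt y; exists (ev QS (Q i) x); rewrite /q /= evK.
- have -> : q x = tmap (quo_proj S) (e x) by [].
  rewrite (@tmap_exact _ _ _ _ _ (inclm S)); last exact: quo_proj_surj.
    by split=> [[y yE]|[y yE]]; exists y; [rewrite yE eK | rewrite -yE evK].
  move=> y; rewrite quo_proj_eq0; split=> [/inclmP //|[u <-]]; exact: inclm_in.
rewrite /q /= -[h z](ev_tens z h) evK.
exact: tmap_tens.
Qed.

End Tensoring.

Section ProperCostratifying.
Variables (A : pzRingType) (I : finType) (Q Psi : I -> lmodType A) (le : rel I).
Hypothesis Q_local : forall i (f g : {linear Q i -> Q i}),
  ~ bijective f -> (forall x, g x = x - f x) -> bijective g.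
Hypothesis Q_neq0 : forall i, ~ zero_module (Q i).
Hypothesis Q_iso : forall i j, isomorphic (Q i) (Q j) -> i = j.
Hypothesis le_order : linear_order le.
Hypothesis Psi_division : forall i, division_ring (endo (Psi i)).
Hypothesis Psi_hom : forall i j, strict_part le i j ->
  forall f : {linear Psi i -> Psi j}, f =1 \0.
Hypothesis Psi_exact : forall i, exists2 Z : lmodType A,
  filt Psi (fun j => le j i) Z & short_exact Z (Q i) (Psi i).
Hypothesis Psi_lifts : forall i j, lifts (Q i) (Psi j).
Implicit Types L X Y : lmodType A.
Local Notation QS := (dsumm Q).
Local Notation P i := (homm Q (Q i)).
Local Notation K := (rad_trace Q le).

Lemma Psi_proj_exists i : exists p : {linear Q i -> Psi i},
  surjective p /\ filt Psi (fun j => le j i) (submod (kerm p)).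
Proof.
have [Z fZ /kerm_short_exact[p surp ZK]] := Psi_exact i.
by exists p; split=> //; apply: filt_iso fZ.
Qed.

Definition Psi_proj i := sval (cid (Psi_proj_exists i)).
Local Notation p i := (Psi_proj i).

Lemma Psi_proj_surj i : surjective (p i).
Proof. by have [] := svalP (cid (Psi_proj_exists i)). Qed.
Lemma Psi_proj_filt i : filt Psi (fun j => le j i) (submod (kerm (p i))).
Proof. by have [] := svalP (cid (Psi_proj_exists i)). Qed.

Lemma Q_filt i : filt Psi (fun j => le j i) (Q i).
Proof.
have [rle _ _ _] := le_order.
exact: filtS (Psi_proj_filt i) (rle i) (short_exact_kerm (@Psi_proj_surj i)).
Qed.

Lemma Psi_endo i (f : {linear Psi i -> Psi i}) : f =1 \0 \/ bijective f.
Proof.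
have [_ div] := Psi_division i; have [f0|f0] := pselect (f =1 \0);
  first by left.
right; have [|g [gf fg]] := div f.
  by move=> fz; apply: f0 => x; rewrite -[LHS]/((f : endo (Psi i)) x) fz.
exists (g : {linear Psi i -> Psi i}) => x.
  exact: (congr1 (fun h : endo (Psi i) => (h : {linear Psi i -> Psi i}) x) gf).
exact: (congr1 (fun h : endo (Psi i) => (h : {linear Psi i -> Psi i}) x) fg).
Qed.

Lemma Psi_proj_neq0 i : ~ forall x, p i x = 0.
Proof.
move=> p0; have [n10 _] := Psi_division i; apply: n10; apply: homP => y.
by have [x <-] := @Psi_proj_surj i y; rewrite p0.
Qed.

Lemma lifts_Psi_filt i S X : filt Psi S X -> lifts (Q i) X.
Proof. by apply: lifts_filt => j _; apply: Psi_lifts. Qed.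

Lemma lifts_QS_filt S X : filt Psi S X -> lifts QS X.
Proof. by move=> fX; apply/lifts_dsum => i; apply: lifts_Psi_filt fX. Qed.

(** The [Psi j] behave as simple objects: a nonzero map to a [Psi i] whose index
    dominates is an epimorphism with filtered kernel. *)
Lemma Psi_epi i X (g : {linear X -> Psi i}) :
    filt Psi (fun j => le j i) X ->
  (forall x, g x = 0) \/
  surjective g /\ filt Psi (fun j => le j i) (submod (kerm g)).
Proof.
move=> fX; elim: fX g => {X} [X X0 g|L X j fL IH ji [f [pi [injf fpi surpi]]]
  g].
  by left=> x; rewrite (X0 x) linear0.
have pif l : pi (f l) = 0 by apply/fpi; exists l.
(* If [g] vanishes on [L], it is induced by a map [Psi j -> Psi i], which is zero for [j <> i] and
   zero or bijective for [j = i]. Otherwise [g] is already onto on [L], and its kernel is an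
   extension of [Psi j] by the kernel on [L]. *)
have [gf0|[surgf fker]] := IH (g \o f).
  have [|h hE] := @factor_surj _ _ _ _ pi g surpi.
    by move=> y /fpi[l <-]; apply: gf0.
  have [ej|nji] := eqVneq j i; last first.
    left=> x; rewrite -hE Psi_hom // /strict_part nji; exact: ji.
  case: i / ej ji g gf0 h hE IH fL => ji g gf0 h hE IH fL.
  have [h0|/bijP[injh surh]] := Psi_endo h; first by left=> x; rewrite -hE h0.
  right; split=> [y|].
    by have [z <-] := surh y; have [x <-] := surpi z; exists x; rewrite hE.
  apply: filt_iso fL.
  have [|k kE] := @factor_inj _ _ _ _ (inclm (kerm g)) f (@inclm_inj _ _ _).
    by move=> l; apply: inclmP; apply/kermP/gf0.
  exists k; apply/bijP; split=> [x y kxy|x]; first by apply: injf;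
    rewrite -!kE kxy.
  have /kermP := inclm_in x; rewrite -hE -[0](linear0 h) => /injh/fpi[l lE].
  by exists l; apply: inclm_inj; rewrite kE.
right; split=> [y|]; first by have [l lE] := surgf y; exists (f l).
apply: filtS fker ji _.
have [|k kE] := @factor_inj _ _ _ _ (inclm (kerm g)) (f \o inclm (kerm (g \o
  f))) (@inclm_inj _ _ _).
  by move=> l; apply: inclmP; apply/kermP;
    apply: (kermP (g \o f) _ (inclm_in l)).
exists k, (pi \o inclm (kerm g)); split=> [x y kxy|x|y] /=.
- by apply: inclm_inj; apply: injf; have := kE y; rewrite -kxy kE.
- rewrite fpi; split=> [[l lE]|[l <-]]; last first.
    by exists (inclm _ l); rewrite -[LHS]/((f \o inclm _) l) -kE.
  have [|u uE] := @inclmP _ _ (kerm (g \o f)) l.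
    by apply/kermP; rewrite /= lE; apply/kermP/inclm_in.
  by exists u; apply: inclm_inj; rewrite kE /= uE lE.
have [x <-] := surpi y; have [l lE] := surgf (g x).
have [|u uE] := @inclmP _ _ (kerm g) (x - f l).
  by apply/kermP; rewrite linearB -lE subrr.
by exists u; rewrite uE linearB pif subr0.
Qed.

Lemma Psi_step j L X (f : {linear L -> X}) (pi : {linear X -> Psi j}) S :
    filt Psi S L -> injective f -> exact f pi -> surjective pi ->
  exists u : {linear Q j -> X}, forall x, pi (u x) = p j x.
Proof. by move=> /lifts_Psi_filt lL injf fpi surpi; apply: (lL _ _ _ f). Qed.

Lemma hom_post_Psi_proj j (h : {linear QS -> Psi j}) :
  exists g : {linear QS -> Q j}, forall x, p j (g x) = h x.
Proof.
apply: (lifts_QS_filt (Psi_proj_filt j)); last exact: Psi_proj_surj.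
  exact: inclm_inj.
move=> x; split=> [/kermP/inclmP //|[y <-]]; exact/kermP/inclm_in.
Qed.

(** Subtracting a lift through the top [Q j] leaves a map into the smaller filtered module [L]. *)
Lemma filt_fac (S : pred I) X (h : {linear QS -> X}) :
  filt Psi S X -> fac (fun j (_ : {linear Q j -> X}) => S j) h.
Proof.
move=> fX; elim: fX h => {X} [X X0 h|L X j fL IH Sj [f [pi [injf fpi surpi]]]
  h].
  by apply: fac0 => x; apply: X0.
have [u uE] := Psi_step fL injf fpi surpi.
have [g gE] := hom_post_Psi_proj (pi \o h).
have [|k kE] := @factor_inj _ _ _ _ f (h \+ (GRing.opp \o (u \o g))) injf.
  by move=> x; apply/fpi; rewrite /= linearB uE gE /= subrr.
apply: (facD (h1 := f \o k) (h2 := u \o g)) => [||x];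
  last by rewrite /= kE /= subrK.
  by apply: (fac_postcomp (p := f) _ (IH k)) => // i v Si; apply: fac_gen.
exact: (facM (g := g)).
Qed.

(** Otherwise [p i \o u] is epi with filtered kernel, and [p i] lifts along it to some [s]. As
    [u \o s] is not bijective, [1 - u \o s] is onto; but [p i] vanishes on its image, so [p i] would
    be zero. *)
Lemma Psi_proj_radmap i j (u : {linear Q j -> Q i}) :
  radmaps le u -> forall x, p i (u x) = 0.
Proof.
move=> [ji nu]; have [_ _ trle _] := le_order.
have fQ : filt Psi (fun k => le k i) (Q j).
  by apply: filt_sub (Q_filt j) => k kj; apply: trle kj ji.
have [//|[surpu fker]] := Psi_epi (p i \o u) fQ; exfalso.
have [|||s sE] := @lifts_Psi_filt i _ _ fker _ _ (inclm _) (p i \o u) (p i).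
- exact: inclm_inj.
- by move=> x; split=> [/kermP/inclmP //|[y <-]]; exact/kermP/inclm_in.
- exact: surpu.
apply: (@Psi_proj_neq0 i) => x.
have nus := nonbij_precomp Q_local Q_neq0 Q_iso (g := s) nu.
have /bijP[_ sur] := Q_local (g :=
  idfun \+ (GRing.opp \o (u \o s))) nus (fun _ => erefl).
have [y <-] := sur x; rewrite /= linearB; have := sE y; rewrite /= => ->.
exact: subrr.
Qed.

(** A map killed by [p i] lands in the filtered kernel of [p i], hence is a sum of maps through some
    [Q j] with [j <= i]; the maps [Q j -> Q i] so obtained are not onto, hence radical. *)
Lemma mem_rad_trace_Psi i (h : {linear QS -> Q i}) :
  (h : P i) \in K i <-> forall x, p i (h x) = 0.
Proof.
rewrite mem_rad_trace //; split=> [fh|ph].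
  by apply: fac_kill fh => j u; apply: Psi_proj_radmap.
have [|k kE] := @factor_inj _ _ _ _ (inclm (kerm (p i))) h (@inclm_inj _ _ _).
  by move=> x; apply: inclmP; apply/kermP.
apply: (fac_postcomp (p :=
  inclm (kerm (p i))) _ (filt_fac k (Psi_proj_filt i))) => //.
move=> j u ji; apply: fac_gen; split=> // /bijP[_ suru].
apply: (@Psi_proj_neq0 i) => x; have [y <-] := suru x.
exact/kermP/inclm_in.
Qed.

Lemma ev_surj_filt S X : filt Psi S X -> surjective (ev QS X).
Proof.
elim=> {X} [X X0 x|L X j fL IH Sj [f [pi [injf fpi surpi]]] x].
  by exists 0; rewrite linear0 (X0 x).
have [u uE] := Psi_step fL injf fpi surpi.
have [y yE] := @Psi_proj_surj j (pi x).
have [|l lE] := (fpi (x - u y)).1; first by rewrite linearB uE yE subrr.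
have [z zE] := IH l.
exists (tens (dsum_inj Q j y) (u \o dsum_proj Q j :
  lin_hom QS X) + tmap (hom_post f) z).
by rewrite linearD ev_tens ev_natural zE lE /= dsum_injE addrC subrK.
Qed.

Lemma Psi_proj_ker_ev i x : p i x = 0 ->
  exists y : tensm (homm Q (submod (kerm (p i)))),
    ev QS (Q i) (tmap (hom_post (inclm (kerm (p i)))) y) = x.
Proof.
move=> /kermP/inclmP[u uE]; have [y yE] := ev_surj_filt (Psi_proj_filt i) u.
by exists y; rewrite ev_natural yE.
Qed.

(** For [Psi j], lift to [Q (x) P j], where the counit is bijective: an element of the kernel comes
    from the kernel of [p j] and so vanishes. In general [Hom(Q, -)] is exact on each filtration
    step, and a diagram chase concludes. *)
Lemma ev_inj_filt S X : filt Psi S X -> injective (ev QS X).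
Proof.
have ev_Psi j : injective (ev QS (Psi j)).
  apply: linear_inj0 => y evy.
  have [|z zE] := @tmap_surj _ QS (homm Q (Q j)) (homm Q (Psi j)) (hom_post (p
    j)) _ y.
    move=> h; have [g gE] := hom_post_Psi_proj (h : {linear QS -> Psi j}).
    by exists (g : lin_hom QS (Q j)); apply: homP.
  have [|w wE] := @Psi_proj_ker_ev j (ev QS (Q j) z).
    by rewrite -ev_natural zE.
  rewrite -zE -((bij_inj (ev_bij Q j)) _ _ wE).
  rewrite (@tmap_comp _ _ _ _ _ (hom_post (inclm (kerm (p j)))) (hom_post (p
    j)) \0).
    exact: tmap_eq0.
  by move=> h; apply: homP => x; apply: (kermP (p j) _ (inclm_in _)).
elim=> {X} [X X0|L X j fL IH Sj [f [pi [injf fpi surpi]]]].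
  apply: linear_inj0; apply: tens_ind => [//|q h _|x y _ _ _].
    by rewrite (_ : h = 0) ?tens0r //; apply: homP => x; apply: X0.
  move: (x + y); apply: tens_ind => [//|q h|u v -> ->]; last by rewrite addr0.
  by rewrite (_ : h = 0) ?tens0r //; apply: homP => z; apply: X0.
have surh : surjective (hom_post pi : lin_hom QS X -> lin_hom QS (Psi j)).
  move=> h; have [w wE] := lifts_QS_filt fL (h : {linear QS ->
    Psi j}) injf fpi surpi.
  by exists (w : lin_hom QS X); apply: homP.
have exh : exact (hom_post f : lin_hom QS L -> lin_hom QS X) (hom_post pi).
  move=> h; split=> [hpi|[k <-]]; last first.
    by apply: homP => x; apply/fpi; exists ((k : {linear QS -> L}) x).
  have [|k kE] := @factor_inj _ _ _ _ f (h : {linear QS -> X}) injf.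
    move=> x; apply/fpi.
    exact: (congr1 (fun h : lin_hom QS (Psi j) => (h : {linear QS ->
      Psi j}) x) hpi).
  by exists (k : lin_hom QS L); apply: homP.
apply: linear_inj0 => y evy.
have [|w wE] := (tmap_exact exh surh y).1.
  by apply: ev_Psi; rewrite linear0 ev_natural evy linear0.
suff w0 : w = 0 by rewrite -wE w0 linear0.
by apply: IH; rewrite linear0; apply: injf; rewrite linear0 -ev_natural wE.
Qed.

(** Both modules are quotients of [Q i]; the kernel of [p i] is generated by images of maps from
    [QS], and these maps are the elements of [K i]. *)
Lemma Psi_tensor i : isomorphic (Psi i) (tensm (quo (K i))).
Proof.
have [q [surq qker qE]] := tens_quo (K i).
apply: (same_kernel_iso (@Psi_proj_surj i) surq) => x; split.
  move=> /Psi_proj_ker_ev[y <-]; move: y.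
  apply: tens_ind => [|z h|y z qy qz]; rewrite ?linear0 ?linear0 //; last first.
    by rewrite !linearD qy qz addr0.
  rewrite /= tmap_tens ev_tens qE.
  suff /quo_proj_eq0-> : hom_post (inclm (kerm (p i))) h \in K i by rewrite
    tens0r.
  by apply/mem_rad_trace_Psi => w; apply/kermP/inclm_in.
move=> /qker[y <-]; move: y; apply: tens_ind => [|z h|y z py pz];
  first by rewrite !linear0.
  by rewrite /= tmap_tens ev_tens;
    apply: ((mem_rad_trace_Psi _).1 (inclm_in h) z).
by rewrite !linearD py pz addr0.
Qed.

(** [a] and [b] identify [K i] with the maps from [QS] to the kernel of [p i], where the counit is
    injective; so the inclusion of [K i] in [P i] stays injective after tensoring. *)
Lemma Delta_Tor i : Tor1_eq0 QS (quo (K i)).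
Proof.
apply: (inj_Tor1_eq0 (f := inclm (K i)) (g := quo_proj (K i))).
- exact: P_projective.
- exact: inclm_inj.
- by move=> y; rewrite quo_proj_eq0; split=> [/inclmP //|[u <-]];
  exact: inclm_in.
- exact: quo_proj_surj.
pose i' := hom_post (inclm (kerm (p i))) :
  {linear homm Q (submod (kerm (p i))) -> P i}.
have inji' : injective i'.
  move=> h k hk; apply: homP => x; apply: inclm_inj.
  exact: (congr1 (fun h : lin_hom QS (Q i) => (h : {linear QS -> Q i}) x) hk).
have [|a aE] := @factor_inj _ _ _ _ i' (inclm (K i)) inji'.
  move=> h; have /mem_rad_trace_Psi ph := inclm_in h.
  have [|k kE] := @factor_inj _ _ _ _ (inclm (kerm (p i)))
      (inclm (K i) h : {linear QS -> Q i}) (@inclm_inj _ _ _).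
    by move=> x; apply: inclmP; apply/kermP.
  by exists (k : lin_hom QS _); apply: homP.
have [|b bE] := @factor_inj _ _ _ _ (inclm (K i)) i' (@inclm_inj _ _ _).
  by move=> h; apply: inclmP; apply/mem_rad_trace_Psi => x;
    apply/kermP/inclm_in.
have baK x : b (a x) = x by apply: inclm_inj; rewrite bE aE.
apply: linear_inj0 => y iy.
have ay : tmap a y = 0.
  apply: (ev_inj_filt (Psi_proj_filt i)); rewrite linear0.
  apply: inclm_inj; rewrite linear0 -ev_natural.
  by rewrite (@tmap_comp _ _ _ _ _ a i' (inclm (K i))) // iy linear0.
rewrite -[y](@tmap_id _ _ _ (b \o a) _ y); last exact: baK.
by rewrite -(@tmap_comp _ _ _ _ _ a b (b \o a)) // ay linear0.
Qed.

Lemma Delta_lifts i : lifts QS (tensm (quo (K i))).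
Proof.
apply: lifts_iso (Psi_tensor i) _; apply/lifts_dsum => j; exact: Psi_lifts.
Qed.

End ProperCostratifying.

(** * Proper standard filtrations *)

Section MoreFiltrations.
Variable A : pzRingType.
Implicit Types L M N U X Y : lmodType A.

(** The preimage of [N'] in [M], realized as the kernel of [g' \o g], is an extension of [N'] by
    [L]; this allows induction along filtrations of [N]. *)
Lemma ses_pullback L M N N' N'' (f : {linear L -> M}) (g : {linear M -> N})
    (f' : {linear N' -> N}) (g' : {linear N -> N''}) :
    injective f -> exact f g -> surjective g ->
    injective f' -> exact f' g' -> surjective g' ->
  exists (k : {linear L -> submod (kerm (g' \o g))})
         (h : {linear submod (kerm (g' \o g)) -> N'}),
    [/\ forall x, inclm _ (k x) = f x, injective k, exact k h & surjective h].
Proof.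
move=> injf fg surg injf' fg' surg'.
have gf x : g (f x) = 0 by apply/fg; exists x.
have [|k kE] := @factor_inj _ _ _ _ (inclm (kerm (g' \o g))) f (@inclm_inj _ _
  _).
  by move=> x; apply: inclmP; apply/kermP; rewrite /= gf linear0.
have [|h hE] := @factor_inj _ _ _ _ f' (g \o inclm (kerm (g' \o g))) injf'.
  by move=> x; apply/fg'; apply: (kermP (g' \o g) _ (inclm_in x)).
exists k, h; split=> // [x y kxy|y|y].
- by apply: injf; rewrite -!kE kxy.
- split=> [hy|[x <-]].
    have [|x xE] := (fg (inclm _ y)).1; first by have := hE y;
      rewrite hy linear0.
    by exists x; apply: inclm_inj; rewrite kE.
  by apply: injf'; rewrite hE linear0 /= kE.
have [m mE] := surg (f' y).
have [|u uE] := @inclmP _ _ (kerm (g' \o g)) m.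
  by apply/kermP; rewrite /= mE; apply/fg'; exists y.
by exists u; apply: injf'; rewrite hE /= uE.
Qed.

Lemma filt_ses I (F : I -> lmodType A) S L M N :
  short_exact L M N -> filt F S L -> filt F S N -> filt F S M.
Proof.
move=> LMN fL fN; elim: fN M LMN =>
  {N} [N N0|N' N j _ IH Sj N'N] M [f [g [injf fg surg]]].
  apply: filt_iso fL; exists f; apply/bijP; split=> // y; apply/fg; exact: N0.
case: N'N => f' [g' [injf' fg' surg']].
have [k [h [_ injk kh surh]]] := ses_pullback injf fg surg injf' fg' surg'.
have fK : filt F S (submod (kerm (g' \o g))) by apply: IH; exists k, h.
apply: filtS fK Sj (short_exact_kerm _) => y.
by have [z <-] := surg' y; have [x <-] := surg z; exists x.
Qed.

Lemma extends_ses N' N N'' Y :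
  short_exact N' N N'' -> extends N' Y -> extends N'' Y -> extends N Y.
Proof.
move=> [f' [g' [injf' fg' surg']]] e' e'' L M f g u injf fg surg.
have [k [h [kE injk kh surh]]] := ses_pullback injf fg surg injf' fg' surg'.
have [v vE] := e' _ _ k h u injk kh surh.
have [|||w wE] := e'' _ _ (inclm (kerm (g' \o g))) (g' \o g) v.
- exact: inclm_inj.
- move=> y; split=> [/(kermP (g' \o g))/inclmP //|[x <-]];
  exact: (kermP (g' \o g) _ (inclm_in x)).
- by move=> y; have [z <-] := surg' y; have [x <-] := surg z; exists x.
by exists w => x; rewrite -vE -wE kE.
Qed.

Lemma extends_filt I (F : I -> lmodType A) (S : pred I) Y N :
  (forall j, S j -> extends (F j) Y) -> filt F S N -> extends N Y.
Proof.
move=> eF; elim=> {N} [N N0|N' N j _ IH Sj ses]; last first.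
  exact: extends_ses ses IH (eF _ Sj).
move=> L M f g u injf fg surg.
have surf : surjective f by move=> y; apply/fg; apply: N0.
have [|w wE] := @factor_surj _ _ _ _ f u surf; last by exists w.
by move=> m; rewrite -[0](linear0 f) => /injf ->; rewrite linear0.
Qed.

Lemma hom_to_filt0 I (F : I -> lmodType A) (S : pred I) X Y :
    (forall j, S j -> forall f : {linear X -> F j}, f =1 \0) ->
  filt F S Y -> forall (f : {linear X -> Y}) x, f x = 0.
Proof.
move=> F0; elim=> {Y} [Y Y0 f x|L Y j _ IH Sj [i [p [inji ip surp]]] f x];
  first exact: Y0.
have [|g gE] := @factor_inj _ _ _ _ i f inji.
  by move=> y; apply/ip; apply: (F0 _ Sj (p \o f)).
by rewrite -gE IH linear0.
Qed.

(** An isomorphism theorem: [T] is [S] plus the image of [phi], and [W] is the preimage of [S], so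
    [T / S] is [X / W]. *)
Lemma short_exact_generated M X (S T : submodule M) (W : submodule X)
    (phi : {linear X -> M}) :
    {subset S <= T} -> (forall x, phi x \in T) ->
    (forall t, t \in T -> exists x, t - phi x \in S) ->
    (forall x, x \in W <-> phi x \in S) ->
  short_exact (submod S) (submod T) (quo W).
Proof.
move=> ST phiT Tgen Wphi.
have [|f fE] := @factor_inj _ _ _ _ (inclm T) (inclm S) (@inclm_inj _ _ _).
  by move=> x; apply: inclmP; apply: ST; apply: inclm_in.
have [|k kE] := @factor_surj _ _ _ _ (quo_proj W) (quo_proj S \o phi)
  (@quo_proj_surj _ _ _).
  by move=> x /quo_proj_eq0/Wphi xS; apply/quo_proj_eq0.
have injk : injective k.
  apply: linear_inj0 => z; have [x <-] := quo_proj_surj z; rewrite kE.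
  by move=> /quo_proj_eq0/Wphi/quo_proj_eq0.
have [|p pE] := @factor_inj _ _ _ _ k (quo_proj S \o inclm T) injk.
  move=> t; have [x xS] := Tgen _ (inclm_in t).
  by exists (quo_proj W x); rewrite kE /=; apply/esym/proj_eq.
exists f, p; split=> [x y fxy|t|z].
- by apply: inclm_inj; rewrite -!fE fxy.
- split=> [pt|[s <-]].
    have /quo_proj_eq0/inclmP[s sE] : quo_proj S (inclm T t) = 0.
      by have := pE t; rewrite pt linear0.
    by exists s; apply: inclm_inj; rewrite fE.
  by apply: injk; rewrite pE /= fE linear0; apply/quo_proj_eq0/inclm_in.
have [x <-] := quo_proj_surj z; have [t tE] := inclmP (phiT x).
by exists t; apply: injk; rewrite pE kE /= tE.
Qed.

Lemma strict_minimal (I : finType) (le : rel I) (T : I -> Prop) :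
    linear_order le -> (exists k, T k) ->
  exists2 k, T k & forall j, strict_part le j k -> ~ T j.
Proof.
move=> [rle ale trle _] [k0 Tk0].
have : exists n k, T k /\ #|[set j | le j k]| = n by exists #|[set j |
  le j k0]|, k0.
case=> n; elim/ltn_ind: n => n IH [k [Tk kn]].
have [[j [jk Tj]]|no] := pselect (exists j, strict_part le j k /\ T j);
  last first.
  by exists k => // j jk Tj; apply: no; exists j.
apply: (IH #|[set l | le l j]|); last by exists j.
rewrite -kn; apply: proper_card; apply/properP; move/andP: jk => [njk jk].
split; first by apply/subsetP => l; rewrite !inE => lj; apply: trle lj jk.
exists k; rewrite inE ?rle //; apply: contra njk => kj.
by apply/eqP/ale; rewrite jk.
Qed.

End MoreFiltrations.

(** * The layers of the trace submodule *)

Section Stratification.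
Variables (A : pzRingType) (I : finType).
Variables (Q Theta : I -> lmodType A) (le : rel I).
Hypothesis Q_local : forall i (f g : {linear Q i -> Q i}),
  ~ bijective f -> (forall x, g x = x - f x) -> bijective g.
Hypothesis Q_neq0 : forall i, ~ zero_module (Q i).
Hypothesis Q_iso : forall i j, isomorphic (Q i) (Q j) -> i = j.
Hypothesis le_order : linear_order le.
Hypothesis Theta_hom : forall i j, strict_part le j i ->
  forall f : {linear Theta i -> Theta j}, f =1 \0.
Hypothesis Theta_exact : forall i, exists2 Z : lmodType A,
  filt Theta (fun j => strict_part le j i) Z & short_exact (Theta i) (Q i) Z.
Hypothesis Theta_extends : forall i j, extends (Theta j) (Q i).
Implicit Types L X Y : lmodType A.
Local Notation QS := (dsumm Q).
Local Notation P i := (homm Q (Q i)).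
Local Notation K := (rad_trace Q le).

Definition proper_delta i : lmodType (opendo QS) := quo (K i).

Lemma Theta_in i : exists (Z : lmodType A) (f : {linear Theta i -> Q i}) (g :
  {linear Q i -> Z}),
  [/\ filt Theta (fun j => strict_part le j i) Z,
      injective f, exact f g & surjective g].
Proof. by have [Z fZ [f [g [injf fg surg]]]] := Theta_exact i; exists Z, f,
  g. Qed.

Lemma Theta_map_extend i j : exists f : {linear Theta j -> Q j},
  forall h : {linear Theta j -> Q i}, exists u : {linear Q j -> Q i}, forall x,
    h x = u (f x).
Proof.
have [Z [f [g [fZ injf fg surg]]]] := Theta_in j; exists f => h.
have [|u uE] := @extends_filt _ _ Theta _ (Q i) _ _ fZ _ _ f g h injf fg surg.
  by move=> k _; apply: Theta_extends.
by exists u => x; rewrite uE.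
Qed.

Lemma Q_Theta_filt i : filt Theta (fun j => le j i) (Q i).
Proof.
have [Z fZ ses] := Theta_exact i; have [rle _ _ _] := le_order.
apply: filt_ses ses (filt1 _ (rle i)) (filt_sub _ fZ) => j.
by move=> /andP[].
Qed.

Lemma hom_Theta_Q i j : strict_part le i j -> forall (f : {linear Theta j ->
  Q i}) x, f x = 0.
Proof.
move=> /andP[nij ij]; apply: hom_to_filt0 (Q_Theta_filt i) => k ki f.
apply: Theta_hom; have [_ ale trle _] := le_order.
rewrite /strict_part (trle _ _ _ ki ij) andbT; apply: contraNneq nij => ekj.
by apply/eqP/ale; rewrite ij -ekj ki.
Qed.

(** Extend the restriction of [h] to [L] by Ext-injectivity; the difference factors through
    [Theta j], hence through [Q j]. *)
Lemma Theta_fac i X (S : pred I) (h : {linear X -> Q i}) :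
  filt Theta S X -> fac (fun j (_ : {linear Q j -> Q i}) => S j) h.
Proof.
move=> fX; elim: fX h => {X} [X X0 h|L X j _ IH Sj [f [p [injf fp surp]]] h].
  by apply: fac0 => x; rewrite (X0 x) linear0.
have [|h' fh' h'E] := @fac_extend _ _ _ _ _ _ _ f (h \o f) _ (IH (h \o f)).
  by move=> l w; apply: Theta_extends injf fp surp.
have [|g gE] := @factor_surj _ _ _ _ p (h \+ (GRing.opp \o h')) surp.
  by move=> x /fp[l <-]; rewrite /= h'E subrr.
have [io ioP] := Theta_map_extend i j; have [u uE] := ioP g.
apply: (facD (h1 := u \o (io \o p)) (h2 := h') _ fh'); last first.
  by move=> x; rewrite /= -uE gE /= subrK.
exact: (facM (g := io \o p)).
Qed.

Section Layer.
Variable i : I.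
Implicit Type U : forall j, {linear Q j -> Q i} -> Prop.

(** The invariant carried from layer to layer: membership of a map on [Theta j] can be tested after
    pulling it back to [X]. It allows subfunctors to be compared one [Theta j] at a time. *)
Definition reflects U : Prop :=
  forall L X j (f : {linear L -> X}) (p : {linear X -> Theta j}),
    filt Theta predT L -> injective f -> exact f p -> surjective p ->
  forall h : {linear Theta j -> Q i}, fac U (h \o p) -> fac U h.

Section Step.
Variable U : forall j, {linear Q j -> Q i} -> Prop.
Variables (k : I) (u : {linear Q k -> Q i}).
Hypothesis U_reflects : reflects U.
Hypothesis u_rad : radmaps le u.
Hypothesis u_new : ~ fac U u.
Hypothesis u_min : forall j (v : {linear Q j -> Q i}),
  strict_part le j k -> radmaps le v -> fac U v.
Hypothesis u_socle : forall f : {linear Q k -> Q k}, ~ bijective f ->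
  fac U (u \o f).

(** For a radical map [v : Q j -> Q k], the case [j = k] is [u_socle] and the case [j < k] is the
    minimality [u_min]. *)
Lemma layer_sub X (g : {linear X -> Q k}) : fac (@radmaps _ _ Q le k) g ->
  fac U (u \o g).
Proof.
move=> fg; apply: (fac_postcomp (p := u) _ fg) => // j v [jk nv].
have [ejk|njk] := eqVneq j k.
  by move/esym: ejk => ekj; case: j / ekj v jk nv => v _; apply: u_socle.
apply: u_min; rewrite /strict_part ?njk //; split.
  by have [_ _ trle _] := le_order; apply: trle jk u_rad.1.
exact: nonbij_postcomp.
Qed.

(** For [j < k], [g] extends to a radical map [Q j -> Q k]; for [k < j] it is zero. For [j = k], a
    bijective extension [v] of [g] would put [u] itself into the subfunctor. *)
Lemma layer_Theta j (g : {linear Theta j -> Q k}) :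
  fac U (u \o g) -> fac (@radmaps _ _ Q le k) g.
Proof.
move=> ug; have [rle _ _ totle] := le_order.
have [jk|] := boolP (strict_part le j k).
  have [io ioP] := Theta_map_extend k j; have [v vE] := ioP g.
  apply: (facM (u := v) (g := io)) => //; move/andP: jk => [njk jk]; split=> //.
  by apply: nonbij_neq => //; apply/eqP.
rewrite /strict_part negb_and negbK => jk.
have [ejk|njk] := eqVneq j k; last first.
  apply: fac0; apply: hom_Theta_Q; rewrite /strict_part eq_sym njk.
  by move: jk (totle j k); rewrite (negPf njk) /= => /negPf->.
move/esym: ejk => ekj; case: j / ekj g ug jk => g ug _.
have [Z [io [p [fZ injio iop surp]]]] := Theta_in k.
have ext l (w : {linear Theta k -> Q l}) : exists w' : {linear Q k -> Q l},
  forall x, w' (io x) = w x.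
  apply: (@extends_filt _ _ Theta _ (Q l) _ _ fZ _ _ io p w injio iop surp).
  by move=> m _; apply: Theta_extends.
have [v vE] := ext _ g; have [bv|nbv] := pselect (bijective v); last first.
  by apply: (facM (u := v) (g := io)) => //; split.
exfalso; apply: u_new.
(* [u \o v] is the extension [s] plus a map through [Z]; only indices below [k] occur in [Z], and
   there minimality applies. *)
have [s fs sE] := fac_extend ext ug.
have [|d dE] := @factor_surj _ _ _ _ p ((u \o v) \+ (GRing.opp \o s)) surp.
  by move=> x /iop[y <-]; rewrite /= sE /= vE subrr.
have fd : fac U d.
  apply: fac_trans (Theta_fac d fZ) => l w lj; apply: u_min => //.
  have [_ _ trle _] := le_order; have [ji _] := u_rad; case/andP: (lj) =>
    nlj llj.
  split; first exact: trle llj ji.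
  apply: nonbij_neq => // eli; case/negP: nlj; apply/eqP.
  have [_ ale _ _] := le_order; apply: ale; rewrite llj.
  by rewrite eli.
have [v' [vK Kv]] := linear_bij_inv bv.
apply: (facD (h1 := d \o (p \o v')) (h2 := s \o v')).
- exact: fac_precomp fd _.
- exact: fac_precomp fs _.
by move=> x; rewrite /= dE /= Kv subrK.
Qed.

(** Correct [g] by an extension of its restriction to [L]; what remains factors through [Theta j],
    where [U_reflects] and [layer_Theta] apply. *)
Lemma layer_sup X (g : {linear X -> Q k}) :
  filt Theta predT X -> fac U (u \o g) -> fac (@radmaps _ _ Q le k) g.
Proof.
move=> fX; elim: fX g => {X} [X X0 g _|L X j fL IH _ [f [p [injf fp surp]]] g
  ug].
  by apply: fac0 => x; rewrite (X0 x) linear0.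
have fgf : fac (@radmaps _ _ Q le k) (g \o f) by apply: IH;
  apply: fac_precomp ug _.
have [|g' fg' g'E] := @fac_extend _ _ _ _ _ _ _ f (g \o f) _ fgf.
  by move=> l w; apply: Theta_extends injf fp surp.
have [|n nE] := @factor_surj _ _ _ _ p (g \+ (GRing.opp \o g')) surp.
  by move=> x /fp[l <-]; rewrite /= g'E subrr.
have fn : fac (@radmaps _ _ Q le k) n.
  apply: layer_Theta; apply: (U_reflects fL injf fp surp).
  apply: (fac_sub ug (layer_sub fg')) => x.
  by rewrite /= nE /= linearB.
apply: (facD (h1 := n \o p) (h2 := g')) => // [|x];
  last by rewrite /= nE /= subrK.
exact: fac_precomp fn _.
Qed.

(** [U] together with [u]; the cast only expresses that [j] is [k]. *)
Definition add_map j (v : {linear Q j -> Q i}) : Prop :=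
  U v \/ exists e : k = j, v =1 u \o (fun x => ecast l (Q l) (esym e) x).

Lemma add_map_u : add_map u.
Proof. by right; exists erefl. Qed.

Lemma fac_add_map X (h : {linear X -> Q i}) :
  fac add_map h <-> exists (g : {linear X -> Q k}) (s : {linear X -> Q i}),
    fac U s /\ forall x, h x = s x + u (g x).
Proof.
split=> [|[g [s [fs hE]]]]; last first.
  apply: (facD (h1 := s) (h2 := u \o g)) => //.
    by apply: fac_trans fs => j v Uv; apply: fac_gen; left.
  exact: (facM (u := u) (g := g) add_map_u).
elim=> {h} [h h0|h h1 h2 _ [g1 [s1 [f1 h1E]]] _ [g2 [s2 [f2 h2E]]] hE|j v g h
  [Uv|[e vE]] hE].
- exists \0, \0; split; first exact: fac0.
  by move=> x; rewrite h0 /= linear0 addr0.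
- exists (g1 \+ g2), (s1 \+ s2); split; first exact: facD f1 f2 _.
  by move=> x; rewrite hE h1E h2E /= linearD addrACA.
- exists \0, h; split; first exact: (facM (g := g) Uv).
  by move=> x; rewrite /= linear0 addr0.
case: j / e v g vE hE => v g vE hE; exists g, \0; split; first exact: fac0.
by move=> x; rewrite hE vE /= add0r.
Qed.

(** In [h \o p = s + u \o g], the restriction of [g] to [L] is radical because [u \o g = - s] there.
    Corrected by an extension, [g] factors through some [n] on [Theta j], and [U_reflects] applies
    to [h - u \o n]. *)
Lemma add_map_reflects : reflects add_map.
Proof.
move=> L X j f p fL injf fp surp h /fac_add_map[g [s [fs hE]]].
have pf x : p (f x) = 0 by apply/fp; exists x.
have fgf : fac (@radmaps _ _ Q le k) (g \o f).
  apply: layer_sup => //; have f0 : fac U (\0 : {linear L ->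
    Q i}) by apply: fac0.
  apply: (fac_sub f0 (fac_precomp (k := f) (h' := s \o f) fs _)) => // x.
  have := hE (f x); rewrite /= pf linear0 => /esym/eqP.
  by rewrite addrC addr_eq0 => /eqP->; rewrite sub0r.
have [|g' fg' g'E] := @fac_extend _ _ _ _ _ _ _ f (g \o f) _ fgf.
  by move=> l w; apply: Theta_extends injf fp surp.
have [|n nE] := @factor_surj _ _ _ _ p (g \+ (GRing.opp \o g')) surp.
  by move=> x /fp[l <-]; rewrite /= g'E subrr.
apply/fac_add_map; exists n, (h \+ (GRing.opp \o (u \o n))); split; last first.
  by move=> x; rewrite /= subrK.
apply: (U_reflects fL injf fp surp).
apply: (facD (h1 := s) (h2 := u \o g') fs (layer_sub fg')) => x.
have := hE x; rewrite /= nE /= linearB => ->.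
by rewrite opprB addrACA subrr addr0.
Qed.

(** The new layer is [P k] modulo the [g] with [u \o g] in the old submodule, and these form [K k]
    by [layer_sub] and [layer_sup]. *)
Lemma add_map_filt : le k i ->
  filt proper_delta (fun j => le j i) (submod (facS U)) ->
  filt proper_delta (fun j => le j i) (submod (facS add_map)).
Proof.
move=> ki fU; apply: filtS fU ki _.
apply: (@short_exact_generated _ _ _ _ _ (K k) (hom_post u)).
- move=> h /asboolP fh; apply/asboolP; apply: fac_trans fh => j v Uv.
  by apply: fac_gen; left.
- by move=> g; apply/asboolP; apply: (facM (u := u) (g := g : {linear QS ->
  Q k}) add_map_u).
- move=> h /asboolP/fac_add_map[g [s [fs hE]]]; exists (g : lin_hom QS (Q k)).
  apply/asboolP; apply: (fac_precomp (k := idfun) fs) => x.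
  rewrite -[LHS]/((h : {linear QS -> Q i}) x - u (g x)) hE; exact: addrK.
move=> g; pose g' : {linear QS -> Q k} := g; rewrite -[g]/(g' :
  P k) mem_rad_trace //.
split=> [fg|/asboolP ug]; first by apply/asboolP; apply: (fac_precomp (k :=
  idfun) (layer_sub fg)).
(* [layer_sup] asks for a source filtered by [Theta], so [g'] is examined on each summand [Q a]. *)
have fga a : fac (@radmaps _ _ Q le k) (g' \o dsum_inj Q a).
  apply: layer_sup; first exact: filt_sub (Q_Theta_filt a).
  exact: fac_precomp ug _.
pose F a : P k := (g' \o (dsum_inj Q a \o dsum_proj Q a) : {linear QS -> Q k}).
have -> : g' = \sum_a F a :> P k.
  apply: homP => x; rewrite [in LHS](dsum_sum (M := Q) x) linear_sum.
  apply: (@etrans _ _ (\sum_a (F a : {linear QS -> Q k}) x)) => //.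
  by elim/big_rec2: _ => // a y1 y2 _ ->.
apply: (big_ind (fun h : P k => fac (@radmaps _ _ Q le k) (h : {linear QS ->
  Q k}))).
- exact: fac0.
- by move=> k1 k2 f1 f2; apply: facD f1 f2 _.
- by move=> a _; apply: (fac_precomp (k := dsum_proj Q a) (fga a)).
Qed.

End Step.

Hypothesis acc : chain_cond true (P i).
Hypothesis dcc : chain_cond false (P i).

(** Take [k] minimal, then [u] generating a minimal submodule of [P i]. If [u \o f] were new, it
    would generate the same submodule, so [u = u \o f \o g] for some [g]; as [1 - f \o g] is onto,
    [u] would be zero. *)
Lemma choose_map U :
    (exists k (u : {linear Q k -> Q i}), radmaps le u /\ ~ fac U u) ->
  exists k (u : {linear Q k -> Q i}), [/\ radmaps le u, ~ fac U u,
    forall j (v : {linear Q j -> Q i}), strict_part le j k -> radmaps le v ->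
      fac U v &
    forall f : {linear Q k -> Q k}, ~ bijective f -> fac U (u \o f)].
Proof.
move=> /(strict_minimal le_order)[k [u0 [u0_rad u0_new]] kmin].
pose good (u : {linear Q k -> Q i}) := radmaps le u /\ ~ fac U u.
pose gens (u : {linear Q k -> Q i}) : submodule (P i) :=
  imagem (hom_post u : {linear P k -> P i}) (fullm _).
have [|S [u [u_rad u_new] SE] Smin] := @chain_extremal _ false (P i)
  (fun S => exists2 u, good u & S =i gens u) dcc.
  by exists (gens u0), u0.
exists k, u; split=> // [j v jk v_rad|f nbf].
  by apply: contrapT => v_new; apply: (kmin j jk); exists v.
apply: contrapT => uf_new; apply: u_new.
have uf_good : good (u \o f).
  split=> //; split; first exact: u_rad.1.
  by apply: nonbij_postcomp.
have sub : {subset gens (u \o f) <= S}.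
  move=> h /imagemP[g _ <-]; rewrite SE; apply/imagemP.
  by exists (f \o (g : {linear QS -> Q k}) : {linear QS -> Q k}) => //;
    apply: homP.
have eqS : gens (u \o f) =i S by apply: Smin => //; exists (u \o f).
have : (u \o dsum_proj Q k : {linear QS -> Q i}) \in gens (u \o f).
  by rewrite eqS SE; apply/imagemP; exists (dsum_proj Q k) => //; apply: homP.
move=> /imagemP[g _ gE].
have uE x : u (f ((g : {linear QS -> Q k}) (dsum_inj Q k x))) = u x.
  rewrite -[x in RHS](dsum_injE (M := Q)).
  exact: (congr1 (fun h : P i => (h : {linear QS -> Q i}) (dsum_inj Q k x)) gE).
have nbfg := nonbij_precomp Q_local Q_neq0 Q_iso
  (g := (g : {linear QS -> Q k}) \o dsum_inj Q k) nbf.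
have /bijP[_ sur] := Q_local (g :=
  idfun \+ (GRing.opp \o (f \o (g \o dsum_inj Q k)))) nbfg (fun _ => erefl).
apply: fac0 => x; have [y <-] := sur x.
by rewrite /= linearB uE subrr.
Qed.

(** Take a maximal filtered submodule among those given by reflecting families of radical maps; if
    it missed a radical map, [choose_map] and [add_map] would enlarge it. *)
Lemma rad_trace_filt : filt proper_delta (fun j => le j i) (submod (K i)).
Proof.
pose good (S : submodule (P i)) := exists U, [/\ S =i facS U, forall j (u :
  {linear Q j -> Q i}), U j u -> radmaps le u,
   reflects U & filt proper_delta (fun j => le j i) (submod (facS U))].
have [|S [U [SE Urad Urefl Ufilt]] Smax] :=
  @chain_extremal _ true (P i) good acc.
  (* The construction starts from the empty family, which yields only zero maps. *)
  have F0 X (h : {linear X -> Q i}) : fac (fun j (u : {linear Q j -> Q i}) =>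
    False) h -> forall x, h x = 0.
    elim=> {h} [h h0 //|h h1 h2 _ z1 _ z2 hE x|//].
    by rewrite hE z1 z2 addr0.
  exists (facS (fun j (u : {linear Q j -> Q i}) => False)).
  exists (fun j (u : {linear Q j -> Q i}) => False); split=> //.
    move=> L X j f p _ _ _ surp h /F0 hp; apply: fac0 => x.
    by have [y <-] := surp x; apply: hp.
  by apply: filt0; apply: sub_of_zero => h /asboolP/F0 h0; apply: homP.
have all_rad j (v : {linear Q j -> Q i}) : radmaps le v -> fac U v.
  move=> v_rad; apply: contrapT => v_new.
  have [|k [u [u_rad u_new u_min u_socle]]] := @choose_map U;
    first by exists j, v.
  have ST : {subset S <= facS (add_map U u)}.
    move=> h; rewrite SE => /asboolP fh; apply/asboolP; apply: fac_trans fh =>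
      l w Uw.
    by apply: fac_gen; left.
  have gT : good (facS (add_map U u)).
    exists (add_map U u); split=> //.
    - move=> l w [/Urad //|[e]]; case: l / e w => w wE.
      case: u_rad => ki nu; split=> // bw; apply: nu.
      by apply: (eq_bij bw) => x; rewrite wE.
    - exact: add_map_reflects.
    - by apply: add_map_filt => //; apply: u_rad.1.
  have eqT := Smax _ gT ST.
  have : (u \o dsum_proj Q k : {linear QS -> Q i}) \in facS (add_map U u).
    by apply/asboolP; apply: (facM (u := u) (g :=
      dsum_proj Q k) (add_map_u U u)).
  rewrite eqT SE => /asboolP fu; apply: u_new.
  by apply: (fac_precomp (k := dsum_inj Q k) fu) => x; rewrite /= dsum_injE.
have eqK : facS U =i K i.
  move=> h; pose h' : {linear QS -> Q i} := h; rewrite -[h]/(h' : P i).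
  apply/idP/idP => [/asboolP fh|/mem_rad_trace fh].
    by apply/mem_rad_trace => //; apply: fac_trans fh => j u /Urad;
      apply: fac_gen.
  apply/asboolP; apply: fac_trans (fh _ _ _) => //.
have [|f fE] := @factor_inj _ _ _ _ (inclm (K i)) (inclm (facS U)) (@inclm_inj
  _ _ _).
  by move=> x; apply: inclmP; rewrite -eqK; apply: inclm_in.
apply: filt_iso Ufilt; exists f; apply/bijP; split=> [x y fxy|y].
  by apply: inclm_inj; rewrite -!fE fxy.
have [|x xE] := @inclmP _ _ (facS U) (inclm _ y); first by rewrite eqK;
  apply: inclm_in.
by exists x; apply: inclm_inj; rewrite fE.
Qed.

End Layer.
End Stratification.

(** * From the homological conditions to a proper costratifying system *)

Section Costratification.
Variables (A : pzRingType) (I : finType) (Q : I -> lmodType A) (le : rel I).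
Hypothesis Q_local : forall i (f g : {linear Q i -> Q i}),
  ~ bijective f -> (forall x, g x = x - f x) -> bijective g.
Hypothesis Q_neq0 : forall i, ~ zero_module (Q i).
Hypothesis Q_iso : forall i j, isomorphic (Q i) (Q j) -> i = j.
Local Notation QS := (dsumm Q).
Local Notation P i := (homm Q (Q i)).
Local Notation K := (rad_trace Q le).
Local Notation Delta := (proper_delta Q le).
Hypothesis le_refl : reflexive le.
Hypothesis rad_trace_filt : forall i,
  filt Delta (fun j => le j i) (submod (K i)).
Hypothesis Delta_Tor : forall i, Tor1_eq0 QS (Delta i).

Definition GDelta i : lmodType A := tensm (Delta i).
Hypothesis GDelta_lifts : forall i, lifts QS (GDelta i).
Implicit Types M N : lmodType (opendo QS).

Lemma tensm_zero M : zero_module M -> zero_module (tensm M).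
Proof.
move=> M0; apply: tens_ind => [//|q m|x y -> ->]; last by rewrite addr0.
by rewrite (M0 m) tens0r.
Qed.

(** Vanishing of Tor on the top factor keeps each filtration step exact on the left. *)
Lemma tensor_filt S M : filt Delta S M -> filt GDelta S (tensm M).
Proof.
elim=> {M} [M M0|L M j _ IH Sj [f [g [injf fg surg]]]].
  exact/filt0/tensm_zero.
apply: filtS IH Sj _; exists (tmap f), (tmap g); split.
- exact: Tor1_eq0_inj (@Delta_Tor j) injf fg surg.
- exact: tmap_exact.
- exact: tmap_surj.
Qed.

Lemma lifts_tensor_filt S M : filt Delta S M -> lifts QS (tensm M).
Proof. by move=> /tensor_filt; apply: lifts_filt => j _;
  apply: GDelta_lifts. Qed.

Lemma quo_K_ses i : [/\ injective (inclm (K i)),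
  exact (inclm (K i)) (quo_proj (K i) : P i ->
    Delta i) & surjective (@quo_proj _ _ (K i))].
Proof.
split; [exact: inclm_inj | | exact: quo_proj_surj].
by move=> y; rewrite quo_proj_eq0; split=> [/inclmP //|[u <-]]; exact: inclm_in.
Qed.

Definition GK_in i : {linear tensm (submod (K i)) -> Q i} :=
  ev QS (Q i) \o tmap (inclm (K i)).

Lemma GK_in_inj i : injective (GK_in i).
Proof.
have [injK exK surK] := quo_K_ses i.
apply: (inj_comp (bij_inj (ev_bij Q i))).
exact: Tor1_eq0_inj (@Delta_Tor i) injK exK surK.
Qed.

Lemma GDelta_proj_exists i : exists q : {linear Q i -> GDelta i},
  [/\ surjective q, exact (GK_in i) q &
      forall (h : {linear QS -> Q i}) z, q (h z) = tens z (quo_proj (K i) (h :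
        P i))].
Proof. exact: tens_quo. Qed.

Definition GDelta_proj i := sval (cid (GDelta_proj_exists i)).
Local Notation q i := (GDelta_proj i).

Lemma GDelta_proj_surj i : surjective (q i).
Proof. by have [] := svalP (cid (GDelta_proj_exists i)). Qed.
Lemma GDelta_proj_exact i : exact (GK_in i) (q i).
Proof. by have [] := svalP (cid (GDelta_proj_exists i)). Qed.
Lemma GDelta_projE i (h : {linear QS -> Q i}) z :
  q i (h z) = tens z (quo_proj (K i) (h : P i)).
Proof. by have [_ _] := svalP (cid (GDelta_proj_exists i)); apply. Qed.

Lemma GDelta_ses i : short_exact (tensm (submod (K i))) (Q i) (GDelta i).
Proof.
exists (GK_in i), (q i); split; [exact: GK_in_inj | exact: GDelta_proj_exact |
  exact: GDelta_proj_surj].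
Qed.

Lemma GDelta_exact i : exists2 Z : lmodType A,
  filt GDelta (fun j => le j i) Z & short_exact Z (Q i) (GDelta i).
Proof.
exists (tensm (submod (K i))); [exact/tensor_filt/rad_trace_filt |
  exact: GDelta_ses].
Qed.

Lemma lift_to_Q (X : lmodType A) j (f : {linear X -> GDelta j}) :
    lifts X (tensm (submod (K j))) ->
  exists g : {linear X -> Q j}, forall x, q j (g x) = f x.
Proof.
move=> lX; apply: (lX _ _ (GK_in j) (q j)).
- exact: GK_in_inj.
- exact: GDelta_proj_exact.
- exact: GDelta_proj_surj.
Qed.

(** [u x] is a value of [u] composed with the projection onto [Q i]; this composite lies in [K j],
    so its class vanishes. *)
Lemma GDelta_proj_radmap i j (u : {linear Q i -> Q j}) :
  radmaps le u -> forall x, q j (u x) = 0.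
Proof.
move=> u_rad x; have := GDelta_projE (u \o dsum_proj Q i) (dsum_inj Q i x).
rewrite /= dsum_injE => ->.
suff /quo_proj_eq0-> : (u \o dsum_proj Q i : {linear QS ->
  Q j}) \in K j by rewrite tens0r.
by apply/mem_rad_trace => //; apply: (facM (u := u) (g := dsum_proj Q i)).
Qed.

Lemma GDelta_map i j (f : {linear GDelta i -> GDelta j}) :
  exists phi : {linear Q i -> Q j}, forall x, q j (phi x) = f (q i x).
Proof.
have [|g gE] := @lift_to_Q (Q i) j (f \o q i); last by exists g.
by apply: (lifts_dsum Q _).2; apply: lifts_tensor_filt (rad_trace_filt j).
Qed.

Lemma GDelta_hom i j : strict_part le i j ->
  forall f : {linear GDelta i -> GDelta j}, f =1 \0.
Proof.
move=> /andP[/eqP nij ij] f y; have [x <-] := @GDelta_proj_surj i y.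
have [phi phiE] := GDelta_map f; rewrite -phiE GDelta_proj_radmap //.
by split=> //; apply: nonbij_neq.
Qed.

(** Surjectivity of the unit [M -> Hom(Q, Q (x) M)]. *)
Lemma unit_surj S M (h : {linear QS -> tensm M}) :
  filt Delta S M -> exists m : M, forall z, h z = tens z m.
Proof.
move=> fM; elim: fM h => {M} [M M0 h|L M j fL IH Sj [f [g [injf fg surg]]] h].
  by exists 0 => z; rewrite tens0r; apply: (tensm_zero M0).
have [|phi phiE] := @lift_to_Q QS j (tmap g \o h).
  exact: lifts_tensor_filt (rad_trace_filt j).
have [m mE] := surg (quo_proj (K j) (phi : P j)).
(* [c] is the unit at a lift [m] of the top component; [h - c] takes values in [Q (x) L], where
   induction applies. *)
have [c cE] : exists c : {linear QS -> tensm M}, forall z, c z = tens z m.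
  apply: linear_pack => a x y; rewrite tensDl; congr (_ + _).
  by rewrite -tensZ_tens.
have injtf := Tor1_eq0_inj (@Delta_Tor j) injf fg surg.
have [|k kE] := @factor_inj _ _ _ _ (tmap f) (h \+ (GRing.opp \o c)) injtf.
  move=> z; apply/(tmap_exact fg surg); rewrite /= linearB cE.
  have := phiE z; rewrite GDelta_projE /= => <-.
  by rewrite tmap_tens mE subrr.
have [l lE] := IH k; exists (m + f l) => z.
have := kE z; rewrite lE /= tmap_tens cE tensDr => ->.
by rewrite addrC subrK.
Qed.

(** Otherwise the projection onto [Q i] factors through [G (K i)], hence by [unit_surj] lies in
    [K i] and in the radical, although it splits. *)
Lemma GDelta_neq0 i : ~ zero_module (GDelta i).
Proof.
move=> G0; have [|k kE] :=
  @factor_inj _ _ _ _ (GK_in i) (dsum_proj Q i) (@GK_in_inj i).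
  by move=> x; apply/GDelta_proj_exact; apply: G0.
have [m mE] := unit_surj k (rad_trace_filt i).
have prK : (dsum_proj Q i : P i) = inclm (K i) m.
  apply: homP => z; rewrite -kE mE /GK_in /=.
  by rewrite tmap_tens ev_tens.
have : (dsum_proj Q i : P i) \in K i by rewrite prK; apply: inclm_in.
have radmap_rad (h : {linear QS -> Q i}) :
    fac (@radmaps _ _ Q le i) h -> (h : P i) \in radical (P i).
  elim=> {h} [h h0|h h1 h2 _ IH1 _ IH2 hE|j u g h [_ nu] hE].
  - by rewrite (_ : (h : P i) = 0) ?rpred0 //; apply: homP.
  - by rewrite (_ : (h : P i) = (h1 : P i) + h2) ?rpredD //; apply: homP.
  apply/mem_radicalP => // s bh.
  apply: (nonbij_precomp Q_local Q_neq0 Q_iso (g := g \o s) nu).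
  by apply: (eq_bij bh) => x; rewrite /= hE.
move=> /mem_rad_trace-/(_ Q_local Q_neq0 Q_iso)/radmap_rad/mem_radicalP.
move=> /(_ Q_local Q_neq0 Q_iso (dsum_inj Q i)); apply.
by exists id => x /=; rewrite dsum_injE.
Qed.

(** A nonzero [f] lifts to a map [phi] that is not radical, hence bijective; the inverse of [phi]
    preserves [K i] and so induces the inverse of [f]. *)
Lemma GDelta_division i : division_ring (endo (GDelta i)).
Proof.
split=> [e10|f f0].
  apply: (@GDelta_neq0 i) => x.
  exact: (congr1 (fun h : endo (GDelta i) => (h : {linear GDelta i ->
    GDelta i}) x) e10).
pose f' : {linear GDelta i -> GDelta i} := f.
have [phi phiE] := GDelta_map f'.
have [bphi|nphi] := pselect (bijective phi); last first.
  case: f0; apply: homP => y; have [x <-] := @GDelta_proj_surj i y.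
  rewrite -[LHS]phiE.
  by apply: GDelta_proj_radmap; split.
have [psi [phiK psiK]] := linear_bij_inv bphi.
have [|g gE] := @factor_surj _ _ _ _ (q i) (q i \o psi) (@GDelta_proj_surj i).
  move=> x /GDelta_proj_exact[y <-]; move: y; apply: tens_ind =>
    [|z h|y z py pz].
  - by rewrite !linear0.
  - rewrite /GK_in /= tmap_tens ev_tens.
    pose h' : {linear QS -> Q i} := inclm (K i) h.
    have := GDelta_projE (psi \o h') z; rewrite /= => ->.
    suff /quo_proj_eq0-> : (psi \o h' : {linear QS ->
      Q i}) \in K i by rewrite tens0r.
    have /mem_rad_trace-/(_ Q_local Q_neq0 Q_iso) fh : (h' : P i) \in K i :=
      inclm_in h.
    apply/mem_rad_trace => //; apply: (fac_postcomp (p := psi) _ fh) =>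
      // j u [ji nu].
    by apply: fac_gen; split=> //; apply: nonbij_postcomp.
  by rewrite !linearD py pz addr0.
exists (g : endo (GDelta i)); split; apply: homP => y; have [x <-] :=
  @GDelta_proj_surj i y.
  change (g (f' (q i x)) = q i x).
  by rewrite -phiE gE /= phiK.
change (f' (g (q i x)) = q i x).
by rewrite gE /= -phiE psiK.
Qed.

End Costratification.

(** * The equivalence and the uniqueness *)

Lemma extends_dsum (A : pzRingType) (I : finType) (F : I -> lmodType A)
    (U : lmodType A) i :
  extends U (dsumm F) -> extends U (F i).
Proof.
move=> eF M N f g u injf fg surg.
have [w wE] := eF _ _ f g (dsum_inj F i \o u) injf fg surg.
by exists (dsum_proj F i \o w) => x; rewrite /= wE /= dsum_injE.
Qed.

Theorem theorem5p4 (R : comNzRingType) (Lam : algType R) (t : nat)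
    (Theta Q : 'I_t -> lmodType Lam) (le : rel 'I_t)
    (hLam : artin_algebra Lam)
    (hQ : ext_injective_stratifying Theta Q le)
    (hiso : forall i j, isomorphic (Q i) (Q j) -> i = j) :
  let Qsum : lmodType Lam := dsum Q in
  let Gamma := opendo Qsum in
  let G (M : lmodType Gamma) : lmodType Lam := tensor M in
  let P (i : 'I_t) : lmodType Gamma := lin_hom Qsum (Q i) in
  let Delta := proper_standard P (opp_order le) in
  ((exists Psi : 'I_t -> lmodType Lam, proper_costratifying Psi Q le) <->
   (forall i, Tor1_eq0 Qsum (Delta i) /\ Ext1_eq0 Qsum (G (Delta i)))) /\
  (forall Psi : 'I_t -> lmodType Lam, proper_costratifying Psi Q le ->
     (forall i, isomorphic (Psi i) (G (Delta i))) /\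
     (forall Psi' : 'I_t -> lmodType Lam, proper_costratifying Psi' Q le ->
        forall i, isomorphic (Psi' i) (Psi i))).
Proof.
move=> Qsum Gamma G P Delta.
have DeltaE i : Delta i = proper_delta Q le i by [].
have GDeltaE i : G (Delta i) = GDelta Q le i by rewrite DeltaE.
have le_order := eiss_order hQ; have [le_refl _ _ _] := le_order.
have Q_fg i := (eiss_fin_gen hQ i).2.
have Q_neq0 i := (eiss_neq0 hQ i).2.
have Q_local i (f g : {linear Q i -> Q i}) :
    ~ bijective f -> (forall x, g x = x - f x) -> bijective g.
  exact: (nonbij_subr (chain_fg hLam (up := true) (Q_fg i))
    (chain_fg hLam (up := false) (Q_fg i)) (eiss_indecomposable hQ i)).
have pcs_lifts Psi : proper_costratifying Psi Q le -> forall i j,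
  lifts (Q i) (Psi j).
  by move=> hPsi i j; apply/Ext1_eq0_lifts/(pcs_ext hPsi).
have pcs_filt Psi : proper_costratifying Psi Q le -> forall i,
    exists2 Z : lmodType Lam,
      filt Psi (fun j => le j i) Z & short_exact Z (Q i) (Psi i).
  by move=> hPsi i; have [Z /filtered_filt fZ ses] := pcs_exact hPsi i;
    exists Z.
have Psi_iso Psi : proper_costratifying Psi Q le -> forall i,
  isomorphic (Psi i) (G (Delta i)).
  move=> hPsi i; rewrite GDeltaE.
  exact: (Psi_tensor Q_local Q_neq0 hiso le_order (pcs_division hPsi)
    (pcs_hom hPsi) (pcs_filt _ hPsi) (pcs_lifts _ hPsi)).
(* Uniqueness comes first: any two families are compared through [G (Delta i)]. *)
split; last first.
  move=> Psi hPsi; split=> [|Psi' hPsi'] i; first exact: Psi_iso.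
  apply: isomorphic_trans (Psi_iso _ hPsi' i) _.
  exact: isomorphic_sym (Psi_iso _ hPsi i).
split=> [[Psi hPsi] i|hDelta].
  split.
    rewrite DeltaE.
    exact: (Delta_Tor Q_local Q_neq0 hiso le_order (pcs_division hPsi)
      (pcs_hom hPsi) (pcs_filt _ hPsi) (pcs_lifts _ hPsi)).
  apply: lifts_Ext1_eq0; rewrite GDeltaE.
  exact: (Delta_lifts Q_local Q_neq0 hiso le_order (pcs_division hPsi)
    (pcs_hom hPsi) (pcs_filt _ hPsi) (pcs_lifts _ hPsi)).
have Theta_extends i j : extends (Theta j) (Q i).
  have ext : Ext1_eq0 (Theta j) (dsumm Q) := @eiss_ext _ _ _ _ _ hQ j.
  exact: extends_dsum (Ext1_eq0_extends ext).
have Theta_exact i : exists2 Z : lmodType Lam,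
    filt Theta (fun j => strict_part le j i) Z & short_exact (Theta i) (Q i) Z.
  by have [Z /filtered_filt fZ ses] := eiss_exact hQ i; exists Z.
have QS_fg : fin_gen (dsumm Q) := fin_gen_dsum Q_fg.
have KF i :
    filt (proper_delta Q le) (fun j => le j i) (submod (rad_trace Q le i)).
  exact: (rad_trace_filt Q_local Q_neq0 hiso le_order (eiss_hom hQ) Theta_exact
    Theta_extends
    (chain_hom hLam QS_fg (Q_fg i)) (chain_hom hLam QS_fg (Q_fg i))).
have Tor i : Tor1_eq0 (dsumm Q) (proper_delta Q le i) := (hDelta i).1.
have Ext i : lifts (dsumm Q) (GDelta Q le i).
  by rewrite -GDeltaE; apply/Ext1_eq0_lifts/(hDelta i).2.
(* By [Psi_iso], no other witness is possible up to isomorphism. *)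
exists (GDelta Q le); split=> //.
- move=> i; split=> //; apply: fin_gen_surj (Q_fg i).
  exact: (@GDelta_proj_surj _ _ Q le i).
- exact: eiss_indecomposable hQ.
- exact: (GDelta_division Q_local Q_neq0 hiso le_refl KF Tor Ext).
- exact: (GDelta_hom Q_local Q_neq0 hiso KF Tor Ext).
- move=> i; have [Z fZ ses] := GDelta_exact KF Tor i.
  by exists Z => //; apply: filt_filtered.
move=> i j; apply: lifts_Ext1_eq0; exact: ((lifts_dsum Q _).2 (Ext j) i).
Qed.
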